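(* Let $\lambda\in\mathbb{C}$ with $|\lambda|<1$ and let $V$ be the (almost everywhere defined) function on $[-1,1]$ that counts returns to the origin with weight $\lambda^{n+1}$, as defined in the context. Then the following hold. **(i)** Let $P(x)=\sum_{n=0}^N p_nx^n$ be a polynomial with $p_n\in\mathbb{C}$. Then $$\int_{-1}^1P(V(x))\,dx=\frac{2}{\prod_{n=1}^N\sqrt{1-\lambda^{2n}}}\,\det A,$$ where $A$ is the $(N+1)\times(N+1)$ matrix with rows $i=1,\dots,N+1$ and columns $m=0,\dots,N$ whose entries are, for $1\le i\le N$, $$A_{i,0}=1,\qquad A_{i,m}=\frac{\binom{i}{m}\lambda^{2m}}{1+\sqrt{1-\lambda^{2m}}}\ (1\le m<i),\qquad A_{i,i}=-\sqrt{1-\lambda^{2i}},\qquad A_{i,m}=0\ (m>i),$$ and, for the last row, $A_{N+1,m}=p_m$ $(0\le m\le N)$. In particular, for $N\ge1$, $$\int_{-1}^1V(x)^N\,dx=\frac{2}{\prod_{n=1}^N\sqrt{1-\lambda^{2n}}}\,\det\big(A_{i,m}\big)_{1\le i\le N,\ 0\le m\le N-1},$$ with the same entries $A_{i,m}$, $1\le i\le N$. Alternatively, for $N\ge1$, one has the recurrence $$\int_{-1}^1V(x)^N\,dx=\frac1{\sqrt{1-\lambda^{2N}}}\left(2+\sum_{n=1}^{N-1}\binom{N}{n}\big(1-\sqrt{1-\lambda^{2n}}\big)\int_{-1}^1V(x)^n\,dx\right).$$ Moreover, $$\big(1-\sqrt{1-\lambda^{2N}}\big)\int_{-1}^{1}V(x)^N\,dx=\int_{-1}^1(V(x)-1)^N\,dx,\qquad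 N\ge1,$$ and, for $N\ge1$, $$\int_{-1}^{1}V(x)^N\,dx=2\sum_{k\ge1}\ \sum_{N=N_0>N_1>\dots>N_k=0}(-1)^{N+k}\prod_{j=0}^{k-1}\binom{N_j}{N_{j+1}}\cdot\prod_{j=0}^{k-1}\big(1-\lambda^{2N_j}\big)^{-\frac12},$$ where the inner sum is over all strictly decreasing chains of integers $N=N_0>N_1>\dots>N_k=0$. **(ii)** Let $\mathcal{R}_{\pm}$ be the operators on $L^2(-1,1)$ given by $(\mathcal{R}_{\pm}h)(x)=h\!\left(\frac{x\pm1}2\right)$. Then for every $h\in L^2(-1,1)$ $$\int_{-1}^1 V(x)h(x)\,dx=\int_{-1}^1\oint_{|z|=1}\left(1-\lambda\frac{z^{-1}\mathcal{R}_-+z\mathcal{R}_+}2\right)^{-1}h(x)\,\frac{dz\,dx}{2\pi i z}.$$ Moreover, the $L^2\to L^2$ operator norm satisfies $\|z^{-1}\mathcal{R}_-+z\mathcal{R}_+\|\le 2$ for $|z|=1$. Instead of $L^2(-1,1)$ one may take $L^{\infty}(-1,1)$ (bounded functions) or $C([-1,1])$ (continuous functions). **(iii)** Let $N$ be even and let $P(x)=\sum_{n=0}^Np_nx^n$ be a polynomial with $p_n\in\mathbb{C}$. Then $$\int_{-1}^1V(x)P(x)\,dx=\sum_{j=0}^N\frac{2}{2^j\sqrt{1-\frac{\lambda^2}{4^j}}\ \prod_{0\le n\le N,\ n\ne j}\left(1-\frac{2^n}{2^j}\right)}\,\det B^{(j)},$$ where $B^{(j)}$ is the $(N+2)\times(N+2)$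 matrix with rows and columns indexed by $0,\dots,N+1$ whose entries are, for $0\le n\le N$ and $0\le m\le N$, $$B^{(j)}_{n,n}=1-\frac{2^n}{2^j},\qquad B^{(j)}_{n,m}=0\ (m>n),\qquad B^{(j)}_{n,m}=\begin{cases}\binom nm,& m<n,\ n-m\text{ even},\\ -\binom nm\sqrt{1-\frac{\lambda^2}{4^j}},& m<n,\ n-m\text{ odd},\end{cases}$$ with last column $B^{(j)}_{n,N+1}=\frac{2^n}{n+1}$ for even $n\le N$, $B^{(j)}_{n,N+1}=0$ for odd $n\le N$, and last row $B^{(j)}_{N+1,m}=-p_m$ $(0\le m\le N)$, $B^{(j)}_{N+1,N+1}=0$. In particular, for even $N\ge0$, $$\int_{-1}^1V(x)x^N\,dx=\sum_{j=0}^N\frac{2}{2^j\sqrt{1-\frac{\lambda^2}{4^j}}\ \prod_{0\le n\le N,\ n\ne j}\left(1-\frac{2^n}{2^j}\right)}\,\det \widetilde B^{(j)},$$ where $\widetilde B^{(j)}$ is the $(N+1)\times(N+1)$ matrix obtained from $B^{(j)}$ by deleting row $N+1$ and column $N$. If $N\ge0$ is odd, then $\int_{-1}^1V(x)x^N\,dx=0$. **(iv)** For $\omega\in\mathbb{C}$ we have $$\int_{-1}^1V(x)\cos(\omega x)\,dx=\frac1\pi\int_{-\pi}^{\pi}C(\varphi,\omega)\,d\varphi,$$ where $$C(\varphi,\omega)=\sum_{n=0}^{\infty}\lambda^n\,\frac{2^n}{\omega}\sin\frac{\omega}{2^n}\prod_{j=1}^n\cos\!\Big(\varphi+\frac{\omega}{2^j}\Big)$$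 $$=\frac{\sin\omega}{\omega}\cdot\cfrac{1}{1-\cfrac{\lambda\cos(\varphi+\frac{\omega}{2})}{\cos\frac{\omega}{2}+\lambda\cos(\varphi+\frac{\omega}{2})-\cfrac{\lambda\cos\frac{\omega}{2}\cos(\varphi+\frac{\omega}{4})}{\cos\frac{\omega}{4}+\lambda\cos(\varphi+\frac{\omega}{4})-\cfrac{\lambda\cos\frac{\omega}{4}\cos(\varphi+\frac{\omega}{8})}{\cos\frac{\omega}{8}+\lambda\cos(\varphi+\frac{\omega}{8})-\cdots}}}}.$$
   Context: Every $x\in[-1,1]$ outside a countable set of dyadic rationals has a unique expansion $$x=\frac{x_0}{2}+\frac{x_1}{2^2}+\frac{x_2}{2^3}+\cdots,\qquad x_n\in\{-1,+1\}.$$ For $\lambda\in\mathbb{C}$, $|\lambda|<1$, define (for almost every $x\in[-1,1]$) $$V(x)=1+\sum_{n=0}^{\infty}\lambda^{n+1}L_n(x),\qquad L_n(x)=\begin{cases}1,&\sum_{j=0}^nx_j=0,\\0,&\text{otherwise.}\end{cases}$$ $V$ is bounded, even and measurable; the values on the exceptional countable set do not affect the integrals. Conventions: $\sqrt{\cdot}$ and $(\cdot)^{-1/2}$ use the principal branch (all radicands have positive real part). Empty sums are $0$, empty products are $1$. $\binom nm$ are binomial coefficients. The circle $|z|=1$ is oriented counterclockwise. $L^2(-1,1)$ is the space of square integrable functions. In (ii), the inverse is the inverse of a bounded operator on the function space in question, applied to $h$. In (iv), for $\omega=0$ the quotients $\frac{\sin\omega}{\omega}$ and $\frac{2^n}{\omega}\sin\frac{\omega}{2^n}$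 are understood as their limit $1$. In (iv) the continued fraction has the form $\frac{1}{1-\frac{a_1}{b_1-\frac{a_2}{b_2-\cdots}}}$ with $a_1=\lambda\cos(\varphi+\frac\omega2)$, $a_n=\lambda\cos\frac{\omega}{2^{n-1}}\cos(\varphi+\frac{\omega}{2^n})$ for $n\ge2$, and $b_n=\cos\frac{\omega}{2^n}+\lambda\cos(\varphi+\frac{\omega}{2^n})$ for $n\ge1$.
   Formalization: In (iv), for nonzero ω with sin ω = 0 the continued fraction has vanishing denominators and the right-hand side reads 0·∞; there the equality is stated as the limit, as w tends to ω, of (sin w / w) times the continued fraction. *)

(* Defs.v *)
(* MathComp-Analysis; complex numbers are R[i] from mathcomp-real-closed. *)
From HB Require Import structures.
From mathcomp Require Import all_boot all_order all_algebra.
From mathcomp Require Import all_classical all_reals all_analysis.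
From mathcomp Require Import complex.

Set Implicit Arguments.
Unset Strict Implicit.
Unset Printing Implicit Defensive.

Import Order.TTheory GRing.Theory Num.Theory.
Import numFieldNormedType.Exports.

Local Open Scope classical_set_scope.
Local Open Scope ring_scope.

(* The topology of R[i] is carried by its copy R[i]^o. *)
Definition csum (R : realType) (u : nat -> R[i]) : R[i] :=
  limn (series (u : nat -> R[i]^o)).

Definition cmeasurable (R : realType) d (T : measurableType d)
    (D : set T) (f : T -> R[i]) : Prop :=
  measurable_fun D (fun x => complex.Re (f x)) /\
  measurable_fun D (fun x => complex.Im (f x)).

Definition cintegral (R : realType) (D : set R) (f : R -> R[i]) : R[i] :=
  Complex (\int[lebesgue_measure]_(x in D) complex.Re (f x))
          (\int[lebesgue_measure]_(x in D) complex.Im (f x)).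

Definition I11 (R : realType) : set R := `[-1, 1].

Definition cexp (R : realType) (z : R[i]) : R[i] :=
  Complex (expR (complex.Re z) * cos (complex.Im z))
          (expR (complex.Re z) * sin (complex.Im z)).

Definition ccos (R : realType) (z : R[i]) : R[i] :=
  (cexp ('i%C * z) + cexp (- ('i%C * z))) / 2.

Definition csin (R : realType) (z : R[i]) : R[i] :=
  (cexp ('i%C * z) - cexp (- ('i%C * z))) / (2 * 'i%C).

(* sin z / z with value 1 at 0; (2^n / omega) sin (omega / 2^n) is
   csinc (omega / 2^n). *)
Definition csinc (R : realType) (z : R[i]) : R[i] :=
  if z == 0 then 1 else csin z / z.

Definition unit_circle (R : realType) (t : R) : R[i] := cexp (Complex 0 t).

(* Contour integral over |z| = 1, counterclockwise: z = e^{it}, dz = i z dt. *)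
Definition circle_integral (R : realType) (f : R[i] -> R[i]) : R[i] :=
  cintegral `[0, 2 * pi]
    (fun t => f (unit_circle t) * ('i%C * unit_circle t)).

Definition is_expansion (R : realType) (x : R) (s : nat -> int) : Prop :=
  (forall n, s n = 1 \/ s n = -1) /\
  series (fun n => (s n)%:~R / 2 ^+ n.+1 : R) @ \oo --> x.

(* On [-1, 1] the expansion is unique except at countably many dyadic
   rationals, where one of the two expansions is chosen arbitrarily. *)
Definition digits (R : realType) (x : R) : nat -> int :=
  xget (fun=> 1) [set s | is_expansion x s].

Definition L_ (R : realType) (n : nat) (x : R) : R[i] :=
  if \sum_(j < n.+1) digits x j == 0 then 1 else 0.

Definition V (R : realType) (lambda : R[i]) (x : R) : R[i] :=
  1 + csum (fun n => lambda ^+ n.+1 * L_ n x).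

(* [sqrtc] is the principal branch; [sqrtC] of numClosedFieldType is not (it
   selects the root with nonnegative imaginary part). *)

(* The index [i] starts at 1. *)
Definition Aentry (R : realType) (lambda : R[i]) (i m : nat) : R[i] :=
  if m == 0 then 1
  else if (m < i)%N then
    'C(i, m)%:R * lambda ^+ (2 * m) / (1 + sqrtc (1 - lambda ^+ (2 * m)))
  else if m == i then - sqrtc (1 - lambda ^+ (2 * i))
  else 0.

Definition Amx (R : realType) (lambda : R[i]) (N : nat) (P : {poly R[i]}) :
    'M[R[i]]_N.+1 :=
  \matrix_(r < N.+1, m < N.+1)
    if (r < N)%N then Aentry lambda r.+1 m else P`_m.

Definition Amx_minor (R : realType) (lambda : R[i]) (N : nat) :
    'M[R[i]]_N :=
  \matrix_(r < N, m < N) Aentry lambda r.+1 m.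

Definition is_chain (N k : nat) (c : k.+1.-tuple 'I_N.+1) : bool :=
  [&& nth ord0 c 0 == ord_max, nth ord0 c k == ord0
    & sorted (fun a b : 'I_N.+1 => (b < a)%N) c].

Definition chain_term (R : realType) (lambda : R[i]) (N k : nat)
    (c : k.+1.-tuple 'I_N.+1) : R[i] :=
  (-1) ^+ (N + k)
  * (\prod_(j < k) 'C(nth ord0 c j, nth ord0 c j.+1)%:R)
  * \prod_(j < k) (sqrtc (1 - lambda ^+ (2 * nth ord0 c j)))^-1.

Definition Bentry (R : realType) (lambda : R[i]) (j n m : nat) : R[i] :=
  if m == n then 1 - 2 ^+ n / 2 ^+ j
  else if (n < m)%N then 0
  else if odd (n - m) then
    - ('C(n, m)%:R * sqrtc (1 - lambda ^+ 2 / 4 ^+ j))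
  else 'C(n, m)%:R.

Definition Bmx (R : realType) (lambda : R[i]) (N : nat) (P : {poly R[i]})
    (j : nat) : 'M[R[i]]_N.+2 :=
  \matrix_(n < N.+2, m < N.+2)
    if (n <= N)%N then
      if (m <= N)%N then Bentry lambda j n m
      else if odd n then 0 else 2 ^+ n / n.+1%:R
    else if (m <= N)%N then - P`_m else 0.

(* [Bmx] without row N+1 and column N; the deleted row is the only one that
   involves the polynomial. *)
Definition Bmx_minor (R : realType) (lambda : R[i]) (N j : nat) :
    'M[R[i]]_N.+1 :=
  row' ord_max (col' (inord N) (Bmx lambda N 'X^N j)).

Definition Bcoef (R : realType) (lambda : R[i]) (N j : nat) : R[i] :=
  2 / (2 ^+ j * sqrtc (1 - lambda ^+ 2 / 4 ^+ j)
       * \prod_(0 <= n < N.+1 | n != j) (1 - 2 ^+ n / 2 ^+ j)).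

(* A (semi)normed space of functions on [-1, 1]: its elements are represented
   by functions on R whose values outside [-1, 1] are irrelevant, and two
   representatives are identified when their difference has norm 0. *)
Record fspace (R : realType) := FSpace {
  fcarrier : set (R -> R[i]) ;
  fnorm : (R -> R[i]) -> \bar R }.

Definition feq (R : realType) (E : fspace R) (f g : R -> R[i]) : Prop :=
  fnorm E (fun x => f x - g x) = 0%E.

Definition LpI11_norm (R : realType) (p : \bar R) (h : R -> R[i]) : \bar R :=
  Lnorm lebesgue_measure p
    ((fun x => (complex.Re `|h x|)%:E) \_ (@I11 R)).

Definition LpI11 (R : realType) (p : \bar R) : fspace R :=
  FSpace [set h | cmeasurable (@I11 R) h /\ (LpI11_norm p h < +oo)%E]
         (LpI11_norm p).

Definition CI11 (R : realType) : fspace R :=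
  FSpace [set h | {within @I11 R, continuous (h : R -> R[i]^o)}]
         (fun h => ereal_sup [set (complex.Re `|h x|)%:E | x in @I11 R]).

Definition opnorm (R : realType) (E : fspace R)
    (T : (R -> R[i]) -> (R -> R[i])) : \bar R :=
  ereal_sup [set fnorm E (T h) | h in
               [set h | fcarrier E h /\ (fnorm E h <= 1)%E]].

Definition bounded_op (R : realType) (E : fspace R)
    (T : (R -> R[i]) -> (R -> R[i])) : Prop :=
  [/\ forall h, fcarrier E h -> fcarrier E (T h),
      forall (a : R[i]) h k, fcarrier E h -> fcarrier E k ->
        feq E (T (fun x => a * h x + k x)) (fun x => a * T h x + T k x)
    & (opnorm E T < +oo)%E].

Definition is_inverse_op (R : realType) (E : fspace R)
    (T S : (R -> R[i]) -> (R -> R[i])) : Prop :=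
  bounded_op E S /\
  forall h, fcarrier E h -> feq E (T (S h)) h /\ feq E (S (T h)) h.

Definition Rminus (R : realType) (h : R -> R[i]) : R -> R[i] :=
  fun x => h ((x - 1) / 2).

Definition Rplus (R : realType) (h : R -> R[i]) : R -> R[i] :=
  fun x => h ((x + 1) / 2).

Definition Mop (R : realType) (z : R[i]) (h : R -> R[i]) : R -> R[i] :=
  fun x => z^-1 * Rminus h x + z * Rplus h x.

Definition Top (R : realType) (lambda z : R[i]) (h : R -> R[i]) : R -> R[i] :=
  fun x => h x - lambda * (Mop z h x / 2).

(* An element of L^2 or L^oo has no value at a point, so the inner integral of
   (S z h)(x) in z makes sense for (almost) every x only for representatives
   that are jointly measurable in (z, x). *)
Definition circle_measurable (R : realType) (G : R[i] -> R -> R[i]) : Prop :=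
  cmeasurable (`[0, 2 * pi] `*` @I11 R)
    (fun p : R * R => G (unit_circle p.1) p.2).

Definition Cfun_term (R : realType) (lambda : R[i]) (phi : R) (omega : R[i])
    (n : nat) : R[i] :=
  lambda ^+ n * csinc (omega / 2 ^+ n)
  * \prod_(1 <= j < n.+1) ccos (phi%:C%C + omega / 2 ^+ j).

Definition Cfun (R : realType) (lambda : R[i]) (phi : R) (omega : R[i]) :
    R[i] :=
  csum (Cfun_term lambda phi omega).

(* Numerators and denominators of the convergents of
     1 / (1 - a_1 / (b_1 - a_2 / (b_2 - ...)))
   satisfy X_n = b_n X_(n-1) - a_n X_(n-2), with X_(-1), X_0 = 0, 1 for the
   numerators and 1, 1 for the denominators; the n-th convergent is
     1 / (1 - a_1 / (b_1 - ... - a_n / b_n)). *)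
Fixpoint cfrac_rec (K : fieldType) (a b : nat -> K) (u v : K) (n : nat) :
    K * K :=
  if n is m.+1 then
    let: (x, y) := cfrac_rec a b u v m in (y, b m.+1 * y - a m.+1 * x)
  else (u, v).

Definition cfrac_num (K : fieldType) (a b : nat -> K) (n : nat) : K :=
  (cfrac_rec a b 0 1 n).2.

Definition cfrac_den (K : fieldType) (a b : nat -> K) (n : nat) : K :=
  (cfrac_rec a b 1 1 n).2.

Definition cfrac_cvg (R : realType) (a b : nat -> R[i]) (l : R[i]) : Prop :=
  (\forall n \near \oo, cfrac_den a b n != 0) /\
  (fun n => cfrac_num a b n / cfrac_den a b n : R[i]^o) @ \oo
    --> (l : R[i]^o).

Definition cfrac_val (R : realType) (a b : nat -> R[i]) : R[i] :=
  limn (fun n => cfrac_num a b n / cfrac_den a b n : R[i]^o).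

(* The coefficients are only used for n >= 1. *)
Definition cfa (R : realType) (lambda : R[i]) (phi : R) (omega : R[i])
    (n : nat) : R[i] :=
  if n == 1 then lambda * ccos (phi%:C%C + omega / 2)
  else lambda * ccos (omega / 2 ^+ n.-1) * ccos (phi%:C%C + omega / 2 ^+ n).

Definition cfb (R : realType) (lambda : R[i]) (phi : R) (omega : R[i])
    (n : nat) : R[i] :=
  ccos (omega / 2 ^+ n) + lambda * ccos (phi%:C%C + omega / 2 ^+ n).

(* Main.v *)
Require Import Defs.
From HB Require Import structures.
From mathcomp Require Import all_boot all_order all_algebra.
From mathcomp Require Import all_classical all_reals all_analysis.
From mathcomp Require Import complex measurable_realfun ess_sup_inf ring lra zify.
Set Implicit Arguments.
Unset Strict Implicit.
Unset Printing Implicit Defensive.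
Import Order.TTheory GRing.Theory Num.Theory.
Import numFieldNormedType.Exports ComplexField.Normc.
Local Open Scope classical_set_scope.
Local Open Scope ring_scope.

(* Off the dyadic rationals V = W_0, where W_k counts, with weights lambda^n,
   the visits to 0 of the digit walk started at k, and
   W_k((x + e) / 2) = [k = 0] + lambda W_(k+e)(x) for e = 1, -1.

   (i) For k <> 0 the moments m_k of W_k^N satisfy
   2 m_k = lambda^N (m_(k+1) + m_(k-1)). Only one of the two geometric solutions
   is bounded, so m_1 and m_(-1) are multiples of m_0; thus the moments of V and
   of V - 1 are proportional, and the binomial theorem gives the recurrence, from
   which the determinant follows by Cramer's rule.

   (iii) The moments of W_k x^n, 0 <= n <= N, satisfy a triangular system of such
   recurrences. Its bounded solutions are spanned by t_j^k v_j, where v_j spans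
   the kernel of a triangular matrix T_j; pairing with the left kernel of T_j
   gives the coefficients, and the bordered determinant det B^(j) is the product
   of the two pairings and of the nonzero diagonal entries of T_j. For odd n the
   system is invariant under k -> -k up to sign.

   (ii) The integral over |z| = 1 of z^(digit sum) selects the returns to 0. The
   inverse is a Neumann series, dominated pointwise by the corresponding series of
   averages of |h|. Two inverses agree up to null functions, because iterating
   the resolvent equation under the integral leaves a remainder O(lambda^n).

   (iv) The operators in (ii) send x -> exp(i w x) to a multiple of
   x -> exp(i w x / 2). The convergents of the continued fraction, times
   sin(omega) / omega, are the partial sums of the series C. *)

(** * Complex series, measurability and integrals *)

(** A single halving of the interval moves the walk to height 1 or -1, so [V] alone satisfies no
    closed equation. All heights k are therefore carried along, at the price of second order
    recurrences in k that lack an initial value; boundedness uniform in k supplies it.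
    Characteristic roots are kept multiplied out, as in (1 + s) m_1 = mu m_0, so lambda = 0 needs no
    separate treatment. The computations take place on [-1, 1[, where the two halves are disjoint
    and the halving identities hold at every point. The endpoint 1 and the dyadic rationals enter
    only as a null set at the very end. In (ii) an inverse determines its values only almost
    everywhere and its norm is finite for each z separately, whereas Fubini requires a bound uniform
    in z. The resolvent equation provides one: integrate |g| <= |h| + |lambda| avg |g| and use that
    averaging preserves integrals. Joint measurability of the constructed inverse is obtained by
    cutting the Neumann series off where its majorant diverges; the majorant does not depend on
    z. *)

Section ComplexSeries.
Variable R : realType.
Implicit Types (z w l : R[i]) (u v : nat -> R[i]) (a : nat -> R).
Local Notation nrm := (@normc R).
Local Notation Re := (@complex.Re R).
Local Notation Im := (@complex.Im R).

Lemma normc_ge0 z : 0 <= nrm z.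
Proof. by case: z => x y; exact: sqrtr_ge0. Qed.

Lemma normcE z : `|z| = (nrm z)%:C%C. Proof. by []. Qed.

Lemma normcD z w : nrm (z + w) <= nrm z + nrm w.
Proof. by rewrite -lecR rmorphD /= -!normcE ler_normD. Qed.

Lemma normcB z w : nrm (z - w) = nrm (w - z).
Proof. by apply/complexI; rewrite -!normcE distrC. Qed.

Lemma normcX z n : nrm (z ^+ n) = nrm z ^+ n.
Proof.
elim: n => [|n IH]; first by rewrite !expr0 normc1.
by rewrite !exprS normcM IH.
Qed.

Lemma normcN1 : nrm (-1) = 1.
Proof. by apply: complexI; rewrite -normcE normrN1. Qed.

Lemma normc_Re z : `|Re z| <= nrm z.
Proof. by rewrite -lecR -normcE normc_ge_Re. Qed.

Lemma normc_Im z : `|Im z| <= nrm z.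
Proof.
by case: z => x y /=; rewrite -sqrtr_sqr ler_wsqrtr// lerDr sqr_ge0.
Qed.

Lemma normc_ReIm z : nrm z <= `|Re z| + `|Im z|.
Proof.
case: z => x y /=; rewrite -[leRHS]ger0_norm ?addr_ge0// -sqrtr_sqr ler_wsqrtr//.
by rewrite sqrrD !real_normK ?num_real// addrAC lerDl mulrn_wge0// mulr_ge0.
Qed.

Lemma normc_real (x : R) : nrm x%:C%C = `|x|.
Proof. by rewrite /= expr0n /= addr0 sqrtr_sqr. Qed.

Lemma normc_eq0 z : (nrm z == 0) = (z == 0).
Proof.
apply/eqP/eqP => [/eq0_normc//|->].
exact: normc0.
Qed.

Lemma normc_sum I (s : seq I) (P : pred I) (F : I -> R[i]) :
  nrm (\sum_(i <- s | P i) F i) <= \sum_(i <- s | P i) nrm (F i).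
Proof.
elim/big_rec2 : _ => [|i x y _ H]; first by rewrite normc0.
by rewrite (le_trans (normcD _ _))// lerD2l.
Qed.

Lemma ReD z w : Re (z + w) = Re z + Re w.
Proof. by case: z; case: w. Qed.
Lemma ImD z w : Im (z + w) = Im z + Im w.
Proof. by case: z; case: w. Qed.
Lemma ReN z : Re (- z) = - Re z. Proof. by case: z. Qed.
Lemma ImN z : Im (- z) = - Im z. Proof. by case: z. Qed.
Lemma ReB z w : Re (z - w) = Re z - Re w. Proof. by rewrite ReD ReN. Qed.
Lemma ImB z w : Im (z - w) = Im z - Im w. Proof. by rewrite ImD ImN. Qed.
Lemma ReM z w : Re (z * w) = Re z * Re w - Im z * Im w.
Proof. by case: z; case: w. Qed.
Lemma ImM z w : Im (z * w) = Re z * Im w + Im z * Re w.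
Proof. by case: z => a b; case: w => c d /=. Qed.

Lemma Re_sum I (s : seq I) (P : pred I) (F : I -> R[i]) :
  Re (\sum_(i <- s | P i) F i) = \sum_(i <- s | P i) Re (F i).
Proof. by elim/big_rec2 : _ => //= i x y _ <-; rewrite ReD. Qed.
Lemma Im_sum I (s : seq I) (P : pred I) (F : I -> R[i]) :
  Im (\sum_(i <- s | P i) F i) = \sum_(i <- s | P i) Im (F i).
Proof. by elim/big_rec2 : _ => //= i x y _ <-; rewrite ImD. Qed.

Section Cvg.
Variables (T : Type) (F : set_system T).
Context {FF : Filter F}.

(** An epsilon for the topology of [R[i]^o] is itself a complex number; being positive it is real,
    so convergence can be tested on the real moduli. *)
Lemma cvgc_normc (f : T -> R[i]) l :
  (fun x => f x : R[i]^o) @ F --> (l : R[i]^o) <->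
  (fun x => nrm (f x - l)) @ F --> (0 : R).
Proof.
split => [/cvgrPdist_le H|/cvgrPdist_le H].
  apply/cvgrPdist_le => e e0.
  have /H : (0 : R[i]) < e%:C%C by rewrite ltcR.
  apply: filterS => x.
  by rewrite normcE lecR sub0r normrN (ger0_norm (normc_ge0 _)) normcB.
apply/cvgrPdist_le => e e0.
have eE : e = (Re e)%:C%C by rewrite RRe_real// gtr0_real.
have : 0 < Re e by rewrite -ltcR -eE.
move=> /H; apply: filterS => x.
by rewrite sub0r normrN (ger0_norm (normc_ge0 _)) normcB eE normcE lecR.
Qed.

Lemma cvgcP (f : T -> R[i]) l :
  (fun x => f x : R[i]^o) @ F --> (l : R[i]^o) <->
  (fun x => Re (f x)) @ F --> Re l /\ (fun x => Im (f x)) @ F --> Im l.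
Proof.
rewrite cvgc_normc; split => [H|[/cvgrPdist_le H1 /cvgrPdist_le H2]].
  move/cvgrPdist_le : H => H.
  split; apply/cvgrPdist_le => e /H; apply: filterS => x;
    rewrite sub0r normrN (ger0_norm (normc_ge0 _)); apply: le_trans.
    by rewrite distrC -ReB normc_Re.
  by rewrite distrC -ImB normc_Im.
apply/cvgrPdist_le => e e0.
have e2 : 0 < e / 2 by rewrite divr_gt0.
apply: filterS2 (H1 _ e2) (H2 _ e2) => x.
rewrite sub0r normrN (ger0_norm (normc_ge0 _)) => h1 h2.
rewrite (le_trans (normc_ReIm _))// [leRHS]splitr ReB ImB.
by rewrite ![`|_ (f x) - _|]distrC lerD.
Qed.

End Cvg.

Lemma cvgc_lim u l :
  (u : nat -> R[i]^o) @ \oo --> (l : R[i]^o) -> limn (u : nat -> R[i]^o) = l.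
Proof. by move=> ul; apply/cvg_lim. Qed.

Lemma Re_series u n : Re (series u n) = series (fun k => Re (u k)) n.
Proof. by rewrite /series /= Re_sum. Qed.
Lemma Im_series u n : Im (series u n) = series (fun k => Im (u k)) n.
Proof. by rewrite /series /= Im_sum. Qed.

Section Dominated.
Variables (u : nat -> R[i]) (a : nat -> R).
Hypothesis ua : forall n, nrm (u n) <= a n.
Hypothesis ca : cvgn (series a).

Lemma dom_real_series (b : nat -> R) :
  (forall n, `|b n| <= a n) -> cvgn (series b).
Proof.
move=> ba; apply: normed_cvg; apply: series_le_cvg ca => // n.
  exact: normr_ge0.
exact: le_trans (normr_ge0 _) (ba n).
Qed.

Lemma csum_cvg : (series u : nat -> R[i]^o) @ \oo --> (csum u : R[i]^o).
Proof.
have cR : cvgn (series (fun k => Re (u k))).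
  by apply: dom_real_series => n; rewrite (le_trans (normc_Re _)).
have cI : cvgn (series (fun k => Im (u k))).
  by apply: dom_real_series => n; rewrite (le_trans (normc_Im _)).
have H : (series u : nat -> R[i]^o) @ \oo --> (Complex
    (limn (series (fun k => Re (u k)))) (limn (series (fun k => Im (u k)))) : R[i]^o).
  apply/cvgcP; split.
    by under eq_fun do rewrite Re_series.
  by under eq_fun do rewrite Im_series.
by rewrite /csum (cvgc_lim H).
Qed.

Lemma normc_cvg_le (f : nat -> R[i]) l (c : R) :
  (f : nat -> R[i]^o) @ \oo --> (l : R[i]^o) ->
  (\forall n \near \oo, nrm (f n) <= c) -> nrm l <= c.
Proof.
move=> /cvgc_normc fl fc.
apply/ler_addgt0Pr => e e0.
move/cvgrPdist_le : fl => /(_ _ e0) fl.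
near \oo => n.
have h1 : nrm (f n) <= c by near: n.
have h2 : nrm (f n - l) <= e.
  by rewrite -[nrm _]ger0_norm ?normc_ge0// -normrN -sub0r; near: n.
rewrite (_ : l = f n + (l - f n)); last by rewrite addrC subrK.
by rewrite (le_trans (normcD _ _))// lerD// normcB.
Unshelve. all: by end_near. Qed.

Lemma csum_le : nrm (csum u) <= limn (series a).
Proof.
apply: (normc_cvg_le csum_cvg); near=> n.
rewrite (le_trans (normc_sum _ _ _))//.
apply: (@le_trans _ _ (series a n)); first by apply: ler_sum.
apply: nondecreasing_cvgn_le => //.
by apply: nondecreasing_series => k _ _; rewrite (le_trans (normc_ge0 _) (ua k)).
Unshelve. all: by end_near. Qed.

End Dominated.

Lemma csum_lim u l :
  (series u : nat -> R[i]^o) @ \oo --> (l : R[i]^o) -> csum u = l.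
Proof. exact: cvgc_lim. Qed.

Lemma eq_csum u v : u =1 v -> csum u = csum v.
Proof. by move=> /funext ->. Qed.

Lemma csum0 : csum (fun=> 0 : R[i]) = 0.
Proof.
apply: csum_lim; apply/cvgcP; rewrite /series /=.
under eq_fun do rewrite big1//.
under [X in _ /\ (X @ _ --> _)]eq_fun do rewrite big1//.
by split; exact: cvg_cst.
Qed.

(** Absolute summability with a real majorant: the condition under which [csum], a mere [limn], is
    the limit of its partial sums. *)
Definition dominated u := exists2 a, (forall n, nrm (u n) <= a n) & cvgn (series a).

Lemma dominated_cvg_csum u : dominated u ->
  (series u : nat -> R[i]^o) @ \oo --> (csum u : R[i]^o).
Proof. by move=> [a ua ca]; exact: csum_cvg ua ca. Qed.

Lemma cvgcD T (F : set_system T) {FF : Filter F} (f g : T -> R[i]) l m :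
  (fun x => f x : R[i]^o) @ F --> (l : R[i]^o) ->
  (fun x => g x : R[i]^o) @ F --> (m : R[i]^o) ->
  (fun x => f x + g x : R[i]^o) @ F --> (l + m : R[i]^o).
Proof. exact: cvgD. Qed.

Lemma cvgc_cst T (F : set_system T) {FF : Filter F} l :
  (fun=> l : R[i]^o) @ F --> (l : R[i]^o).
Proof. exact: cvg_cst. Qed.

Lemma cvgcM T (F : set_system T) {FF : Filter F} (f g : T -> R[i]) l m :
  (fun x => f x : R[i]^o) @ F --> (l : R[i]^o) ->
  (fun x => g x : R[i]^o) @ F --> (m : R[i]^o) ->
  (fun x => f x * g x : R[i]^o) @ F --> (l * m : R[i]^o).
Proof.
move=> /cvgcP[f1 f2] /cvgcP[g1 g2]; apply/cvgcP; split.
  by under eq_fun do rewrite ReM; rewrite ReM; apply: cvgB; apply: cvgM.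
by under eq_fun do rewrite ImM; rewrite ImM; apply: cvgD; apply: cvgM.
Qed.

Lemma csumD u v : dominated u -> dominated v ->
  csum (fun n => u n + v n) = csum u + csum v.
Proof.
move=> du dv; apply: csum_lim; rewrite (_ : series _ = fun n => series u n + series v n).
  by apply: cvgcD; exact: dominated_cvg_csum.
by apply/funext => n; rewrite /series /= big_split.
Qed.

Lemma csumZ c u : dominated u -> csum (fun n => c * u n) = c * csum u.
Proof.
move=> du; apply: csum_lim; rewrite (_ : series _ = fun n => c * series u n).
  by apply: cvgcM; [exact: cvgc_cst|exact: dominated_cvg_csum].
by apply/funext => n; rewrite /series /= big_distrr.
Qed.

Lemma csum_recl u : dominated u -> csum u = u 0%N + csum (fun n => u n.+1).
Proof.
move=> du; suff H : (series (fun n => u n.+1) : nat -> R[i]^o) @ \oo -->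
    (csum u - u 0%N : R[i]^o) by rewrite (csum_lim H) addrC subrK.
rewrite (_ : series _ = fun n => series u n.+1 + - u 0%N); last first.
  by apply/funext => n; rewrite /series /= big_nat_recl// addrAC subrr add0r.
apply: (cvgcD (f := fun n => series u n.+1) (g := fun=> - u 0%N)).
  by have := dominated_cvg_csum du; rewrite -(cvg_shiftS (series u : nat -> R[i]^o)).
exact: cvgc_cst.
Qed.

Lemma dominatedZ c u : dominated u -> dominated (fun n => c * u n).
Proof.
move=> [a ua ca]; exists (nrm c *: a) => [n|].
  by rewrite normcM ler_wpM2l// normc_ge0.
by rewrite seriesZ; exact: is_cvgZr.
Qed.

Lemma dominated_geometric (c r : R) u : 0 <= r < 1 ->
  (forall n, nrm (u n) <= c * r ^+ n) -> dominated u.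
Proof.
move=> /andP[r0 r1] uc; exists (geometric c r) => //.
by apply: is_cvg_geometric_series; rewrite ger0_norm.
Qed.

Lemma csum_geometric_le (c r : R) u : 0 <= r < 1 ->
  (forall n, nrm (u n) <= c * r ^+ n) -> nrm (csum u) <= c / (1 - r).
Proof.
move=> /andP[r0 r1] uc; have r1' : `|r| < 1 by rewrite ger0_norm.
have := @csum_le u (geometric c r) uc (is_cvg_geometric_series r1').
by rewrite (cvg_lim _ (cvg_geometric_series r1')).
Qed.

End ComplexSeries.

Section ComplexMeasurable.
Context (R : realType) d (T : measurableType d).
Implicit Types (D : set T) (f g : T -> R[i]).

Lemma cmeasurable_cst D (c : R[i]) : cmeasurable D (fun=> c).
Proof. by split; exact: measurable_cst. Qed.

Lemma cmeasurableD D f g : cmeasurable D f -> cmeasurable D g ->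
  cmeasurable D (fun x => f x + g x).
Proof.
move=> [f1 f2] [g1 g2]; split.
  by under eq_fun do rewrite ReD; exact: measurable_funD.
by under eq_fun do rewrite ImD; exact: measurable_funD.
Qed.

Lemma cmeasurableM D f g : cmeasurable D f -> cmeasurable D g ->
  cmeasurable D (fun x => f x * g x).
Proof.
move=> [f1 f2] [g1 g2]; split.
  by under eq_fun do rewrite ReM; apply: measurable_funB; exact: measurable_funM.
by under eq_fun do rewrite ImM; apply: measurable_funD; exact: measurable_funM.
Qed.

Lemma cmeasurableZ D (c : R[i]) f : cmeasurable D f -> cmeasurable D (fun x => c * f x).
Proof. by move=> mf; apply: cmeasurableM => //; exact: cmeasurable_cst. Qed.

Lemma cmeasurableB D f g : cmeasurable D f -> cmeasurable D g ->
  cmeasurable D (fun x => f x - g x).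
Proof.
move=> mf mg; apply: (cmeasurableD mf); under eq_fun do rewrite -mulN1r.
exact: cmeasurableZ.
Qed.

Lemma cmeasurable_sum D I (s : seq I) (F : I -> T -> R[i]) :
  (forall i, cmeasurable D (F i)) ->
  cmeasurable D (fun x => \sum_(i <- s) F i x).
Proof.
move=> mF; elim: s => [|i s IH].
  by under eq_fun do rewrite big_nil; exact: cmeasurable_cst.
by under eq_fun do rewrite big_cons; exact: cmeasurableD.
Qed.

Lemma cmeasurableX D f n : cmeasurable D f -> cmeasurable D (fun x => f x ^+ n).
Proof.
move=> mf; elim: n => [|n IH].
  by under eq_fun do rewrite expr0; exact: cmeasurable_cst.
by under eq_fun do rewrite exprS; exact: cmeasurableM.
Qed.

Lemma cmeasurable_real D (f : T -> R) : measurable_fun D f ->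
  cmeasurable D (fun x => (f x)%:C%C).
Proof. by move=> mf; split => //; exact: measurable_cst. Qed.

Lemma cmeasurableS D E f : d.-measurable E -> D `<=` E ->
  cmeasurable E f -> cmeasurable D f.
Proof. by move=> mE DE [f1 f2]; split; apply: measurable_funS; eassumption. Qed.

Lemma eq_cmeasurable D f g : {in D, f =1 g} -> cmeasurable D f -> cmeasurable D g.
Proof.
move=> fg [f1 f2]; split.
  by apply: eq_measurable_fun f1 => x xD; rewrite fg.
by apply: eq_measurable_fun f2 => x xD; rewrite fg.
Qed.

Lemma measurable_normc D f : cmeasurable D f ->
  measurable_fun D (fun x => normc (f x)).
Proof.
move=> [f1 f2].
rewrite (_ : (fun x => _) = Num.sqrt \o
    (fun x => complex.Re (f x) ^+ 2 + complex.Im (f x) ^+ 2)).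
  apply: measurableT_comp; first exact: continuous_measurable_fun (@sqrt_continuous R).
  by apply: measurable_funD; exact: measurable_funX.
by apply/funext => x /=; case: (f x).
Qed.

Lemma cmeasurable_csum D (u : nat -> T -> R[i]) :
  (forall n, cmeasurable D (u n)) ->
  (forall x, D x -> dominated (u ^~ x)) ->
  cmeasurable D (fun x => csum (u ^~ x)).
Proof.
move=> mu du; split.
  apply: (@measurable_fun_cvg _ _ _ _
    (fun n x => complex.Re (series (u ^~ x) n))) => [n|x Dx].
    by have [] := cmeasurable_sum (index_iota 0 n) mu.
  by have /cvgcP[] := dominated_cvg_csum (du x Dx).
apply: (@measurable_fun_cvg _ _ _ _
  (fun n x => complex.Im (series (u ^~ x) n))) => [n|x Dx].
  by have [] := cmeasurable_sum (index_iota 0 n) mu.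
by have /cvgcP[] := dominated_cvg_csum (du x Dx).
Qed.

End ComplexMeasurable.

Lemma cmeasurable_comp (R : realType) d1 d2 (T1 : measurableType d1)
    (T2 : measurableType d2) (D : set T1) (E : set T2) (f : T2 -> R[i]) (g : T1 -> T2) :
  measurable E -> g @` D `<=` E -> cmeasurable E f -> measurable_fun D g ->
  cmeasurable D (fun x => f (g x)).
Proof.
move=> mE DE [f1 f2] mg; split.
  exact: (measurable_comp mE DE f1 mg).
exact: (measurable_comp mE DE f2 mg).
Qed.

Section ComplexIntegral.
Variable R : realType.
Implicit Types (D : set R) (f g : R -> R[i]).
Local Notation nrm := (@normc R).
Local Notation mu := (@lebesgue_measure R).

Definition cintegrable D f :=
  mu.-integrable D (EFin \o (fun x => complex.Re (f x))) /\
  mu.-integrable D (EFin \o (fun x => complex.Im (f x))).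

Lemma cintegrable_measurable D f : measurable D -> cintegrable D f -> cmeasurable D f.
Proof. by move=> mD [/measurable_int/measurable_EFinP ? /measurable_int/measurable_EFinP ?]. Qed.

Lemma le_cintegrable D f (g : R -> R) : measurable D -> cmeasurable D f ->
  mu.-integrable D (EFin \o g) -> (forall x, D x -> nrm (f x) <= g x) ->
  cintegrable D f.
Proof.
move=> mD [f1 f2] ig fg; split.
  apply: le_integrable ig => //; first exact/measurable_EFinP.
  move=> x Dx /=; rewrite lee_fin (le_trans (normc_Re _))// (le_trans (fg _ Dx))//.
  exact: ler_norm.
apply: le_integrable ig => //; first exact/measurable_EFinP.
move=> x Dx /=; rewrite lee_fin (le_trans (normc_Im _))// (le_trans (fg _ Dx))//.
exact: ler_norm.
Qed.

Lemma integrable_cst D (c : R) : measurable D -> (mu D < +oo)%E ->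
  mu.-integrable D (EFin \o cst c).
Proof.
move=> mD Doo; apply/integrableP; split; first exact/measurable_EFinP/measurable_cst.
by rewrite /= integral_cst// lte_mul_pinfty.
Qed.

Lemma bounded_cintegrable D f (c : R) : measurable D -> (mu D < +oo)%E ->
  cmeasurable D f -> (forall x, D x -> nrm (f x) <= c) -> cintegrable D f.
Proof.
move=> mD Doo mf fc; apply: le_cintegrable fc => //.
exact: integrable_cst.
Qed.

Lemma cintegrableD D f g : measurable D -> cintegrable D f -> cintegrable D g ->
  cintegrable D (fun x => f x + g x).
Proof.
move=> mD [f1 f2] [g1 g2]; split.
  under [X in _.-integrable _ X]eq_fun do rewrite /= ReD EFinD.
  exact: integrableD.
under [X in _.-integrable _ X]eq_fun do rewrite /= ImD EFinD.
exact: integrableD.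
Qed.

Lemma cintegrableZ D (c : R[i]) f : measurable D -> cintegrable D f ->
  cintegrable D (fun x => c * f x).
Proof.
move=> mD [f1 f2]; split.
  under [X in _.-integrable _ X]eq_fun do rewrite /= ReM EFinB !EFinM.
  by apply: integrableB => //; exact: integrableZl.
under [X in _.-integrable _ X]eq_fun do rewrite /= ImM EFinD !EFinM.
by apply: integrableD => //; exact: integrableZl.
Qed.

Lemma cintegrable_normc D f : measurable D -> cintegrable D f ->
  mu.-integrable D (EFin \o (fun x => nrm (f x))).
Proof.
move=> mD cf; have mf := cintegrable_measurable mD cf; case: cf => f1 f2.
have : mu.-integrable D ((abse \o (EFin \o (fun x => complex.Re (f x)))) \+
    (abse \o (EFin \o (fun x => complex.Im (f x)))))%E.
  by apply: integrableD => //; exact: integrable_abse.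
apply: le_integrable => //; first exact/measurable_EFinP/measurable_normc.
move=> x Dx /=; rewrite lee_fin (ger0_norm (normc_ge0 _)) [leRHS]ger0_norm ?addr_ge0//.
exact: normc_ReIm.
Qed.

Lemma cintegralD D f g : measurable D -> cintegrable D f -> cintegrable D g ->
  cintegral D (fun x => f x + g x) = cintegral D f + cintegral D g.
Proof.
move=> mD [f1 f2] [g1 g2]; rewrite /cintegral.
under eq_Rintegral do rewrite ReD.
under [X in Complex _ X]eq_Rintegral do rewrite ImD.
by rewrite !RintegralD.
Qed.

Lemma cintegralZ D (c : R[i]) f : measurable D -> cintegrable D f ->
  cintegral D (fun x => c * f x) = c * cintegral D f.
Proof.
move=> mD [f1 f2]; rewrite /cintegral.
under eq_Rintegral do rewrite ReM.
under [X in Complex _ X]eq_Rintegral do rewrite ImM.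
have Z a h : mu.-integrable D (EFin \o h) -> mu.-integrable D (EFin \o (fun x => a * h x)).
  by move=> ih; under [X in _.-integrable _ X]eq_fun do rewrite /= EFinM; exact: integrableZl.
rewrite RintegralB ?RintegralD ?RintegralZl//; try exact: Z.
by case: c => a b.
Qed.

Lemma cintegrable0 D : cintegrable D (fun=> 0).
Proof. by split; exact: integrable0. Qed.

Lemma cintegral0 D : cintegral D (fun=> 0) = 0.
Proof. by rewrite /cintegral /= /Rintegral !integral0_eq. Qed.

Lemma cintegrable_sum D I (s : seq I) (F : I -> R -> R[i]) : measurable D ->
  (forall i, cintegrable D (F i)) -> cintegrable D (fun x => \sum_(i <- s) F i x).
Proof.
move=> mD cF; elim: s => [|i s IH].
  by under eq_fun do rewrite big_nil; exact: cintegrable0.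
by under eq_fun do rewrite big_cons; exact: cintegrableD.
Qed.

Lemma cintegral_sum D I (s : seq I) (F : I -> R -> R[i]) : measurable D ->
  (forall i, cintegrable D (F i)) ->
  cintegral D (fun x => \sum_(i <- s) F i x) = \sum_(i <- s) cintegral D (F i).
Proof.
move=> mD cF; elim: s => [|i s IH].
  by under eq_fun do rewrite big_nil; rewrite big_nil cintegral0.
under eq_fun do rewrite big_cons; rewrite big_cons cintegralD ?IH//.
exact: cintegrable_sum.
Qed.

Lemma eq_cintegral D f g : {in D, f =1 g} -> cintegral D f = cintegral D g.
Proof. by move=> fg; congr Complex; apply: eq_Rintegral => x xD; rewrite fg. Qed.

Lemma ae_eq_cintegral D f g (N : set R) : measurable D ->
  cmeasurable D f -> cmeasurable D g -> mu.-negligible N ->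
  (forall x, D x -> ~ N x -> f x = g x) -> cintegral D f = cintegral D g.
Proof.
move=> mD [f1 f2] [g1 g2] N0 fg; congr Complex; congr fine; apply: ae_eq_integral => //;
  try exact/measurable_EFinP.
- by apply: negligibleS N0 => x /= h; apply: contrapT => Nx; apply: h => Dx; rewrite fg.
- by apply: negligibleS N0 => x /= h; apply: contrapT => Nx; apply: h => Dx; rewrite fg.
Qed.

(** The factor 2 comes from estimating the real and the imaginary part separately. It is harmless,
    since the bound serves only to show boundedness. *)
Lemma le_cintegral D f (c : R) : measurable D -> (mu D < +oo)%E -> cintegrable D f ->
  (forall x, D x -> nrm (f x) <= c) ->
  nrm (cintegral D f) <= (c + c) * fine (mu D).
Proof.
move=> mD Doo [f1 f2] fc; rewrite (le_trans (normc_ReIm _))// mulrDl /cintegral /=.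
have ic : mu.-integrable D (EFin \o cst c) by exact: integrable_cst.
rewrite -(Rintegral_cst mu mD) lerD// (le_trans (le_normr_Rintegral _ _))//;
  apply: le_Rintegral => //.
- exact: integrable_norm.
- by move=> x Dx; rewrite (le_trans (normc_Re _))// fc.
- exact: integrable_norm.
- by move=> x Dx; rewrite (le_trans (normc_Im _))// fc.
Qed.

Section CsumIntegral.
Variables (D : set R) (u : nat -> R -> R[i]) (a : nat -> R -> R).
Hypothesis mD : measurable D.
Hypothesis mu_ : forall n, cmeasurable D (u n).
Hypothesis ua : forall n x, D x -> nrm (u n x) <= a n x.
Hypothesis ca : forall x, D x -> cvgn (series (a ^~ x)).
Hypothesis ia : mu.-integrable D (EFin \o (fun x => limn (series (a ^~ x)))).

Let a_ge0 n x : D x -> 0 <= a n x.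
Proof. by move=> Dx; rewrite (le_trans (normc_ge0 _) (ua n Dx)). Qed.

Let series_le n x : D x -> nrm (series (u ^~ x) n) <= limn (series (a ^~ x)).
Proof.
move=> Dx; rewrite (le_trans (normc_sum _ _ _))//.
apply: (@le_trans _ _ (series (a ^~ x) n)).
  by apply: ler_sum => i _; exact: ua.
apply: nondecreasing_cvgn_le; last exact: ca.
by apply: nondecreasing_series => k _ _; exact: a_ge0.
Qed.

Let dom x : D x -> dominated (u ^~ x).
Proof. by move=> Dx; exists (a ^~ x) => [n|]; [exact: ua|exact: ca]. Qed.

Lemma cintegrable_csum : cintegrable D (fun x => csum (u ^~ x)).
Proof.
apply: le_cintegrable ia _ => //; first exact: cmeasurable_csum.
by move=> x Dx; apply: csum_le => [n|]; [exact: ua|exact: ca].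
Qed.

Let cintegrable_u n : cintegrable D (u n).
Proof.
apply: le_cintegrable ia _ => // x Dx; rewrite (le_trans (ua n Dx))//.
apply: (@le_trans _ _ (series (a ^~ x) n.+1)).
  by rewrite /series /= big_nat_recr//= lerDr sumr_ge0// => i _; exact: a_ge0.
apply: nondecreasing_cvgn_le; last exact: ca.
by apply: nondecreasing_series => k _ _; exact: a_ge0.
Qed.

(** Dominated convergence for the real and imaginary parts of the partial sums, all of which are
    dominated by the full sum of the majorants. *)
Lemma cvg_cintegral_csum :
  (series (fun n => cintegral D (u n)) : nat -> R[i]^o) @ \oo -->
  (cintegral D (fun x => csum (u ^~ x)) : R[i]^o).
Proof.
rewrite (_ : series _ = fun n => cintegral D (fun x => series (u ^~ x) n)); last first.
  by apply/funext => n; rewrite /series /= cintegral_sum.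
have [cR cI] := cintegrable_csum.
have cS n : cintegrable D (fun x => series (u ^~ x) n) by exact: cintegrable_sum.
apply/cvgcP; split.
  apply: fine_cvg; rewrite fineK; last by exact: integrable_fin_num.
  apply: (@dominated_cvg _ _ _ mu D mD
     (fun n x => (complex.Re (series (u ^~ x) n))%:E) _
     (fun x => (limn (series (a ^~ x)))%:E)) => //.
  - by move=> n; apply/measurable_EFinP; have [] := cmeasurable_sum (index_iota 0 n) mu_.
  - move=> x Dx; apply: cvg_EFin; first exact: nearW.
    by have /cvgcP[] := dominated_cvg_csum (dom Dx).
  - by move=> n x Dx /=; rewrite lee_fin (le_trans (normc_Re _))// series_le.
apply: fine_cvg; rewrite fineK; last by exact: integrable_fin_num.
apply: (@dominated_cvg _ _ _ mu D mD
   (fun n x => (complex.Im (series (u ^~ x) n))%:E) _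
   (fun x => (limn (series (a ^~ x)))%:E)) => //.
- by move=> n; apply/measurable_EFinP; have [] := cmeasurable_sum (index_iota 0 n) mu_.
- move=> x Dx; apply: cvg_EFin; first exact: nearW.
  by have /cvgcP[] := dominated_cvg_csum (dom Dx).
- by move=> n x Dx /=; rewrite lee_fin (le_trans (normc_Im _))// series_le.
Qed.

Lemma cintegral_csum :
  cintegral D (fun x => csum (u ^~ x)) = csum (fun n => cintegral D (u n)).
Proof. by rewrite (csum_lim cvg_cintegral_csum). Qed.

End CsumIntegral.

Lemma cintegral_csum_geometric D (u : nat -> R -> R[i]) (c r : R) :
  measurable D -> (mu D < +oo)%E -> 0 <= r < 1 ->
  (forall n, cmeasurable D (u n)) ->
  (forall n x, D x -> nrm (u n x) <= c * r ^+ n) ->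
  cintegral D (fun x => csum (u ^~ x)) = csum (fun n => cintegral D (u n)).
Proof.
move=> mD Doo /andP[r0 r1] mu_ uc.
have r1' : `|r| < 1 by rewrite ger0_norm.
apply: (@cintegral_csum D u (fun n _ => c * r ^+ n)) => //.
  by move=> x Dx; exact: is_cvg_geometric_series.
exact: integrable_cst.
Qed.

End ComplexIntegral.

(** * The maps x -> (x +- 1) / 2 *)

Section HalfShift.
Variable R : realType.
Local Notation mu := (@lebesgue_measure R).
Implicit Types (e : R).

Definition half_shift e (x : R) : R := (x + e) / 2.

Lemma measurable_half_shift e (D : set R) : measurable_fun D (half_shift e).
Proof. by apply: measurable_funM => //; apply: measurable_funD. Qed.

Let half_shift_mfun e : measurableTypeR R -> measurableTypeR R := half_shift e.

(** Half-open, so that the two half shifts map it bijectively onto the disjoint sets [-1, 0[ and [0,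
    1[, on each of which the first digit is constant. *)
Definition J11 : set R := `[-1, 1[.

Lemma measurable_J11 : measurable J11. Proof. exact: measurable_itv. Qed.

#[local] Hint Resolve measurable_J11 : core.

Lemma J11E x : J11 x = (-1 <= x < 1) :> Prop.
Proof. by rewrite /J11 /= in_itv. Qed.

Lemma mu_J11 : mu J11 = (2%:E)%E.
Proof.
rewrite /J11 lebesgue_measure_itv /= lte_fin (_ : -1 < 1)%R; last by lra.
by rewrite -EFinB opprK.
Qed.

Lemma mu_J11_lty : (mu J11 < +oo)%E. Proof. by rewrite mu_J11 ltry. Qed.

(** The preimage of ]a, b] is ]2a - e, 2b - e], which is twice as long, and the Lebesgue measure is
    determined by its values on such intervals. *)
Lemma lebesgue_half_shift e (A : set R) : measurable A ->
  (2^-1%:E * pushforward mu (half_shift_mfun e) A = mu A)%E.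
Proof.
move=> mA; apply/esym.
unshelve refine (@lebesgue_measure_unique R
  (mscale (2^-1)%:nng (pushforward mu (half_shift_mfun e))) _ A mA).
  exact: measurable_half_shift.
move=> /= _ [[a b]] _ <-.
rewrite /mscale /= /pushforward.
have -> : half_shift_mfun e @^-1` [set` `]a, b]] = [set` `]a * 2 - e, b * 2 - e]].
  apply/seteqP; split => x; rewrite /= /half_shift_mfun /half_shift !in_itv /= ltr_pdivlMr// ler_pdivrMr//.
    by rewrite ltrBlDr lerBrDr.
  by rewrite ltrBlDr lerBrDr.
rewrite !lebesgue_measure_itv/= !lte_fin ltrD2r ltr_pM2r//.
case: ifP => _; last by rewrite mule0.
by rewrite -!EFinB -EFinM; congr EFin; field.
Qed.

Lemma ge0_integral_half_shift e (D : set R) (f : R -> \bar R) :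
  measurable D -> measurable_fun D f -> (forall x, D x -> 0 <= f x)%E ->
  (\int[mu]_(x in D) f x = 2^-1%:E * \int[mu]_(x in half_shift e @^-1` D) f (half_shift e x))%E.
Proof.
move=> mD mf f0.
rewrite -(@ge0_integral_pushforward _ _ _ _ _ (half_shift_mfun e) _ mu D f)//=; last 2 first.
- exact: (@measurable_half_shift e setT).
- by move=> y /set_mem; exact: f0.
unshelve epose proof (@ge0_integral_mscale _ _ R (pushforward mu (half_shift_mfun e))
  D mD (2^-1)%:nng f mf f0) as H; first exact: measurable_half_shift.
rewrite /= in H; rewrite -H.
by apply: eq_measure_integral => A mA AD; exact/esym/lebesgue_half_shift.
Qed.

Lemma half_shiftN1_preimage : half_shift (-1) @^-1` `[-1, 0[ = J11.
Proof.
apply/seteqP; split => x; rewrite /J11 /= /half_shift !in_itv /= => /andP[h1 h2];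
  apply/andP; split; lra.
Qed.

Lemma half_shift1_preimage : half_shift 1 @^-1` `[0, 1[ = J11.
Proof.
apply/seteqP; split => x; rewrite /J11 /= /half_shift !in_itv /= => /andP[h1 h2];
  apply/andP; split; lra.
Qed.

Lemma J11_setU : J11 = `[-1, 0[ `|` `[0, 1[.
Proof.
apply/seteqP; split => x; rewrite /J11 /= !in_itv /=.
  by move=> /andP[h1 h2]; have [h|h] := ltP x 0; [left|right]; apply/andP; split.
by move=> [/andP[h1 h2]|/andP[h1 h2]]; apply/andP; split; lra.
Qed.

Lemma ge0_integral_halves (f : R -> \bar R) :
  measurable_fun J11 f -> (forall x, J11 x -> 0 <= f x)%E ->
  (\int[mu]_(x in J11) f x =
   2^-1%:E * (\int[mu]_(x in J11) f (half_shift (-1) x) +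
              \int[mu]_(x in J11) f (half_shift 1 x)))%E.
Proof.
move=> mf f0; have s1 : `[-1, 0[ `<=` J11 by rewrite J11_setU; exact: subsetUl.
have s2 : `[0, 1[ `<=` J11 by rewrite J11_setU; exact: subsetUr.
have g1 : (forall x : R, `[-1, 0[%classic x -> (0 <= f x)%E) by move=> x /s1; exact: f0.
have g2 : (forall x : R, `[0, 1[%classic x -> (0 <= f x)%E) by move=> x /s2; exact: f0.
have mf1 : measurable_fun (`[-1, 0[ : set R) f by exact: measurable_funS mf.
have mf2 : measurable_fun (`[0, 1[ : set R) f by exact: measurable_funS mf.
rewrite [in LHS]J11_setU ge0_integral_setU//=.
- rewrite (@ge0_integral_half_shift (-1) `[-1, 0[)//.
  rewrite half_shiftN1_preimage.
  rewrite (@ge0_integral_half_shift 1 `[0, 1[)//.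
  have h1 : (0 <= \int[mu]_(x in J11) f (half_shift (-1) x))%E.
    apply: integral_ge0 => x Jx; apply: g1.
    by have : (half_shift (-1) @^-1` `[-1, 0[) x by rewrite half_shiftN1_preimage.
  have h2 : (0 <= \int[mu]_(x in J11) f (half_shift 1 x))%E.
    apply: integral_ge0 => x Jx; apply: g2.
    by have : (half_shift 1 @^-1` `[0, 1[) x by rewrite half_shift1_preimage.
  by rewrite half_shift1_preimage (ge0_muleDr _ h1 h2).
- by rewrite -J11_setU.
- by move=> x; rewrite !inE => -[/g1|/g2].
- apply/disj_setPS => x [] /=; rewrite !in_itv/= => /andP[_ h] /andP[h' _]; lra.
Qed.

Lemma half_shift_J11 e x : e = -1 \/ e = 1 -> J11 x -> J11 (half_shift e x).
Proof.
rewrite !J11E /half_shift => -[] -> /andP[h1 h2]; apply/andP; split; lra.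
Qed.

Lemma half_shift_I11 e x : e = -1 \/ e = 1 -> @I11 R x -> @I11 R (half_shift e x).
Proof.
rewrite /I11 /= !in_itv /= /half_shift => -[] -> /andP[h1 h2]; apply/andP; split; lra.
Qed.

Lemma measurable_fun_half_shift_J11 d (T : measurableType d) e (f : R -> T) :
  e = -1 \/ e = 1 -> measurable_fun J11 f ->
  measurable_fun J11 (fun x => f (half_shift e x)).
Proof.
move=> he mf; apply: (measurable_comp _ _ mf (@measurable_half_shift e J11)).
  exact: measurable_J11.
by move=> _ [x Jx <-]; exact: half_shift_J11.
Qed.

Lemma integrable_halves (f : R -> R) : mu.-integrable J11 (EFin \o f) ->
  [/\ mu.-integrable J11 (EFin \o (fun x => f (half_shift (-1) x))),
      mu.-integrable J11 (EFin \o (fun x => f (half_shift 1 x))) &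
      \int[mu]_(x in J11) f x = 2^-1 *
        (\int[mu]_(x in J11) f (half_shift (-1) x) + \int[mu]_(x in J11) f (half_shift 1 x))].
Proof.
move=> intf; have /integrableP[mf fy] := intf.
have mf' : measurable_fun J11 f by exact/measurable_EFinP.
have m1 : measurable_fun J11 (EFin \o (fun x => f (half_shift (-1) x))).
  by apply/measurable_EFinP; apply: measurable_fun_half_shift_J11 => //; left.
have m2 : measurable_fun J11 (EFin \o (fun x => f (half_shift 1 x))).
  by apply/measurable_EFinP; apply: measurable_fun_half_shift_J11 => //; right.
move: fy; rewrite ge0_integral_halves//; last exact: measurableT_comp.
set x := (\int[mu]_(_ in _) _)%E; set y := (\int[mu]_(_ in _) _)%E.
have x0 : (0 <= x)%E by exact: integral_ge0.
have y0 : (0 <= y)%E by exact: integral_ge0.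
(* [x] and [y] are the half integrals of |f|: half of their sum is finite and both are nonnegative,
   so each is finite. *)
move=> xy; have {}xy : (x + y < +oo)%E.
  rewrite ltNge leye_eq; apply/negP => /eqP xyoo; move: xy.
  by rewrite xyoo mulry gtr0_sg ?invr_gt0// mul1e ltxx.
have i1 : mu.-integrable J11 (EFin \o (fun x => f (half_shift (-1) x))).
  by apply/integrableP; split => //; rewrite (le_lt_trans _ xy)// leeDl.
have i2 : mu.-integrable J11 (EFin \o (fun x => f (half_shift 1 x))).
  by apply/integrableP; split => //; rewrite (le_lt_trans _ xy)// leeDr.
split => //.
have i12 : mu.-integrable J11
    (EFin \o (fun x => f (half_shift (-1) x) + f (half_shift 1 x))).
  by under [X in _.-integrable _ X]eq_fun do rewrite /= EFinD; exact: integrableD.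
transitivity (\int[mu]_(x in J11) (2^-1 * (f (half_shift (-1) x) + f (half_shift 1 x))));
  last by rewrite RintegralZl// RintegralD.
rewrite /Rintegral; congr fine.
(* The signed identity follows from the nonnegative one for the positive and negative parts; the
   four resulting integrals are finite, so the rearrangement takes place in [R]. *)
have mp : measurable_fun J11 ((EFin \o f)^\+)%E by exact: measurable_funepos.
have mn : measurable_fun J11 ((EFin \o f)^\-)%E by exact: measurable_funeneg.
rewrite integralE [in LHS]ge0_integral_halves// [X in (_ - X = _)%E]ge0_integral_halves//.
have -> : (\int[mu]_(x in J11) (2^-1 * (f (half_shift (-1) x) + f (half_shift 1 x)))%:E =
    2^-1%:E * \int[mu]_(x in J11) (EFin \o (fun x => f (half_shift (-1) x) + f (half_shift 1 x)))%R x)%E.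
  by rewrite -integralZl.
have -> : (\int[mu]_(x in J11) (EFin \o (fun x => f (half_shift (-1) x) + f (half_shift 1 x)))%R x =
    \int[mu]_(x in J11) (EFin \o (fun x => f (half_shift (-1) x))) x +
    \int[mu]_(x in J11) (EFin \o (fun x => f (half_shift 1 x))) x)%E.
  exact: integralD_EFin.
rewrite [X in (_ = _ * (X + _))%E]integralE [X in (_ = _ * (_ + X))%E]integralE.
have F1 : (\int[mu]_(x in J11) ((EFin \o (fun x => f (half_shift (-1) x)))^\+ x) \is a fin_num)%E.
  exact: integrable_pos_fin_num.
have F2 : (\int[mu]_(x in J11) ((EFin \o (fun x => f (half_shift (-1) x)))^\- x) \is a fin_num)%E.
  exact: integrable_neg_fin_num.
have F3 : (\int[mu]_(x in J11) ((EFin \o (fun x => f (half_shift (1) x)))^\+ x) \is a fin_num)%E.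
  exact: integrable_pos_fin_num.
have F4 : (\int[mu]_(x in J11) ((EFin \o (fun x => f (half_shift (1) x)))^\- x) \is a fin_num)%E.
  exact: integrable_neg_fin_num.
have Ep e : (\int[mu]_(x in J11) (EFin \o f)^\+ (half_shift e x) =
    \int[mu]_(x in J11) ((EFin \o (fun x => f (half_shift e x)))^\+ x))%E.
  by apply: eq_integral => z _; rewrite !funeposE.
have En e : (\int[mu]_(x in J11) (EFin \o f)^\- (half_shift e x) =
    \int[mu]_(x in J11) ((EFin \o (fun x => f (half_shift e x)))^\- x))%E.
  by apply: eq_integral => z _; rewrite !funenegE.
rewrite !Ep !En; move: F1 F2 F3 F4.
move=> /fineK <- /fineK <- /fineK <- /fineK <-.
by rewrite -!(EFinD,EFinN,EFinM); congr EFin; ring.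
Qed.

Lemma cintegral_halves (f : R -> R[i]) : cintegrable J11 f ->
  [/\ cintegrable J11 (Rminus f), cintegrable J11 (Rplus f) &
      cintegral J11 f = (cintegral J11 (Rminus f) + cintegral J11 (Rplus f)) / 2].
Proof.
move=> [/integrable_halves[r1 r2 rE] /integrable_halves[i1 i2 iE]].
split; first by split.
  by split.
rewrite /cintegral rE iE.
have -> : 2^-1 = (2^-1 : R)%:C%C by rewrite fmorphV rmorph_nat.
rewrite mulrC; apply/eqP; rewrite eq_complex !(ReM, ImM, ReD, ImD) /=.
by rewrite !mulr0 subr0 add0r ![2^-1 * _]mulrC !eqxx.
Qed.

Lemma cintegral_I11 (f : R -> R[i]) : cintegrable J11 f ->
  cintegral (@I11 R) f = cintegral J11 f.
Proof.
move=> [f1 f2]; rewrite /cintegral /J11 /I11; congr Complex.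
  by rewrite [RHS]Rintegral_itv_bndo_bndc.
by rewrite [RHS]Rintegral_itv_bndo_bndc.
Qed.

End HalfShift.

(** * The digit walk and the visit function *)

Section Digits.
Variable R : realType.
Implicit Types (x : R) (s : nat -> int).

Lemma exp2_neq0 n : (2 : R) ^+ n != 0.
Proof. by rewrite expf_neq0// pnatr_eq0. Qed.

(** Digits read off from the orbit of the doubling map, whose inverse branches are the half shifts.
    They are explicit, hence measurable, and agree with the chosen [digits] away from the dyadic
    rationals. *)
Definition first_digit x : int := if 0 <= x then 1 else -1.
Definition doubling x : R := 2 * x - (first_digit x)%:~R.
Definition digit n x : int := first_digit (iter n doubling x).
Definition walk n x : int := \sum_(j < n) digit j x.

Lemma first_digitP x : first_digit x = 1 \/ first_digit x = -1.
Proof. by rewrite /first_digit; case: ifP => _; [left|right]. Qed.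

Lemma walkS n x : walk n.+1 x = first_digit x + walk n (doubling x).
Proof.
rewrite /walk big_ord_recl; congr (_ + _).
by apply: eq_bigr => i _; rewrite /digit -iterSr.
Qed.

Lemma first_digit_half_shiftN1 x : J11 x -> first_digit (half_shift (-1) x) = -1.
Proof.
rewrite J11E /first_digit /half_shift => /andP[h1 h2].
by case: ifPn => // h; exfalso; move: h h2; lra.
Qed.

Lemma first_digit_half_shift1 x : J11 x -> first_digit (half_shift 1 x) = 1.
Proof.
rewrite J11E /first_digit /half_shift => /andP[h1 h2].
by case: ifPn => // h; exfalso; move: h h1; rewrite -ltNge; lra.
Qed.

Lemma walk_half_shiftN1 n x : J11 x -> walk n.+1 (half_shift (-1) x) = -1 + walk n x.
Proof.
move=> Jx; rewrite walkS first_digit_half_shiftN1//; congr (_ + walk n _).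
by rewrite /doubling first_digit_half_shiftN1// /half_shift rmorphN1; field.
Qed.

Lemma walk_half_shift1 n x : J11 x -> walk n.+1 (half_shift 1 x) = 1 + walk n x.
Proof.
move=> Jx; rewrite walkS first_digit_half_shift1//; congr (_ + walk n _).
by rewrite /doubling first_digit_half_shift1// /half_shift; field.
Qed.

Lemma doubling_itv x : `|x| <= 1 -> `|doubling x| <= 1.
Proof.
rewrite /doubling /first_digit !ler_norml => /andP[h1 h2].
by case: ifPn => h; rewrite ?rmorphN1; apply/andP; split; move: h; rewrite -?ltNge; lra.
Qed.

Lemma digit_expansion x : `|x| <= 1 -> is_expansion x (digit ^~ x).
Proof.
move=> x1; split => [n|]; first exact: first_digitP.
(* The sum telescopes: after n digits the remainder is the n-th iterate of the doubling map divided
   by 2^n, and the iterates stay in [-1, 1]. *)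
have E n : series (fun n => (digit n x)%:~R / 2 ^+ n.+1 : R) n =
    x - iter n doubling x / 2 ^+ n.
  elim: n => [|n IH]; first by rewrite /series /= big_geq// expr0 divr1 subrr.
  rewrite seriesSr IH iterS /doubling -/(digit n x) exprS.
  by field; exact: exp2_neq0.
apply/cvgrPdist_le => e e0.
have H : `|2^-1 : R| < 1 by rewrite ger0_norm ?invr_ge0// invf_lt1// ltr1n.
have /cvgrPdist_le/(_ _ e0) := cvg_geometric 1 H.
apply: filterS => n; rewrite sub0r normrN /= mul1r ger0_norm ?exprn_ge0 ?invr_ge0// => h.
have I : `|iter n doubling x| <= 1.
  by elim: {h} n => //= n IH; exact: doubling_itv.
rewrite E opprB addrC subrK normrM (le_trans _ h)// -exprVn.
by rewrite [X in _ * X]ger0_norm ?exprn_ge0 ?invr_ge0// ler_piMl// exprn_ge0// invr_ge0.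
Qed.

Lemma expansion_norm_le1 x s : is_expansion x s -> `|x| <= 1.
Proof.
move=> [sP sx].
have H n : `|series (fun n => (s n)%:~R / 2 ^+ n.+1 : R) n| <= 1 - 2 ^- n.
  elim: n => [|n IH]; first by rewrite /series /= big_geq// normr0 expr0 invr1 subrr.
  rewrite seriesSr (le_trans (ler_normD _ _))//.
  have -> : `|(s n)%:~R / 2 ^+ n.+1 : R| = 2 ^- n.+1.
    rewrite normrM (ger0_norm (_ : 0 <= 2 ^- n.+1)) ?invr_ge0 ?exprn_ge0//.
    by case: (sP n) => ->; rewrite ?rmorphN1 ?normrN normr1 mul1r.
  rewrite (le_trans (lerD IH (lexx _)))// exprS invfM.
  have : (0 : R) <= 2 ^- n by rewrite invr_ge0 exprn_ge0.
  by move: (2 ^- n : R) => t; lra.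
have /cvg_norm sx' := sx.
rewrite -(cvg_lim _ sx')//; apply: limr_le; first by apply/cvg_ex; eexists; exact: sx'.
by apply: nearW => n /=; rewrite (le_trans (H n))// gerBl invr_ge0 exprn_ge0.
Qed.

Lemma expansion_shift x s : is_expansion x s ->
  is_expansion (2 * x - (s 0%N)%:~R) (fun n => s n.+1).
Proof.
move=> [sP sx]; split => [n|]; first exact: sP.
rewrite (_ : series _ = fun n =>
    2 * series (fun n => (s n)%:~R / 2 ^+ n.+1 : R) n.+1 - (s 0%N)%:~R).
  apply: cvgB; last exact: cvg_cst.
  by apply: cvgM; [exact: cvg_cst|rewrite (cvg_shiftS (series (fun n => (s n)%:~R / 2 ^+ n.+1 : R)))].
apply/funext => n; rewrite /series /= big_nat_recl// mulrDr expr1.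
rewrite (mulrC 2) mulfVK// addrAC subrr add0r big_distrr /=.
by apply: eq_bigr => i _; rewrite [2 ^+ i.+2]exprS; field; exact: exp2_neq0.
Qed.

Definition dyadic : set R := [set p.1%:~R / 2 ^+ p.2 | p in [set: int * nat]].

Lemma countable_dyadic : countable dyadic.
Proof. by apply: card_le_trans (card_image_le _ _) _; exact: countableP. Qed.

Lemma dyadic_half x (e : int) : dyadic (2 * x - e%:~R) -> dyadic x.
Proof.
move=> [[m n] _ /= h]; exists (m + e * 2 ^+ n, n.+1) => //=.
rewrite rmorphD rmorphM rmorphXn /= exprS.
have -> : x = (m%:~R / 2 ^+ n + e%:~R) / 2 by rewrite h; field.
by field; exact: exp2_neq0.
Qed.

(** If the first digits differ, both 2x - 1 and 2x + 1 are sums of expansions and lie in [-1, 1];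
    this forces x = 0, which is dyadic. *)
Lemma expansion_unique0 x s s' : ~ dyadic x -> is_expansion x s -> is_expansion x s' ->
  s 0%N = s' 0%N.
Proof.
move=> dx es es'.
have := expansion_norm_le1 (expansion_shift es).
have := expansion_norm_le1 (expansion_shift es').
have xn0 : x != 0.
  by apply: contra_notN dx => /eqP ->; exists (0, 0%N); rewrite //= mul0r.
case: es => [/(_ 0%N) sP _]; case: es' => [/(_ 0%N) sP' _].
case: sP => ->; case: sP' => -> //; rewrite rmorphN1 !ler_norml => /andP[h1 h2] /andP[h3 h4];
  exfalso; move/eqP: xn0; apply; lra.
Qed.

Lemma expansion_unique x s s' : ~ dyadic x -> is_expansion x s -> is_expansion x s' ->
  s = s'.
Proof.
move=> dx es es'; apply/funext => n.
elim: n x s s' dx es es' => [|n IH] x s s' dx es es'; first exact: expansion_unique0 dx es es'.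
apply: (IH (2 * x - (s 0%N)%:~R) (fun n => s n.+1) (fun n => s' n.+1)).
- by move=> h; apply: dx; apply: dyadic_half h.
- exact: expansion_shift.
- by rewrite (expansion_unique0 dx es es'); exact: expansion_shift.
Qed.

Lemma digitsE x : `|x| <= 1 -> ~ dyadic x -> digits x = digit ^~ x.
Proof.
move=> x1 dx; apply: (expansion_unique dx); last exact: digit_expansion.
by apply: (@xgetPex _ _ [set s | is_expansion x s]); exists (digit ^~ x); exact: digit_expansion.
Qed.

End Digits.

(** [V] depends on an arbitrary choice at the dyadic points. Every subset of a countable set of
    reals is measurable, so such a modification preserves measurability. *)
Lemma measurable_fun_countable (R : realType) d (T : measurableType d) (D N : set R)
    (f g : R -> T) : measurable D -> countable N -> measurable_fun D g ->
  (forall x, D x -> ~ N x -> f x = g x) -> measurable_fun D f.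
Proof.
move=> mD cN mg fg _ B mB.
have -> : D `&` f @^-1` B = ((D `&` g @^-1` B) `\` N) `|` (N `&` (D `&` f @^-1` B)).
  apply/seteqP; split => x /=.
    move=> [Dx fBx]; have [Nx|Nx] := pselect (N x); first by right.
    by left; split => //; split => //; rewrite -fg.
  by move=> [[[Dx gBx] Nx]|[Nx]//]; split => //; rewrite fg.
have mc (A : set R) : countable A -> measurable A.
  by move=> cA; apply: countable_measurable cA => t; exact: measurable_set1.
apply: measurableU; first by apply: measurableD; [exact: mg|exact: mc].
by apply: mc; exact: card_le_trans (subset_card_le (@subIsetl _ _ _)) cN.
Qed.

Lemma cmeasurable_countable (R : realType) (D N : set R) (f g : R -> R[i]) :
  measurable D -> countable N -> cmeasurable D g ->
  (forall x, D x -> ~ N x -> f x = g x) -> cmeasurable D f.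
Proof.
move=> mD cN [g1 g2] fg; split.
  by apply: (measurable_fun_countable mD cN g1) => x Dx Nx; rewrite fg.
by apply: (measurable_fun_countable mD cN g2) => x Dx Nx; rewrite fg.
Qed.

(* W lambda k x is the total weight of the visits to 0 of the walk started at k.
   Locking it keeps unification from computing in R[i]. *)
HB.lock Definition W (R : realType) (lambda : R[i]) (k : int) (x : R) : R[i] :=
  csum (fun n => lambda ^+ n * (k + walk n x == 0)%:R).

Section Walk.
Variable R : realType.
Variable lambda : R[i].
Hypothesis lambda_lt1 : `|lambda| < 1.
Implicit Types (k : int) (x : R) (n : nat).
Local Notation nrm := (@normc R).

Let r01 : 0 <= nrm lambda < 1.
Proof. by rewrite normc_ge0 -ltcR -normcE. Qed.

Local Notation W := (@W R lambda).

Lemma W_term_le k x n :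
  nrm (lambda ^+ n * (k + walk n x == 0)%:R) <= 1 * nrm lambda ^+ n.
Proof.
rewrite normcM normcX mul1r ler_piMr ?exprn_ge0 ?normc_ge0//.
by case: (_ == 0); rewrite ?normc1 ?normc0.
Qed.

Lemma W_dominated k x : dominated (fun n => lambda ^+ n * (k + walk n x == 0)%:R).
Proof. exact: (dominated_geometric r01 (@W_term_le k x)). Qed.

Lemma W_le k x : nrm (W k x) <= 1 / (1 - nrm lambda).
Proof. by rewrite W.unlock; exact: (csum_geometric_le r01 (@W_term_le k x)). Qed.

Lemma WS k x : W k x = (k == 0)%:R + lambda * W (k + first_digit x) (doubling x).
Proof.
rewrite !W.unlock (csum_recl (W_dominated k x)) expr0 mul1r /walk big_ord0 addr0.
rewrite -csumZ; last exact: W_dominated.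
by congr (_ + _); apply: eq_csum => n; rewrite -/(walk _ _) walkS exprS mulrA addrA.
Qed.

Lemma W_half_shiftN1 k x : J11 x ->
  W k (half_shift (-1) x) = (k == 0)%:R + lambda * W (k - 1) x.
Proof.
move=> Jx; rewrite WS first_digit_half_shiftN1//; congr (_ + _ * W _ _).
by rewrite /doubling first_digit_half_shiftN1// /half_shift rmorphN1; field.
Qed.

Lemma W_half_shift1 k x : J11 x ->
  W k (half_shift 1 x) = (k == 0)%:R + lambda * W (k + 1) x.
Proof.
move=> Jx; rewrite WS first_digit_half_shift1//; congr (_ + _ * W _ _).
by rewrite /doubling first_digit_half_shift1// /half_shift; field.
Qed.

Lemma measurable_walk n (D : set R) : measurable_fun D (fun x : R => (walk n x)%:~R : R).
Proof.
suff H : measurable_fun [set: R] (fun x : R => (walk n x)%:~R : R) by exact: measurable_funTS.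
elim: n => [|n IH].
  by under eq_fun do rewrite /walk big_ord0; exact: measurable_cst.
have mdbl (e : int) : measurable_fun [set: R] (fun x : R => 2 * x - e%:~R : R).
  by apply: measurable_funB => //; exact: measurable_funM.
rewrite (_ : (fun x => _) = fun x : R => if 0 <= x then 1 + (walk n (2 * x - 1%:~R))%:~R
    else -1 + (walk n (2 * x - (-1)%:~R))%:~R).
  apply: measurable_fun_ifT.
  - exact: measurable_fun_ler.
  - by apply: measurable_funD => //; exact: (measurableT_comp IH (mdbl _)).
  - by apply: measurable_funD => //; exact: (measurableT_comp IH (mdbl _)).
apply/funext => x; rewrite walkS /doubling /first_digit rmorphD /=.
by case: ifP => _; rewrite ?rmorphN1.
Qed.

Lemma cmeasurable_walk_eq0 k n (D : set R) :
  cmeasurable D (fun x => (k + walk n x == 0)%:R : R[i]).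
Proof.
have -> : (fun x => (k + walk n x == 0)%:R : R[i]) =
    fun x => (if (walk n x)%:~R == (- k)%:~R :> R then 1 else 0 : R)%:C%C.
  by apply/funext => x; rewrite eqr_int addrC addr_eq0; case: (_ == _).
apply: cmeasurable_real; apply: measurable_funTS; apply: measurable_fun_ifT; [|exact: measurable_cst|exact: measurable_cst].
by apply: measurable_fun_eqr => //; exact: measurable_walk.
Qed.

Lemma cmeasurable_W k (D : set R) : cmeasurable D (W k).
Proof.
rewrite W.unlock; apply: cmeasurable_csum => [n|x _]; last exact: W_dominated.
exact: cmeasurableZ (cmeasurable_walk_eq0 _ _ _).
Qed.

(** The term n = 0 of [W 0] is the leading 1 of [V]; the index shift matches because [L_ n] involves
    n + 1 digits, that is [walk n.+1]. *)
Lemma V_W x : I11 x -> ~ dyadic x -> V lambda x = W 0 x.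
Proof.
move=> Ix dx; rewrite /V W.unlock [RHS]csum_recl; last exact: W_dominated.
rewrite expr0 mul1r add0r {1}/walk big_ord0 eqxx; congr (1 + _).
apply: eq_csum => n; rewrite /L_ digitsE//; last by move: Ix; rewrite /I11 /= in_itv /= ler_norml.
by rewrite add0r /walk; case: ifP.
Qed.

Lemma cmeasurable_V (D : set R) : measurable D -> D `<=` @I11 R -> cmeasurable D (V lambda).
Proof.
move=> mD DI; apply: (cmeasurable_countable mD (@countable_dyadic R)).
  exact: (cmeasurable_W 0).
by move=> x /DI; exact: V_W.
Qed.

Lemma negligible_dyadic : (@lebesgue_measure R).-negligible (@dyadic R).
Proof.
have c := @countable_dyadic R.
apply/negligibleP; last exact: countable_lebesgue_measure0.
by apply: countable_measurable c => t; exact: measurable_set1.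
Qed.

Lemma V_le x : nrm (V lambda x) <= 1 + nrm lambda / (1 - nrm lambda).
Proof.
rewrite (le_trans (normcD _ _))// normc1 lerD2l.
apply: (csum_geometric_le r01) => n.
rewrite normcM normcX exprS ler_piMr ?mulr_ge0 ?exprn_ge0 ?normc_ge0//.
by rewrite /L_; case: ifP; rewrite ?normc1 ?normc0.
Qed.

End Walk.

(** * Moments of V *)

Section Sqrtc.
Variable R : realType.
Implicit Types z mu s : R[i].
Local Notation nrm := (@normc R).

Lemma Re_sqrtc_ge0 z : 0 <= complex.Re (sqrtc z).
Proof. by case: z => a b; rewrite /sqrtc /= sqrtr_ge0. Qed.

Lemma sqrtc1B_neq0 z : nrm z < 1 -> sqrtc (1 - z) != 0.
Proof.
move=> z1; rewrite sqrtc_eq0 subr_eq0; apply: contraTneq z1 => <-.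
by rewrite normc1 ltxx.
Qed.

Lemma normc_1Dsqrtc z : 1 <= nrm (1 + sqrtc z).
Proof.
rewrite (le_trans _ (normc_Re _))// ReD /= ger0_norm; first by rewrite lerDl Re_sqrtc_ge0.
by rewrite addr_ge0// Re_sqrtc_ge0.
Qed.

Lemma add1_sqrtc_neq0 z : 1 + sqrtc z != 0.
Proof. by rewrite -normc_eq0 gt_eqF// (lt_le_trans ltr01)// normc_1Dsqrtc. Qed.

Lemma normcXlt1 z n : nrm z < 1 -> nrm (z ^+ n.+1) < 1.
Proof.
move=> z1; rewrite normcX exprS (le_lt_trans _ z1)//.
by rewrite ler_piMr ?normc_ge0// exprn_ile1 ?normc_ge0// ltW.
Qed.

(** Iteration gives u 0 <= r^n c for every n. This is what excludes the growing solution of a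
    recurrence. *)
Lemma bounded_backward_growth (u : nat -> R) (r c : R) : 0 <= r < 1 ->
  (forall n, 0 <= u n <= c) -> (forall n, u n <= r * u n.+1) -> u 0%N = 0.
Proof.
move=> /andP[r0 r1] uc ur; apply/eqP; rewrite eq_le; have /andP[-> _] := uc 0%N.
rewrite andbT; apply/ler_addgt0Pr => e e0; rewrite add0r.
have H n : u 0%N <= r ^+ n * c.
  have c0 : 0 <= c by have /andP[] := uc 0%N; exact: le_trans.
  have : u 0%N <= r ^+ n * u n.
    elim: n => [|n IH]; first by rewrite expr0 mul1r.
    by rewrite (le_trans IH)// exprSr -mulrA ler_wpM2l// exprn_ge0.
  move=> /le_trans; apply; rewrite ler_wpM2l ?exprn_ge0//; by have /andP[] := uc n.
have := @cvg_geometric R c r; rewrite ger0_norm// => /(_ r1) /cvgrPdist_le/(_ _ e0)[n _ /(_ n)].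
rewrite /= => /(_ (leqnn n)); rewrite sub0r normrN => h.
by rewrite (le_trans (H n))// mulrC (le_trans (ler_norm _)).
Qed.

(* The root of t^2 - (2/mu) t + 1 other than mu / (1 + s) has modulus > 1. *)
Lemma bounded_recurrence (m : nat -> R[i]) mu (c : R) : nrm mu < 1 ->
  (forall k, nrm (m k) <= c) ->
  (forall k, 2 * m k.+1 = mu * (m k.+2 + m k)) ->
  (1 + sqrtc (1 - mu ^+ 2)) * m 1%N = mu * m 0%N.
Proof.
set s := sqrtc _ => mu1 mc rec.
have s2 : s ^+ 2 = 1 - mu ^+ 2 by rewrite /s sqr_sqrtc.
(* [e] vanishes on the decaying solution and measures the growing one. Since s^2 = 1 - mu^2, the
   recurrence factors into (1 + s) e_k = mu e_(k+1), and |1 + s| >= 1 for the principal root. *)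
pose e k := (1 + s) * m k.+1 - mu * m k.
have eS k : (1 + s) * e k = mu * e k.+1.
  have h : mu * m k.+2 = 2 * m k.+1 - mu * m k by rewrite rec; ring.
  have -> : mu * e k.+1 = (1 + s) * (mu * m k.+2) - mu ^+ 2 * m k.+1 by rewrite /e; ring.
  have -> : mu ^+ 2 = 1 - s ^+ 2 by rewrite s2; ring.
  by rewrite h /e; ring.
suff : nrm (e 0%N) = 0 by move/eqP; rewrite normc_eq0 subr_eq0 => /eqP.
apply: (@bounded_backward_growth (fun k => nrm (e k)) (nrm mu) (nrm (1 + s) * c + nrm mu * c)).
- by rewrite normc_ge0.
- move=> k; rewrite normc_ge0 /= (le_trans (normcD _ _))//.
  have -> : nrm (- (mu * m k)) = nrm (mu * m k).
    by apply: complexI; rewrite -!normcE normrN.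
  by rewrite !normcM lerD// ler_wpM2l ?normc_ge0.
- move=> k; rewrite -normcM -eS normcM.
  by rewrite ler_peMl ?normc_ge0// normc_1Dsqrtc.
Qed.

End Sqrtc.

Section MomentAlgebra.
Variable K : fieldType.
Implicit Types (s L a b y : K).

(** Cramer's rule in the form given by the identity for [\adj B *m B], which covers singular [B] as
    well. *)
Lemma mulmx_adj_col n (B : 'M[K]_n) (u : 'cV_n) (y : K) (r i : 'I_n) :
  B *m u = y *: delta_mx r 0 -> \det B * u i 0 = y * cofactor B r i.
Proof.
move=> Bu; have : (\adj B *m (B *m u)) i 0 = \det B * u i 0.
  by rewrite mulmxA mul_adj_mx mul_scalar_mx mxE.
move=> <-; rewrite Bu -scalemxAr mxE; congr (_ * _).
rewrite mxE (bigD1 r)//= !mxE !eqxx mulr1 big1 ?addr0// => k kr.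
by rewrite !mxE (negbTE kr) mulr0.
Qed.

(** [A] sends the column of moments to a multiple of the last basis vector. The minor without the
    last row and the first column is lower triangular with diagonal entries - s 1, ..., - s N, and
    the cofactor sign (-1)^N removes the minus signs. *)
Lemma moment_det N (A : 'M[K]_N.+1) (I s : nat -> K) (y : K) :
  (forall i j : 'I_N.+1, (i < N)%N -> (i.+1 < j)%N -> A i j = 0) ->
  (forall i j : 'I_N.+1, (i < N)%N -> j = i.+1 :> nat -> A i j = - s j) ->
  (forall i : 'I_N.+1, (i < N)%N -> \sum_j A i j * I j = 0) ->
  \sum_j A ord_max j * I j = y ->
  \det A * I 0%N = y * \prod_(1 <= n < N.+1) s n.
Proof.
move=> A0 As AI AN.
have Au : A *m (\col_j I j : 'cV_N.+1) = y *: delta_mx ord_max 0.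
  apply/matrixP => r c; rewrite !ord1 !mxE eqxx andbT.
  under eq_bigr do rewrite mxE.
  have [rN|Nr] := ltnP r N.
    have -> : (r == ord_max) = false by apply: contraTF rN => /eqP ->; rewrite ltnn.
    by rewrite mulr0 AI.
  have -> : r = ord_max by apply/val_inj/eqP; rewrite eqn_leq /= Nr -ltnS ltn_ord.
  by rewrite eqxx mulr1.
have := mulmx_adj_col ord0 Au; rewrite mxE /cofactor /= addn0 => ->; congr (_ * _).
have bN (i : 'I_N) : bump N i = i by rewrite /bump leqNgt ltn_ord.
rewrite det_trig; last first.
  by apply/is_trig_mxP => i j ij; rewrite !mxE A0 /= ?bN//= /bump leq0n add1n ltnS.
rewrite big_add1 big_mkord -[X in (-1) ^+ X]card_ord -prodrN; apply: eq_bigr => i _.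
by rewrite !mxE (As _ _ _ _) /= ?bN ?opprK /bump ?leq0n ?add1n//= opprK.
Qed.

Lemma sign_subn N i : (i <= N)%N -> (-1 : K) ^+ (N - i) = (-1) ^+ (N + i).
Proof.
by move=> iN; rewrite -[in RHS](subnK iN) -addnA addnn exprD -muln2 mulnC exprM sqrrN !expr1n mulr1.
Qed.

Lemma sqr_root_div s L : s ^+ 2 = 1 - L -> 1 + s != 0 -> L / (1 + s) = 1 - s.
Proof.
move=> s2 s0; apply: (mulIf s0); rewrite mulfVK//.
have -> : L = 1 - s ^+ 2 by rewrite s2; ring.
by ring.
Qed.

Lemma double_half_sum L a b : (2 : K) != 0 -> 2 * ((L * a + L * b) / 2) = L * (b + a).
Proof. by move=> n2; field. Qed.

Lemma sub_fixed s a y : y = a + (1 - s) * y -> s * y = a.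
Proof. by move=> /(congr1 (fun z => z - (1 - s) * y)); rewrite addrK => <-; ring. Qed.

Lemma eq_invM s a y : s != 0 -> s * y = a -> y = s^-1 * a.
Proof. by move=> s0 <-; rewrite mulKf. Qed.

Lemma half_sum_sqr_root s L a b y : (2 : K) != 0 -> s ^+ 2 = 1 - L ^+ 2 -> 1 + s != 0 ->
  (1 + s) * a = L * y -> (1 + s) * b = L * y -> (L * a + L * b) / 2 = (1 - s) * y.
Proof.
move=> n2 s2 s0 aE bE; apply: (mulfI s0).
have -> : (1 + s) * ((L * a + L * b) / 2) = L * ((1 + s) * a + (1 + s) * b) / 2 by ring.
rewrite aE bE; have -> : L * (L * y + L * y) / 2 = L ^+ 2 * y by field.
have -> : L ^+ 2 = 1 - s ^+ 2 by rewrite s2; ring.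
by ring.
Qed.

End MomentAlgebra.

Lemma cintegral_J11_cst (R : realType) (c : R[i]) : cintegral (@J11 R) (fun=> c) = 2 * c.
Proof.
have E (r : R) : \int[@lebesgue_measure R]_(x in @J11 R) r = 2 * r.
  transitivity (r * fine (@lebesgue_measure R (@J11 R))); last by rewrite mu_J11 mulrC.
  by apply: Rintegral_cst; exact: measurable_J11.
rewrite /cintegral !E; apply/eqP.
by rewrite eq_complex !(ReM, ImM) !(ReD, ImD) /= addr0 !mul0r subr0 addr0 !eqxx.
Qed.

HB.lock Definition moment (R : realType) (lambda : R[i]) N k : R[i] :=
  cintegral (@J11 R) (fun x => W lambda k x ^+ N).

HB.lock Definition root1B (R : realType) (lambda : R[i]) N : R[i] :=
  sqrtc (1 - lambda ^+ (2 * N)).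

Section Moments.
Variable R : realType.
Variable lambda : R[i].
Hypothesis lambda_lt1 : `|lambda| < 1.
Local Notation nrm := (@normc R).
Local Notation W := (W lambda).
Implicit Types (k : int) (x : R) (n N : nat).

Let r1 : nrm lambda < 1. Proof. by rewrite -ltcR -normcE. Qed.
Let mJ := @measurable_J11 R.
Local Hint Resolve mJ : core.

(** The bridge from integrals of [V] over the closed interval to integrals of [W] over [J11]. *)
Lemma cintegral_I11_dyadic (f g : R -> R[i]) : cintegrable (@J11 R) f ->
  cmeasurable (@J11 R) g -> (forall x, J11 x -> ~ dyadic x -> f x = g x) ->
  cintegral (@I11 R) f = cintegral (@J11 R) g.
Proof.
move=> cf mg fg; rewrite cintegral_I11//; apply: ae_eq_cintegral (negligible_dyadic R) _ => //.
exact: cintegrable_measurable.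
Qed.

Lemma J11_I11 x : J11 x -> I11 x.
Proof. by rewrite J11E /I11 /= in_itv /= => /andP[-> /ltW]. Qed.

Lemma bounded_cintegrable_J11 (f : R -> R[i]) (c : R) : cmeasurable (@J11 R) f ->
  (forall x, J11 x -> nrm (f x) <= c) -> cintegrable (@J11 R) f.
Proof. by move=> mf fc; apply: bounded_cintegrable mf fc => //; rewrite mu_J11_lty. Qed.

Lemma le_cintegral_J11 (f : R -> R[i]) (c : R) : cmeasurable (@J11 R) f ->
  (forall x, J11 x -> nrm (f x) <= c) -> nrm (cintegral (@J11 R) f) <= (c + c) * 2.
Proof.
move=> mf fc; have := le_cintegral mJ (mu_J11_lty R) (bounded_cintegrable_J11 mf fc) fc.
by rewrite mu_J11.
Qed.

Lemma cmeasurable_horner (D : set R) (f : R -> R[i]) (P : {poly R[i]}) :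
  cmeasurable D f -> cmeasurable D (fun x => P.[f x]).
Proof.
move=> mf; under eq_fun do rewrite horner_coef.
by apply: cmeasurable_sum => i; apply: cmeasurableZ; exact: cmeasurableX.
Qed.

Lemma normc_horner_le (P : {poly R[i]}) (c : R) (z : R[i]) : nrm z <= c ->
  nrm P.[z] <= \sum_(i < size P) nrm P`_i * c ^+ i.
Proof.
move=> zc; rewrite horner_coef (le_trans (normc_sum _ _ _))//; apply: ler_sum => i _.
rewrite normcM normcX ler_wpM2l ?normc_ge0//.
by apply: lerXn2r => //; rewrite nnegrE ?normc_ge0// (le_trans _ zc)// normc_ge0.
Qed.

Lemma cintegrable_horner_W P k : cintegrable (@J11 R) (fun x => P.[W k x]).
Proof.
apply: bounded_cintegrable_J11; first exact/cmeasurable_horner/cmeasurable_W.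
by move=> x _; apply: normc_horner_le; exact: W_le.
Qed.

Lemma cintegrable_WX k N : cintegrable (@J11 R) (fun x => W k x ^+ N).
Proof. by have := cintegrable_horner_W 'X^N k; under eq_fun do rewrite hornerXn. Qed.

Lemma cintegral_horner_V P :
  cintegral (@I11 R) (fun x => P.[V lambda x]) = cintegral (@J11 R) (fun x => P.[W 0 x]).
Proof.
apply: cintegral_I11_dyadic.
- apply: bounded_cintegrable_J11; last by move=> x _; apply: normc_horner_le; exact: V_le.
  by apply: cmeasurable_horner; apply: cmeasurable_V => //; exact: J11_I11.
- exact/cmeasurable_horner/cmeasurable_W.
- by move=> x /J11_I11 Ix dx; rewrite V_W.
Qed.

Local Notation m := (moment lambda).
Local Notation s := (root1B lambda).

Lemma momentE N k : m N k = cintegral (@J11 R) (fun x => W k x ^+ N).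
Proof. by rewrite moment.unlock. Qed.

Lemma root1BE N : s N = sqrtc (1 - lambda ^+ (2 * N)).
Proof. by rewrite root1B.unlock. Qed.

Lemma cintegral_VX N : cintegral (@I11 R) (fun x => V lambda x ^+ N) = m N 0.
Proof.
rewrite momentE; have := cintegral_horner_V 'X^N; under eq_fun do rewrite hornerXn.
by under [X in _ = cintegral _ X]eq_fun do rewrite hornerXn.
Qed.

Lemma moment_recurrence N k : k != 0 ->
  2 * m N k = lambda ^+ N * (m N (k + 1) + m N (k - 1)).
Proof.
move=> k0; rewrite {1}momentE; have [_ _ ->] := cintegral_halves (cintegrable_WX k N).
have -> : cintegral (@J11 R) (Rminus (fun x => W k x ^+ N)) = lambda ^+ N * m N (k - 1).
  rewrite momentE -cintegralZ//; last exact: cintegrable_WX.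
  apply: eq_cintegral => x /set_mem Jx.
  by rewrite /Rminus -/(half_shift (-1) x) W_half_shiftN1// (negbTE k0) add0r exprMn.
have -> : cintegral (@J11 R) (Rplus (fun x => W k x ^+ N)) = lambda ^+ N * m N (k + 1).
  rewrite momentE -cintegralZ//; last exact: cintegrable_WX.
  apply: eq_cintegral => x /set_mem Jx.
  by rewrite /Rplus -/(half_shift 1 x) W_half_shift1// (negbTE k0) add0r exprMn.
by apply: double_half_sum; rewrite pnatr_eq0.
Qed.

Lemma moment_bounded N : exists c, forall k, nrm (m N k) <= c.
Proof.
pose c := (1 / (1 - nrm lambda)) ^+ N; exists ((c + c) * 2) => k; rewrite momentE.
apply: le_cintegral_J11; first exact/cmeasurableX/cmeasurable_W.
move=> x _; rewrite normcX /c; apply: lerXn2r; rewrite ?nnegrE ?normc_ge0//; last exact: W_le.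
by rewrite divr_ge0// subr_ge0 ltW.
Qed.

Let lambdaN_lt1 N : (0 < N)%N -> nrm (lambda ^+ N) < 1.
Proof. by case: N => // N _; exact: normcXlt1. Qed.

Lemma s_neq0 N : (0 < N)%N -> s N != 0.
Proof. by move=> N0; rewrite root1BE; apply: sqrtc1B_neq0; apply: lambdaN_lt1; rewrite muln_gt0. Qed.

Lemma moment1 N : (0 < N)%N -> (1 + s N) * m N 1 = lambda ^+ N * m N 0.
Proof.
move=> N0; have [c mc] := moment_bounded N; have := @bounded_recurrence R (fun k : nat => m N k%:Z) (lambda ^+ N) c
  (lambdaN_lt1 N0) (fun k : nat => mc _).
rewrite root1BE mulnC exprM; apply => k; rewrite moment_recurrence//.
by congr (_ * (m N _ + m N _)); lia.
Qed.

Lemma momentN1 N : (0 < N)%N -> (1 + s N) * m N (-1) = lambda ^+ N * m N 0.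
Proof.
move=> N0; have [c mc] := moment_bounded N; have := @bounded_recurrence R (fun k : nat => m N (- k%:Z)) (lambda ^+ N) c
  (lambdaN_lt1 N0) (fun k : nat => mc _).
rewrite root1BE mulnC exprM; apply => k; rewrite moment_recurrence ?oppr_eq0//.
by rewrite [_ + m N _]addrC; congr (_ * (m N _ + m N _)); lia.
Qed.

Lemma sqr_s N : s N ^+ 2 = 1 - lambda ^+ N ^+ 2.
Proof. by rewrite root1BE sqr_sqrtc mulnC exprM. Qed.

(** On the two halves [W 0 - 1] equals lambda times [W (-1)] and [W 1]. With L = lambda^N and L^2 =
    (1 - s)(1 + s), the relations (1 + s) m_(+-1) = L m_0 turn the average of L m_1 and L m_(-1)
    into (1 - s) m_0. *)
Lemma cintegral_W_sub1 N : (0 < N)%N ->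
  cintegral (@J11 R) (fun x => (W 0 x - 1) ^+ N) = (1 - s N) * m N 0.
Proof.
move=> N0.
have cW1 : cintegrable (@J11 R) (fun x => (W 0 x - 1) ^+ N).
  have := cintegrable_horner_W (('X - 1%:P) ^+ N) 0.
  by under eq_fun do rewrite horner_exp hornerXsubC.
have [_ _ ->] := cintegral_halves cW1.
have -> : cintegral (@J11 R) (Rminus (fun x => (W 0 x - 1) ^+ N)) = lambda ^+ N * m N (-1).
  rewrite momentE -cintegralZ//; last exact: cintegrable_WX.
  apply: eq_cintegral => x /set_mem Jx.
  by rewrite /Rminus -/(half_shift (-1) x) W_half_shiftN1// addrC addKr exprMn.
have -> : cintegral (@J11 R) (Rplus (fun x => (W 0 x - 1) ^+ N)) = lambda ^+ N * m N 1.
  rewrite momentE -cintegralZ//; last exact: cintegrable_WX.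
  apply: eq_cintegral => x /set_mem Jx.
  by rewrite /Rplus -/(half_shift 1 x) W_half_shift1// addrC addKr exprMn.
apply: half_sum_sqr_root (sqr_s N) _ (momentN1 N0) (moment1 N0).
  by rewrite pnatr_eq0.
by rewrite root1BE; exact: add1_sqrtc_neq0.
Qed.

Lemma moment0 : m 0 0 = 2.
Proof. by rewrite momentE; under eq_fun do rewrite expr0; rewrite cintegral_J11_cst mulr1. Qed.

(** Expand W = 1 + (W - 1). The term n = 0 is the length 2 of the interval, and the term n = N is
    moved to the left, where it leaves the factor [s N]. *)
Lemma moment_binomial N : (0 < N)%N ->
  s N * m N 0 = 2 + \sum_(1 <= n < N) 'C(N, n)%:R * (1 - s n) * m n 0.
Proof.
move=> N0.
have E : m N 0 = \sum_(0 <= n < N.+1) 'C(N, n)%:R *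
    cintegral (@J11 R) (fun x => (W 0 x - 1) ^+ n).
  have cW n : cintegrable (@J11 R) (fun x => (W 0 x - 1) ^+ n).
    have := cintegrable_horner_W (('X - 1%:P) ^+ n) 0.
    by under eq_fun do rewrite horner_exp hornerXsubC.
  rewrite momentE.
  transitivity (cintegral (@J11 R) (fun x => \sum_(0 <= n < N.+1) 'C(N, n)%:R * (W 0 x - 1) ^+ n)).
    apply: eq_cintegral => x _; rewrite -[in LHS](subrK 1 (W 0 x)) addrC exprDn big_mkord.
    by apply: eq_bigr => i _; rewrite expr1n mul1r mulr_natl.
  rewrite cintegral_sum//; last by move=> i; exact: cintegrableZ.
  by apply: eq_bigr => i _; rewrite cintegralZ.
move: E; rewrite big_nat_recr//= binn mul1r big_ltn// bin0 mul1r.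
under eq_fun do rewrite expr0; rewrite cintegral_J11_cst mulr1 cintegral_W_sub1// => E.
apply: sub_fixed; rewrite {1}E; congr (_ + _ + _).
by apply: eq_big_nat => n /andP[n0 _]; rewrite (cintegral_W_sub1 n0) mulrA.
Qed.

Lemma cintegral_V_sub1 N : (0 < N)%N ->
  (1 - s N) * cintegral (@I11 R) (fun x => V lambda x ^+ N) =
  cintegral (@I11 R) (fun x => (V lambda x - 1) ^+ N).
Proof.
move=> N0; rewrite cintegral_VX -(cintegral_W_sub1 N0).
have := cintegral_horner_V (('X - 1%:P) ^+ N).
under eq_fun do rewrite horner_exp hornerXsubC.
move=> ->; apply: eq_cintegral => x _.
by rewrite horner_exp hornerXsubC.
Qed.

Lemma cintegral_VX_recurrence N : (0 < N)%N ->
  cintegral (@I11 R) (fun x => V lambda x ^+ N) =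
  (s N)^-1 * (2 + \sum_(1 <= n < N) 'C(N, n)%:R * (1 - s n)
                   * cintegral (@I11 R) (fun x => V lambda x ^+ n)).
Proof.
move=> N0; rewrite cintegral_VX; apply: (eq_invM (s_neq0 N0)).
rewrite (moment_binomial N0); congr (_ + _).
by apply: eq_bigr => n _; rewrite cintegral_VX.
Qed.

(** Here (W - 1)^N is expanded instead of W^N. Iterating this second recurrence down to order 0
    produces the signed sum over chains. *)
Lemma moment_alternating N : (0 < N)%N ->
  s N * m N 0 = \sum_(0 <= n < N) (-1) ^+ (N + n).+1 * 'C(N, n)%:R * m n 0.
Proof.
move=> N0; have := cintegral_W_sub1 N0.
have -> : cintegral (@J11 R) (fun x => (W 0 x - 1) ^+ N) =
    \sum_(0 <= n < N.+1) (-1) ^+ (N + n) * 'C(N, n)%:R * m n 0.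
  transitivity (cintegral (@J11 R) (fun x => \sum_(0 <= n < N.+1) (-1) ^+ (N + n) * 'C(N, n)%:R * W 0 x ^+ n)).
    apply: eq_cintegral => x _; rewrite addrC exprDn big_mkord.
    apply: eq_bigr => i _; rewrite -mulr_natl mulrCA mulrA; congr (_ * _ * _).
    by rewrite sign_subn// -ltnS.
  rewrite cintegral_sum//; last by move=> i; apply: cintegrableZ => //; exact: cintegrable_WX.
  by apply: eq_bigr => i _; rewrite cintegralZ// ?momentE//; exact: cintegrable_WX.
rewrite big_nat_recr//= addnn -signr_odd odd_double expr0 mul1r binn mul1r => E.
apply: sub_fixed; rewrite -E addrA -big_split /= big1 ?add0r// => i _.
by rewrite exprS mulN1r !mulNr addNr.
Qed.

(** The first N rows of [Amx] are the recurrence [moment_binomial], rewritten with lambda^(2j) / (1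
    + s_j) = 1 - s_j. *)
Lemma Aentry_row_sum N i : (i < N)%N ->
  \sum_(j < N.+1) Aentry lambda i.+1 j * m j 0 = 0.
Proof.
move=> iN; rewrite -(big_mkord xpredT (fun j => Aentry lambda i.+1 j * m j 0)).
rewrite (@big_cat_nat _ _ _ i.+2)//= [X in _ + X]big_nat_cond [X in _ + X]big1; last first.
  move=> j /andP[/andP[h _] _]; rewrite /Aentry (gtn_eqF (leq_ltn_trans _ h))// ltnNge.
  by rewrite (ltnW h)/= gtn_eqF// mul0r.
rewrite addr0 big_nat_recr//= {2}/Aentry eqxx ltnn /= big_ltn// {1}/Aentry /= mul1r.
rewrite moment0 mulNr -(root1BE i.+1) (moment_binomial (ltn0Sn i)).
apply/eqP; rewrite subr_eq0; apply/eqP; congr (_ + _).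
apply/eq_big_nat => j /andP[j0 ji]; rewrite /Aentry (gtn_eqF j0) ji -[X in X * _]mulrA.
rewrite root1BE (@sqr_root_div _ (sqrtc (1 - lambda ^+ (2 * j)))) ?sqr_sqrtc//.
exact: add1_sqrtc_neq0.
Qed.

Lemma cintegral_V_det N (P : {poly R[i]}) : (size P <= N.+1)%N ->
  cintegral (@I11 R) (fun x => P.[V lambda x]) =
  2 / (\prod_(1 <= n < N.+1) s n) * \det (Amx lambda N P).
Proof.
move=> sP; rewrite cintegral_horner_V.
set I := cintegral _ _.
have sn0 : \prod_(1 <= n < N.+1) s n != 0.
  rewrite big_nat; elim/big_ind : _ => [|a b|i /andP[i0 _]]; first exact: oner_neq0.
    exact: mulf_neq0.
  exact: s_neq0.
suff E : I * \prod_(1 <= n < N.+1) s n = 2 * \det (Amx lambda N P).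
  by apply: (mulIf sn0); rewrite E mulrAC mulfVK.
rewrite [RHS]mulrC -moment0.
apply/esym; apply: (@moment_det _ N _ (fun j => m j 0)).
- move=> i j iN ij; rewrite mxE iN /Aentry (gtn_eqF (leq_ltn_trans _ ij))//.
  by rewrite ltnNge (ltnW ij)/= gtn_eqF.
- by move=> i j iN jE; rewrite mxE iN /Aentry jE /= ltnn eqxx root1BE.
- move=> i iN; rewrite -[RHS](Aentry_row_sum iN).
  by apply: eq_bigr => j _; rewrite !mxE iN.
- transitivity (cintegral (@J11 R) (fun x => \sum_(j < N.+1) P`_j * W 0 x ^+ j)).
    rewrite cintegral_sum//; last by move=> j; apply: cintegrableZ => //; exact: cintegrable_WX.
    by apply: eq_bigr => j _; rewrite !mxE /= ltnn momentE cintegralZ//; exact: cintegrable_WX.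
  by apply: eq_cintegral => x _; rewrite -horner_coef_wide.
Qed.

Lemma cintegral_VX_det N :
  cintegral (@I11 R) (fun x => V lambda x ^+ N) =
  2 / (\prod_(1 <= n < N.+1) s n) * \det (Amx_minor lambda N).
Proof.
have := @cintegral_V_det N 'X^N; rewrite size_polyXn => /(_ (leqnn _)).
under eq_fun do rewrite hornerXn; move=> ->; congr (_ * _).
(* For P = X^N the only nonzero entry of the last row is a 1 in the last column, so the determinant
   is that of the leading minor. *)
rewrite (expand_det_row _ ord_max) (bigD1 ord_max)//= big1 ?addr0; last first.
  move=> j jN; rewrite !mxE /= ltnn coefXn (_ : (j == N :> nat) = false) ?mul0r//.
  by apply: contraNF jN => /eqP jN; apply/eqP/val_inj.
rewrite !mxE /= ltnn coefXn eqxx mul1r /cofactor addnn -signr_odd odd_double expr0 mul1r.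
by congr (\det _); apply/matrixP => i j; rewrite !mxE /= /bump !(leqNgt N) !ltn_ord.
Qed.

End Moments.

(** * Unfolding a recurrence over decreasing chains *)

Section Chains.
Variable K : fieldType.

Lemma big_tupleS (T : finType) k (F : k.+1.-tuple T -> K) :
  \sum_c F c = \sum_x \sum_(t : k.-tuple T) F [tuple of x :: t].
Proof.
rewrite pair_big /= (reindex (fun p : T * k.-tuple T => [tuple of p.1 :: p.2]))//=.
exists (fun c : k.+1.-tuple T => (thead c, [tuple of behead c])) => [[x t] _|c _] /=.
  by congr (_, _); apply/val_inj.
by rewrite [RHS]tuple_eta; apply/val_inj.
Qed.

Lemma big_tuple0 (T : finType) (F : 0.-tuple T -> K) : \sum_c F c = F [tuple].
Proof. by rewrite (big_pred1 [tuple])// => t; apply/esym/eqP; exact: tuple0. Qed.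

Variables (w : nat -> nat -> K) (M : nat).
Let gt_ord := fun a b : 'I_M.+1 => (b < a)%N.

(** The starting point [a] is free, unlike in [is_chain], so that removing the first step of a chain
    gives a recursion. *)
Definition chain_sum k (a : 'I_M.+1) : K :=
  \sum_(c : k.+1.-tuple 'I_M.+1 |
      [&& nth ord0 c 0 == a, nth ord0 c k == ord0 & sorted gt_ord c])
    \prod_(j < k) w (nth ord0 c j) (nth ord0 c j.+1).

Lemma chain_sum0 a : chain_sum 0 a = (a == ord0)%:R.
Proof.
rewrite /chain_sum big_mkcond big_tupleS /= (bigD1 a)//= big_tuple0 /= eqxx andbT /=.
rewrite big_ord0 big1 ?addr0; first by case: (_ == _).
by move=> x /negbTE xa; rewrite big_tuple0 /= xa.
Qed.

Lemma chain_sumS k a :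
  chain_sum k.+1 a = \sum_(b : 'I_M.+1 | (b < a)%N) w a b * chain_sum k b.
Proof.
rewrite /chain_sum [LHS]big_mkcond big_tupleS /= (bigD1 a)//= [X in _ + X]big1 ?addr0; last first.
  by move=> x /negbTE xa; rewrite big1// => t _; rewrite xa.
under [RHS]eq_bigr do rewrite big_distrr /= big_mkcond.
rewrite [RHS]exchange_big /=; apply: eq_bigr => -[t /= /eqP].
case: t => [//|y t] /= _; rewrite eqxx /=.
rewrite [RHS]big_mkcond (bigD1 y)//= eqxx [X in _ + X]big1 ?addr0; last first.
  by move=> b yb; rewrite (eq_sym y) (negbTE yb) if_same.
rewrite /gt_ord; case: ifP => [/and3P[-> -> ->] /=|].
  by rewrite big_ord_recl.
case: (y < a)%N => //=.
by case: (_ == ord0) => //= ->.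
Qed.

(** Each use of the recurrence prepends one step. A chain from [a] has at most [a] steps, so any
    bound [k] with a <= k captures all of them. *)
Lemma sum_chain_sum (I : nat -> K) k (a : 'I_M.+1) : I 0%N = 2 ->
  (forall n, (0 < n)%N -> I n = \sum_(0 <= b < n) w n b * I b) -> (a <= k)%N ->
  I a = 2 * \sum_(0 <= j < k.+1) chain_sum j a.
Proof.
move=> I0 IS; elim: k a => [|k IH] a ak.
  rewrite big_nat1 chain_sum0; have -> : a = ord0 by apply/val_inj/eqP; rewrite -leqn0.
  by rewrite eqxx mulr1.
rewrite big_nat_recl// chain_sum0.
under eq_bigr do rewrite chain_sumS; rewrite exchange_big /=.
under eq_bigr do rewrite -big_distrr /=.
have [a0|a0] := posnP a.
  have -> : a = ord0 by exact/val_inj.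
  by rewrite eqxx big_pred0// addr0 mulr1.
have -> : (a == ord0) = false by apply: contraTF a0 => /eqP ->.
rewrite add0r big_distrr /= IS// big_mkord (big_ord_widen _ (fun b => w a b * I b) (ltnW (ltn_ord a))).
apply: eq_bigr => b ba; rewrite mulrCA; congr (_ * _); apply: IH.
by rewrite -ltnS (leq_trans ba).
Qed.

(** Every intermediate node occurs twice in the total exponent, so only the end points and the
    number of steps remain. *)
Lemma prod_sign (c : nat -> nat) k :
  \prod_(j < k) (-1 : K) ^+ (c j + c j.+1).+1 = (-1) ^+ (c 0%N + c k + k).
Proof.
elim: k => [|k IH].
  by rewrite big_ord0 addn0 addnn -muln2 mulnC exprM sqrrN !expr1n.
rewrite big_ord_recr /= IH -exprD.
have -> : (c 0 + c k + k + (c k + c k.+1).+1 = 2 * c k + (c 0 + c k.+1 + k.+1))%N by lia.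
by rewrite exprD exprM sqrrN !expr1n mul1r.
Qed.

End Chains.

Lemma cintegral_VX_chains (R : realType) (lambda : R[i]) N : `|lambda| < 1 -> (0 < N)%N ->
  cintegral (@I11 R) (fun x => V lambda x ^+ N)
  = 2 * \sum_(1 <= k < N.+1) \sum_(c : k.+1.-tuple 'I_N.+1 | is_chain c) chain_term lambda c.
Proof.
move=> l1 N0; rewrite cintegral_VX//.
(* The weight of a single step, including its sign; the signs along a chain from N to 0 multiply to
   (-1)^(N + k). *)
pose w a b : R[i] := (root1B lambda a)^-1 * ((-1) ^+ (a + b).+1 * 'C(a, b)%:R).
have HS n : (0 < n)%N -> moment lambda n 0 = \sum_(0 <= b < n) w n b * moment lambda b 0.
  move=> n0; have := eq_invM (s_neq0 l1 n0) (moment_alternating l1 n0).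
  by move=> ->; rewrite big_distrr /=; apply: eq_bigr => b _; rewrite mulrA.
have := @sum_chain_sum _ w N (fun n => moment lambda n 0) N ord_max (moment0 lambda) HS (leqnn _).
move=> ->; apply: congr1.
(* The chain without steps would need N = 0, so the summation starts at k = 1. *)
rewrite big_ltn// chain_sum0 (_ : ord_max == ord0 = false) ?add0r; last first.
  by apply: contraTF N0 => /eqP/(congr1 val) /= ->.
apply: eq_bigr => k _; apply: eq_bigr => c /and3P[c0 ck _].
rewrite /chain_term /w -mulrA.
rewrite big_split /= big_split /=.
have := prod_sign R[i] (fun j => nth ord0 c j : nat) k.
rewrite /= (eqP c0) (eqP ck) /= addn0 => ->.
rewrite [LHS]mulrC -mulrA; apply: congr1; apply: congr2 => //.
by apply: eq_bigr => j _; rewrite root1BE.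
Qed.

(** * Triangular transfer systems and bordered determinants *)

Section TransferSystem.
Variables (K : fieldType) (N : nat).
Local Notation I := 'I_N.+1.
(** A system of recurrences in k for N + 1 coupled components, with lower triangular unipotent [A]
    and [A']. The geometric solution [v j n * t j ^+ k] is described without division: [kap j] is h
    t_j, and [tau j] plays the role of h / t_j and stays nonzero even when h and t_j vanish. [w j]
    is the corresponding left vector. Boundedness is an abstract predicate with the few properties
    listed, which makes the rest pure algebra. *)
Variables (h q : K) (p2 tau kap t : I -> K) (A A' : I -> I -> K) (v w : I -> I -> K).
Variable bounded_seq : (nat -> K) -> Prop.
Hypothesis p2_inj : injective p2.
Hypothesis A_trig : forall n m : I, (n < m)%N -> A n m = 0.
Hypothesis A'_trig : forall n m : I, (n < m)%N -> A' n m = 0.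
Hypothesis A_diag : forall n, A n n = 1.
Hypothesis A'_diag : forall n, A' n n = 1.
Hypothesis tauDkap : forall j, tau j + kap j = p2 j.
Hypothesis taukap : forall j, kap j * tau j = q.
Hypothesis tau_neq0 : forall j, tau j != 0.
Hypothesis ht : forall j, h * t j = kap j.
Hypothesis taut : forall j, tau j * t j = h.
Hypothesis tau_kap : forall j, tau j - kap j != 0.
Hypothesis v_lt : forall j n : I, (n < j)%N -> v j n = 0.
Hypothesis v_diag : forall j, v j j = 1.
Hypothesis v_null : forall j n, \sum_i (kap j * A n i + tau j * A' n i) * v j i = p2 n * v j n.
Hypothesis w_gt : forall j n : I, (j < n)%N -> w j n = 0.
Hypothesis w_diag : forall j, w j j = 1.
Hypothesis w_null : forall j i, \sum_n w j n * (kap j * A n i + tau j * A' n i) = w j i * p2 i.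
Hypothesis bounded_seqB : forall u u' a, bounded_seq u -> bounded_seq u' ->
  bounded_seq (fun k => u k - a * u' k).
Hypothesis bounded_seq0 : bounded_seq (fun=> 0).
Hypothesis bounded_t : forall j, bounded_seq (fun k => t j ^+ k).
Hypothesis bounded_shift : forall u, bounded_seq u -> bounded_seq (fun k => u k.+1).
Hypothesis bounded_decay : forall j u, bounded_seq u ->
  (forall k, p2 j * u k.+1 = h * (u k.+2 + u k)) -> forall k, u k.+1 = t j * u k.
Hypothesis bounded_growth : forall j u, bounded_seq u ->
  (forall k, u k = t j * u k.+1) -> u 0%N = 0.

Let step (u : nat -> I -> K) := forall k n,
  p2 n * u k.+1 n = h * \sum_i (A n i * u k.+2 i + A' n i * u k i).

Lemma v_step j : step (fun k n => v j n * t j ^+ k).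
Proof.
move=> k n; rewrite mulrA -v_null big_distrl big_distrr /=; apply: eq_bigr => i _.
rewrite -(ht j) !exprS.
have -> : (h * t j * A n i + tau j * A' n i) * v j i * (t j * t j ^+ k) =
  h * (A n i * (v j i * (t j * (t j * t j ^+ k)))) + tau j * t j * (A' n i * (v j i * t j ^+ k)).
  by ring.
by rewrite taut -mulrDr.
Qed.

Lemma stepB u u' a : step u -> step u' -> step (fun k n => u k n - a * u' k n).
Proof.
move=> su su' k n; rewrite mulrBr su mulrCA su'.
rewrite mulrCA -mulrBr big_distrr /= -sumrB; congr (_ * _); apply: eq_bigr => i _.
ring.
Qed.

(** By triangularity the lowest component that may be nonzero, j = N - d, satisfies a scalar
    recurrence and is a multiple of t_j^k by [bounded_decay]. Subtracting that multiple of the j-th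
    geometric solution makes this component vanish too, which is the induction on [d]. *)
Lemma decompose_vanish d (u : nat -> I -> K) : step u ->
  (forall n, bounded_seq (u ^~ n)) ->
  (forall k (n : I), (n + d < N.+1)%N -> u k n = 0) ->
  exists alpha : I -> K, forall k n, u k n = \sum_j alpha j * v j n * t j ^+ k.
Proof.
elim: d u => [|d IH] u su bu u0.
  exists (fun=> 0) => k n; rewrite u0 ?addn0// big1// => j _; by rewrite !mul0r.
have [Nd|dN] := leqP N.+1 d.
  apply: IH => // k n; rewrite ltnNge (leq_trans Nd)// leq_addl //.
have jP : (N - d < N.+1)%N by rewrite ltnS leq_subr.
pose j : I := Ordinal jP.
have uj k : u k j = u 0%N j * t j ^+ k.
  have H : forall k, u k.+1 j = t j * u k j.
    apply: bounded_decay => // l; rewrite su; congr (_ * _).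
    rewrite (bigD1 j)//= A_diag A'_diag !mul1r big1 ?addr0// => i ij.
    have [ji|ji] := ltnP j i; first by rewrite A_trig// A'_trig// !mul0r addr0.
    have {}ji : (i < j)%N by rewrite ltn_neqAle ji andbT; apply: contraNneq ij => /val_inj ->.
    by rewrite !u0 ?mulr0 ?addr0//; move: ji; rewrite /=; lia.
  elim: k => [|k IHk]; first by rewrite expr0 mulr1.
  by rewrite H IHk exprS mulrCA.
have [] := IH (fun k n => u k n - u 0%N j * (v j n * t j ^+ k)).
- exact: (stepB _ su (v_step j)).
- move=> n; apply: bounded_seqB => //.
  have := bounded_seqB (- v j n) bounded_seq0 (bounded_t j).
  by under eq_fun do rewrite sub0r mulNr opprK.
- move=> k n nd; have [nj|jn] := ltnP n j.
    rewrite v_lt// u0; first by rewrite mul0r mulr0 subr0.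
    by move: nj => /=; lia.
  have -> : n = j by apply/val_inj => /=; move: jn nd => /=; lia.
  by rewrite uj v_diag mul1r subrr.
move=> alpha E; exists (fun i => alpha i + (i == j)%:R * u 0%N j) => k n.
have := E k n => /eqP; rewrite subr_eq => /eqP ->.
under [RHS]eq_bigr do rewrite !mulrDl; rewrite big_split /=; congr (_ + _).
rewrite (bigD1 j)//= eqxx mul1r big1 ?addr0 ?mulrA// => i /negbTE ->.
by rewrite !mul0r.
Qed.

Let wA j i := \sum_n \sum_l w j n * A n l * v i l.
Let wA' j i := \sum_n \sum_l w j n * A' n l * v i l.

(** [w j] is supported on n <= j, [v j] on l >= j, and [X] on l <= n; only n = l = j survives. *)
Lemma triangular_pairing (X : I -> I -> K) j : (forall n m : I, (n < m)%N -> X n m = 0) ->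
  \sum_n \sum_l w j n * X n l * v j l = X j j.
Proof.
move=> X0; rewrite (bigD1 j)//= (bigD1 j)//= w_diag v_diag mul1r mulr1.
rewrite [X in _ + X + _]big1 ?addr0; last first.
  move=> l lj; have [jl|jl] := ltnP j l; first by rewrite X0// !mulr0 mul0r.
  rewrite v_lt ?mulr0// ltn_neqAle jl andbT; by apply: contraNneq lj => /val_inj ->.
rewrite big1 ?addr0// => n nj; apply: big1 => l _.
have [jn|jn] := ltnP j n; first by rewrite w_gt// !mul0r.
have {}jn : (n < j)%N by rewrite ltn_neqAle jn andbT; apply: contraNneq nj => /val_inj ->.
have [lj|jl] := ltnP l j; first by rewrite v_lt ?mulr0.
by rewrite X0 ?mulr0 ?mul0r// (leq_trans jn jl).
Qed.

Lemma pairing_split j i k : \sum_n \sum_l w j n * (kap k * A n l + tau k * A' n l) * v i l =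
  kap k * wA j i + tau k * wA' j i.
Proof.
rewrite !big_distrr /= -big_split /=; apply: eq_bigr => n _.
rewrite !big_distrr /= -big_split /=; apply: eq_bigr => l _; ring.
Qed.

(** Evaluating w_j p2 v_i through both null relations gives kap_i X + tau_i Y = kap_j X + tau_j Y
    for the two pairings X, Y. As all the products kap tau equal [q], the difference is, up to the
    nonzero factor tau_i, a multiple of tau_i - tau_j, which is nonzero because [p2] is
    injective. *)
Lemma pairing_orth j i : i != j -> tau j * wA' j i - kap i * wA j i = 0.
Proof.
move=> ij.
have E : kap i * wA j i + tau i * wA' j i = kap j * wA j i + tau j * wA' j i.
  rewrite -!pairing_split.
  transitivity (\sum_n w j n * (p2 n * v i n)).
    apply: eq_bigr => n _; rewrite -v_null big_distrr /=; apply: eq_bigr => l _.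
    by rewrite mulrA.
  rewrite [RHS]exchange_big /=; apply: eq_bigr => n _.
  by rewrite -big_distrl /= w_null mulrA.
have tij : tau i - tau j != 0.
  rewrite subr_eq0; apply: contraNneq ij => tE; apply/eqP/p2_inj.
  rewrite -!tauDkap tE; congr (_ + _); apply: (mulIf (tau_neq0 j)).
  by rewrite -{1}tE !taukap.
apply: (mulfI tij); apply: (mulfI (tau_neq0 i)); rewrite !mulr0.
move: (taukap i) (taukap j) E; move: (wA j i) (wA' j i) => X Y qi qj E.
have {}E : kap j * X = kap i * X + tau i * Y - tau j * Y by rewrite E addrK.
have -> : tau i * ((tau i - tau j) * (tau j * Y - kap i * X)) =
  tau i * tau j * (kap i * X + tau i * Y - tau j * Y) - tau i * tau i * (kap i * X).
  by ring.
rewrite -E.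
have -> : tau i * tau j * (kap j * X) - tau i * tau i * (kap i * X) =
  tau i * X * (kap j * tau j - kap i * tau i) by ring.
by rewrite qi qj subrr mulr0.
Qed.

Variables (m : int -> I -> K) (c : I -> K).
Hypothesis m_eq : forall k n,
  p2 n * m k n = (k == 0)%:R * c n + h * \sum_i (A n i * m (k + 1) i + A' n i * m (k - 1) i).
Hypothesis bounded_m : forall n, bounded_seq (fun k => m k%:Z n).
Hypothesis bounded_mN : forall n, bounded_seq (fun k => m (- k%:Z) n).

Lemma bounded_comb (J : Type) (s : seq J) (a : J -> K) (u : J -> nat -> K) :
  (forall i, bounded_seq (u i)) -> bounded_seq (fun k => \sum_(i <- s) a i * u i k).
Proof.
move=> bu; elim: s => [|i s IH].
  by under eq_fun do rewrite big_nil.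
under eq_fun do rewrite big_cons addrC.
have := bounded_seqB (- a i) IH (bu i).
by under eq_fun do rewrite mulNr opprK.
Qed.

Let pairm (X : I -> I -> K) j k := \sum_n \sum_i w j n * X n i * m k i.

Lemma bounded_pairm X j : bounded_seq (fun k => pairm X j (- k%:Z)).
Proof.
rewrite /pairm; under eq_fun do rewrite pair_big /=.
exact: (bounded_comb _ (fun p : I * I => w j p.1 * X p.1 p.2) (fun p => bounded_mN p.2)).
Qed.

(** Pairing with [w j] replaces the factors [p2 n] by kap A + tau A', so both sides are expressed by
    the same two scalar sequences. *)
Lemma paired_eq j k : kap j * pairm A j k + tau j * pairm A' j k =
  (k == 0)%:R * (\sum_n w j n * c n) + h * (pairm A j (k + 1) + pairm A' j (k - 1)).
Proof.
transitivity (\sum_n w j n * (p2 n * m k n)).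
  transitivity (\sum_n \sum_i w j n * (kap j * A n i + tau j * A' n i) * m k i).
    rewrite !big_distrr /= -big_split /=; apply: eq_bigr => n _.
    by rewrite !big_distrr /= -big_split /=; apply: eq_bigr => i _; ring.
  rewrite exchange_big /=; apply: eq_bigr => i _.
  by rewrite -big_distrl /= w_null mulrA.
rewrite /pairm -big_split /= !big_distrr /= -big_split /=; apply: eq_bigr => n _.
rewrite m_eq -big_split /= !mulrDr; congr (_ + _); first by rewrite mulrCA.
rewrite mulrCA; congr (_ * _); rewrite big_distrr /=; apply: eq_bigr => i _.
by rewrite mulrDr !mulrA.
Qed.

Lemma paired_at0 j : \sum_n w j n * c n = tau j * pairm A' j 0 - h * pairm A j 1.
Proof.
(* On the side k < 0 the paired equation becomes e_l = t_j e_(l+1); a bounded [e] of this kind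
   vanishes at 0. This removes the unknown value at k = -1 without decomposing the solution for
   negative k. *)
pose e l := h * pairm A j (- l%:Z) - tau j * pairm A' j (- l.+1%:Z).
have eS l : e l = t j * e l.+1.
  have := paired_eq j (- l.+1%:Z); rewrite oppr_eq0 mul0r add0r.
  have -> : - l.+1%:Z + 1 = - l%:Z by lia.
  have -> : - l.+1%:Z - 1 = - l.+2%:Z by lia.
  rewrite /e -ht => E; have {E} : h * pairm A j (- l%:Z) = h * t j * pairm A j (- l.+1%:Z) +
      tau j * pairm A' j (- l.+1%:Z) - h * pairm A' j (- l.+2%:Z).
    by rewrite E; ring.
  by move=> ->; rewrite -{2}(taut j); ring.
have e0 : e 0%N = 0.
  apply: (bounded_growth (j := j)) eS.
  rewrite /e; have h1 := bounded_pairm A j; have h2 := bounded_shift (bounded_pairm A' j).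
  have := bounded_seqB (tau j) (bounded_seqB (- h) bounded_seq0 h1) h2.
  by under eq_fun do rewrite sub0r mulNr opprK.
have := paired_eq j 0; rewrite eqxx mul1r add0r sub0r => E.
have {E} -> : \sum_n w j n * c n = kap j * pairm A j 0 + tau j * pairm A' j 0
    - h * pairm A j 1 - h * pairm A' j (-1) by rewrite E; ring.
move: e0; rewrite /e oppr0 => /eqP; rewrite subr_eq0 => /eqP e0.
by rewrite -ht mulrAC e0 -{2}(taut j); ring.
Qed.

(** For k >= 0 the solution is a combination of geometric ones, since the source acts only at k = 0.
    Inserting it into [paired_at0], orthogonality isolates one coefficient, with factor tau_j -
    kap_j. *)
Lemma transfer_solution n :
  m 0 n = \sum_j (\sum_i w j i * c i) / (tau j - kap j) * v j n.
Proof.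
have sm : step (fun k n => m k%:Z n).
  move=> k i; rewrite m_eq mul0r add0r; congr (_ * _); apply: eq_bigr => l _.
  by congr (_ * m _ _ + _ * m _ _); lia.
have [|alpha E] := @decompose_vanish N.+1 _ sm bounded_m.
  by move=> k i; rewrite ltnNge leq_addl.
have m0 i : m 0 i = \sum_j alpha j * v j i.
  by rewrite (E 0%N); apply: eq_bigr => j _; rewrite expr0 mulr1.
have m1 i : m 1 i = \sum_j alpha j * v j i * t j.
  by rewrite (E 1%N); apply: eq_bigr => j _; rewrite expr1.
rewrite m0; apply: eq_bigr => j _; congr (_ * _).
apply: (mulIf (tau_kap j)); rewrite mulfVK// paired_at0.
have -> : pairm A' j 0 = \sum_i alpha i * wA' j i.
  rewrite /pairm /wA'; under eq_bigr do under eq_bigr do rewrite m0 big_distrr /=.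
  under eq_bigr do rewrite exchange_big /=; rewrite exchange_big /=; apply: eq_bigr => i _.
  rewrite big_distrr /=; apply: eq_bigr => l _; rewrite big_distrr /=; apply: eq_bigr => k _.
  ring.
have -> : h * pairm A j 1 = \sum_i alpha i * (kap i * wA j i).
  rewrite /pairm /wA; under eq_bigr do under eq_bigr do rewrite m1 big_distrr /=.
  under eq_bigr do rewrite exchange_big /=; rewrite exchange_big /= big_distrr /=.
  apply: eq_bigr => i _; rewrite !big_distrr /=; apply: eq_bigr => l _.
  by rewrite !big_distrr /=; apply: eq_bigr => k _; rewrite -ht; ring.
rewrite big_distrr /= -sumrB (bigD1 j)//= big1 ?addr0; last first.
  move=> i ij; rewrite mulrCA -mulrBr pairing_orth ?mulr0//.
rewrite /wA /wA' !triangular_pairing// A_diag A'_diag; ring.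
Qed.

End TransferSystem.

(** * Null vectors of a triangular matrix with one zero on the diagonal *)

Section NullVectors.
Variables (K : fieldType) (n : nat) (T : 'M[K]_n.+1) (j : 'I_n.+1).
Hypothesis T_trig : forall i k : 'I_n.+1, (i < k)%N -> T i k = 0.
Hypothesis Tjj : T j j = 0.
Hypothesis T_diag : forall i, i != j -> T i i != 0.

Let det_T : \det T = 0.
Proof.
rewrite det_trig; last by apply/is_trig_mxP.
by rewrite (bigD1 j)//= Tjj mul0r.
Qed.

Lemma lift_mono (i k : 'I_n) : (i < k)%N -> (lift j i < lift j k)%N.
Proof. by move=> ik; rewrite /= /bump; lia. Qed.

Lemma cofactor_trig : cofactor T j j = \prod_(i | i != j) T i i.
Proof.
rewrite /cofactor addnn -signr_odd odd_double expr0 mul1r det_trig; last first.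
  by apply/is_trig_mxP => i k ik; rewrite !mxE T_trig//; exact: lift_mono.
rewrite [RHS](reindex_omap (lift j) (unlift j)); last first.
  by move=> i; rewrite eq_sym => /unlift_some[k -> ->].
apply: eq_big => [i|i _]; last by rewrite !mxE.
by rewrite liftK eqxx eq_sym neq_lift.
Qed.

Lemma cofactor_trig_neq0 : cofactor T j j != 0.
Proof. by rewrite cofactor_trig; apply/prodf_neq0 => i; exact: T_diag. Qed.

(** Column j of the adjugate, a null vector because the determinant is 0. Its j-th entry is the
    product of the other diagonal entries, hence invertible; the entries before j vanish by forward
    substitution. *)
Lemma right_null_vector : exists v : 'I_n.+1 -> K,
  [/\ forall i, \sum_k T i k * v k = 0, v j = 1 & forall i : 'I_n.+1, (i < j)%N -> v i = 0].
Proof.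
exists (fun i => (cofactor T j j)^-1 * \adj T i j).
have nul i : \sum_k T i k * ((cofactor T j j)^-1 * \adj T k j) = 0.
  have E : (T *m \adj T) i j = 0 by rewrite mul_mx_adj det_T mxE mul0rn.
  rewrite mxE in E; under eq_bigr do rewrite mulrCA; by rewrite -big_distrr /= E mulr0.
split => //; first by rewrite mxE mulVf// cofactor_trig_neq0.
move=> [i iP]; elim/ltn_ind: i iP => i IH iP /= ij.
have := nul (Ordinal iP); rewrite (bigD1 (Ordinal iP))//= big1 ?addr0; last first.
  move=> k ki; have [ik|ik] := ltnP i k; first by rewrite T_trig ?mul0r.
  have {}ik : (k < i)%N by rewrite ltn_neqAle ik andbT; apply: contraNneq ki => ki; apply/eqP/val_inj.
  by case: k ki ik => k kP ki ik; rewrite IH ?mulr0//= (ltn_trans ik).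
move/eqP; rewrite mulf_eq0 => /orP[|/eqP//].
by rewrite (negbTE (T_diag _))//; apply: contraTneq ij => <-; rewrite ltnn.
Qed.

(** The mirror image: row j of the adjugate, with backward substitution from the last index. *)
Lemma left_null_vector : exists w : 'I_n.+1 -> K,
  [/\ forall k, \sum_i w i * T i k = 0, w j = 1 & forall i : 'I_n.+1, (j < i)%N -> w i = 0].
Proof.
exists (fun i => (cofactor T j j)^-1 * \adj T j i).
have nul k : \sum_i (cofactor T j j)^-1 * \adj T j i * T i k = 0.
  have E : (\adj T *m T) j k = 0 by rewrite mul_adj_mx det_T mxE mul0rn.
  rewrite mxE in E; under eq_bigr do rewrite -mulrA; by rewrite -big_distrr /= E mulr0.
split => //; first by rewrite mxE mulVf// cofactor_trig_neq0.
suff H d (i : 'I_n.+1) : (n - i)%N = d -> (j < i)%N -> (cofactor T j j)^-1 * \adj T j i = 0.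
  by move=> i; exact: H.
elim/ltn_ind: d i => d IH i dE ji.
have := nul i; rewrite (bigD1 i)//= big1 ?addr0; last first.
  move=> k ki; have [ik|ik] := ltnP k i; first by rewrite T_trig ?mulr0.
  have {}ik : (i < k)%N.
    by rewrite ltn_neqAle ik andbT; apply: contraNneq ki => ki; apply/eqP/val_inj.
  rewrite (IH (n - k)%N _ k) ?mul0r ?(ltn_trans ji)//.
  by move: (ltn_ord k) ik dE; lia.
move/eqP; rewrite mulf_eq0 => /orP[/eqP//|].
by rewrite (negbTE (T_diag _))//; apply: contraTneq ji => ->; rewrite ltnn.
Qed.

(* The determinant of the bordered matrix [T, c; -p, 0], whose kernel-like
   vectors are (v, 0) and (w, 0). *)
Lemma det_bordered (B : 'M[K]_n.+2) (c p v w : 'I_n.+1 -> K) :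
  (forall i k, B (widen_ord (leqnSn _) i) (widen_ord (leqnSn _) k) = T i k) ->
  (forall i, B (widen_ord (leqnSn _) i) ord_max = c i) ->
  (forall k, B ord_max (widen_ord (leqnSn _) k) = - p k) ->
  (forall i, \sum_k T i k * v k = 0) -> v j = 1 ->
  (forall k, \sum_i w i * T i k = 0) -> w j = 1 ->
  \det B = (\sum_k p k * v k) * (\sum_i w i * c i) * \prod_(i | i != j) T i i.
Proof.
move=> BT Bc Bp vn vj wn wj.
pose W k := widen_ord (leqnSn n.+1) k.
pose j' := W j.
have last_or (i : 'I_n.+2) : i = ord_max \/ exists k, i = W k.
  have [/eqP iE|iE] := boolP (val i == n.+1); first by left; exact/val_inj.
  right; have ip : (i < n.+1)%N by rewrite ltn_neqAle iE -ltnS ltn_ord.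
  by exists (Ordinal ip); exact/val_inj.
have WN k : (W k == ord_max) = false.
  by apply/negbTE; rewrite -val_eqE /= neq_ltn ltn_ord.
pose u : 'cV[K]_n.+2 := \col_i (if insub (val i) is Some k then v k else 0).
have uW k : u (W k) 0 = v k by rewrite !mxE /= insubT /= ?ltn_ord// => p0; congr v; exact/val_inj.
have uN : u ord_max 0 = 0 by rewrite mxE insubF//= ltnn.
(* Cramer's rule for the vector (v, 0) reduces the determinant to the cofactor at the last row and
   column j. *)
have Bu : B *m u = (- \sum_k p k * v k) *: delta_mx ord_max 0.
  apply/matrixP => i z; rewrite !ord1 !mxE eqxx andbT big_ord_recr /= uN mulr0 addr0.
  have [->|[k ->]] := last_or i.
    rewrite eqxx mulr1 -sumrN; apply: eq_bigr => l _.
    by rewrite -/(W l) uW Bp mulNr.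
  rewrite WN mulr0 -[RHS](vn k); apply: eq_bigr => l _.
  by rewrite -/(W l) uW BT.
have := mulmx_adj_col j' Bu; rewrite uW vj mulr1 => ->.
rewrite /cofactor; set C := row' _ _.
have lift_last (k : 'I_n.+1) : lift ord_max k = W k.
  by apply/val_inj; rewrite /= /bump leqNgt ltn_ord.
have liftjN : lift j' ord_max = ord_max.
  by apply/val_inj; rewrite /= /bump -ltnS ltn_ord.
have liftjW (k : 'I_n) : lift j' (widen_ord (leqnSn n) k) = W (lift j k).
  by apply/val_inj.
(* In the remaining minor, [w] annihilates all columns but the border column, so Cramer's rule
   applies again, to the transpose. What is left is the principal minor of [T] without index j. *)
have Cw : C^T *m (\col_i w i : 'cV_n.+1) = (\sum_i w i * c i) *: delta_mx ord_max 0.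
  apply/matrixP => i z; rewrite !ord1 !mxE eqxx andbT.
  under eq_bigr => l _ do rewrite !mxE lift_last.
  have [/eqP iE|iE] := boolP (val i == n).
    have -> : i = ord_max by exact/val_inj.
    rewrite eqxx mulr1 liftjN; apply: eq_bigr => l _; by rewrite Bc mulrC.
  have ip : (i < n)%N by rewrite ltn_neqAle iE -ltnS ltn_ord.
  have -> : i = widen_ord (leqnSn n) (Ordinal ip) by exact/val_inj.
  rewrite liftjW (_ : (_ == ord_max) = false); last first.
    by apply/negbTE; rewrite -val_eqE /= neq_ltn ip.
  rewrite mulr0 -[RHS](wn (lift j (Ordinal ip))); apply: eq_bigr => l _; by rewrite BT mulrC.
have := mulmx_adj_col j Cw; rewrite det_tr mxE wj mulr1 => ->.
rewrite /cofactor -cofactor_trig /cofactor.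
have -> : \det (row' ord_max (col' j C^T)) = \det (row' j (col' j T)).
  rewrite -det_tr; congr (\det _); apply/matrixP => i k; rewrite !mxE lift_last.
  have -> : lift ord_max k = widen_ord (leqnSn n) k.
    by apply/val_inj; rewrite /= /bump leqNgt ltn_ord.
  by rewrite liftjW BT.
set d := \det _; set a := \sum_i w i * c i; set b := \sum_k p k * v k.
(* The two cofactor signs have product -1, which cancels the minus sign of the last row. *)
have -> : (-1) ^+ (@ord_max n.+1 + j') = - (-1) ^+ (n + j) :> K by rewrite /= addSn exprS mulN1r.
rewrite [in RHS](_ : (-1) ^+ (j + j) = (-1) ^+ (n + j) * (-1) ^+ (n + j)); last first.
  by rewrite -exprD !addnn -!muln2 ![(_ * 2)%N]mulnC !exprM !sqrrN !expr1n.
by rewrite /=; move: ((-1) ^+ (n + j)) => e; ring.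
Qed.

End NullVectors.

(** * The residue formula for powers of 2 *)

Section Residues.
Variables (K : fieldType) (N : nat) (lam : K) (sg : nat -> K).
Local Notation I := 'I_N.+1.
Variable bounded_seq : (nat -> K) -> Prop.
Hypothesis exp2_inj : forall a b, (2 : K) ^+ a = 2 ^+ b -> a = b.
Hypothesis sg2 : forall j, sg j ^+ 2 = 1 - lam ^+ 2 / 4 ^+ j.
Hypothesis sg_neq0 : forall j, sg j != 0.
Hypothesis sg1_neq0 : forall j, 1 + sg j != 0.

Let t j := lam / (2 ^+ j * (1 + sg j)).

Hypothesis bounded_seqB : forall u u' a, bounded_seq u -> bounded_seq u' ->
  bounded_seq (fun k => u k - a * u' k).
Hypothesis bounded_seq0 : bounded_seq (fun=> 0).
Hypothesis bounded_t : forall j, bounded_seq (fun k => t j ^+ k).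
Hypothesis bounded_shift : forall u, bounded_seq u -> bounded_seq (fun k => u k.+1).
Hypothesis bounded_decay : forall j u, bounded_seq u ->
  (forall k, 2 ^+ j * u k.+1 = lam / 2 * (u k.+2 + u k)) -> forall k, u k.+1 = t j * u k.
Hypothesis bounded_growth : forall j u, bounded_seq u ->
  (forall k, u k = t j * u k.+1) -> u 0%N = 0.

Variables (m : int -> nat -> K) (c : nat -> K).
Hypothesis m_eq : forall k n,
  2 ^+ n * m k n = (k == 0)%:R * (2 * c n) +
    lam / 2 * \sum_(i < n.+1) ('C(n, i)%:R * m (k + 1) i + (-1) ^+ (n + i) * 'C(n, i)%:R * m (k - 1) i).
Hypothesis bounded_m : forall n, bounded_seq (fun k => m k%:Z n).
Hypothesis bounded_mN : forall n, bounded_seq (fun k => m (- k%:Z) n).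

Let entry j n i : K := if i == n then 1 - 2 ^+ n / 2 ^+ j
  else if (n < i)%N then 0
  else if odd (n - i) then - ('C(n, i)%:R * sg j) else 'C(n, i)%:R.

Let two_neq0 : (2 : K) != 0.
Proof.
by apply/eqP => h; have /exp2_inj : (2 : K) ^+ 1 = 2 ^+ 2 by rewrite !exprS expr0 h !mul0r.
Qed.

Let exp2n0 j : (2 : K) ^+ j != 0. Proof. exact: expf_neq0. Qed.

(** [tau j] and [kap j] are the roots of X^2 - 2^j X + lam^2 / 4, whose discriminant is the square
    of 2^j sg_j. *)
Let tau (j : I) : K := 2 ^+ j * (1 + sg j) / 2.
Let kap (j : I) : K := 2 ^+ j * (1 - sg j) / 2.
Let A (n i : I) : K := 'C(n, i)%:R.
Let A' (n i : I) : K := (-1) ^+ (n + i) * 'C(n, i)%:R.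
Let T (j : I) : 'M[K]_N.+1 := \matrix_(n, i) entry j n i.

(** This is where the entries of B^(j) come from. Off the diagonal the parity of n - i decides
    between kap + tau = 2^j and kap - tau = - 2^j sg_j; on the diagonal the term 2^n is split off,
    so null vectors of [T j] satisfy exactly the relations required of [v] and [w]. *)
Let entryE (j n i : I) : kap j * A n i + tau j * A' n i = 2 ^+ j * T j n i + 2 ^+ n * (n == i)%:R.
Proof.
rewrite mxE /entry /A /A' eq_sym -val_eqE /=; case: eqP => [->|/eqP ni].
  rewrite addnn -muln2 mulnC exprM sqrrN !expr1n binn !mulr1 /kap /tau.
  by field; rewrite two_neq0 exp2n0.
rewrite (_ : false%:R = 0 :> K)// mulr0 addr0; case: ltnP => [nlt|ile]; first by rewrite bin_small// !mulr0 addr0.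
rewrite -sign_subn// -signr_odd; case: (odd _); rewrite ?expr1 ?expr0 /kap /tau; by field.
Qed.

(** The coefficient of the j-th solution carries 1 / (tau_j - kap_j) = 1 / (2^j sg_j). The product
    in the denominator compensates the diagonal entries that the bordered determinant contributes in
    addition to the two pairings. *)
Lemma residue_formula (p : nat -> K) (B : I -> 'M[K]_N.+2) :
  (forall j (n i : I), B j (widen_ord (leqnSn _) n) (widen_ord (leqnSn _) i) = entry j n i) ->
  (forall j (n : I), B j (widen_ord (leqnSn _) n) ord_max = c n) ->
  (forall j (i : I), B j ord_max (widen_ord (leqnSn _) i) = - p i) ->
  \sum_(n : I) p n * m 0 n =
  \sum_(j : I) 2 / (2 ^+ j * sg j * \prod_(n : I | n != j) (1 - 2 ^+ n / 2 ^+ j)) * \det (B j).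
Proof.
move=> BT Bc Bp.
have T_trig j (n i : I) : (n < i)%N -> T j n i = 0.
  by move=> ni; rewrite mxE /entry gtn_eqF// ni.
have Tjj j : T j j j = 0 by rewrite mxE /entry eqxx divff ?subrr.
have T_diag j i : i != j -> T j i i != 0.
  rewrite mxE /entry eqxx subr_eq0 eq_sym => ij; apply: contraNneq ij => E.
  by apply/eqP/val_inj/exp2_inj; rewrite -[RHS](divfK (exp2n0 j)) -E mul1r.
have /fin_all_exists[v vP] := fun j => right_null_vector (T_trig j) (Tjj j) (@T_diag j).
have /fin_all_exists[w wP] := fun j => left_null_vector (T_trig j) (Tjj j) (@T_diag j).
have tauDkap j : tau j + kap j = 2 ^+ j by rewrite /tau /kap; field.
have tauBkap j : tau j - kap j = 2 ^+ j * sg j by rewrite /tau /kap; field.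
have taukap j : kap j * tau j = lam ^+ 2 / 4.
  have -> : kap j * tau j = (2 ^+ j) ^+ 2 * (1 - sg j ^+ 2) / 4.
    rewrite /kap /tau (_ : 4 = 2 * 2 :> K); last by rewrite -natrM.
    by rewrite invfM; ring.
  rewrite sg2 opprB addrC subrK -exprM mulnC exprM (_ : 2 ^+ 2 = 4 :> K); last by rewrite -natrX.
  have f0 : (4 : K) ^+ j != 0.
    by rewrite (_ : 4 = 2 * 2 :> K) -?natrM// natrM expf_neq0// mulf_neq0.
  by rewrite [4 ^+ j * _]mulrC divfK.
have tau0 j : tau j != 0 by rewrite /tau !mulf_neq0 ?invr_eq0.
have taut j : tau j * t j = lam / 2.
  by rewrite /tau /t; field; rewrite exp2n0 sg1_neq0 two_neq0.
have ht (j : I) : lam / 2 * t j = kap j.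
  apply: (mulIf (tau0 j)); rewrite taukap.
  transitivity (lam / 2 * (tau j * t j)); first by ring.
  by rewrite taut (_ : 4 = 2 * 2 :> K) -?natrM// natrM invfM; ring.
have tk0 j : tau j - kap j != 0 by rewrite tauBkap mulf_neq0.
have vn j (n : I) : \sum_i (kap j * A n i + tau j * A' n i) * v j i = 2 ^+ n * v j n.
  under eq_bigr do rewrite entryE mulrDl -mulrA; rewrite big_split /= -big_distrr /=.
  have [-> _ _] := vP j; rewrite mulr0 add0r (bigD1 n)//= eqxx mulr1 big1 ?addr0// => i /negbTE.
  by rewrite eq_sym => ->; rewrite mulr0 mul0r.
have wn j (i : I) : \sum_n w j n * (kap j * A n i + tau j * A' n i) = w j i * 2 ^+ i.
  under eq_bigr do rewrite entryE mulrDr mulrCA; rewrite big_split /= -big_distrr /=.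
  have [-> _ _] := wP j; rewrite mulr0 add0r (bigD1 i)//= eqxx mulr1 big1 ?addr0// => n /negbTE ->.
  by rewrite !mulr0.
have mE n : m 0 (n : I) = \sum_j (\sum_i w j i * (2 * c i)) / (tau j - kap j) * v j n.
  apply: (@transfer_solution K N (lam / 2) (lam ^+ 2 / 4) (fun j : I => 2 ^+ j) tau kap
    (fun j : I => t j) A A' v w bounded_seq _ _ _ _ _ _ _ _ _ _ _ _ _ _ _ _ _ _ _ _ _ _ _
    (fun k n => m k n) (fun i => 2 * c i)) => //.
  - by move=> i j /exp2_inj/val_inj.
  - by move=> i j ij; rewrite /A bin_small.
  - by move=> i j ij; rewrite /A' bin_small// mulr0.
  - by move=> i; rewrite /A binn.
  - by move=> i; rewrite /A' binn mulr1 addnn -muln2 mulnC exprM sqrrN !expr1n.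
  - by move=> j i; have [_ _] := vP j; apply.
  - by move=> j; have [] := vP j.
  - by move=> j i; have [_ _] := wP j; apply.
  - by move=> j; have [] := wP j.
  - by move=> j; exact: bounded_decay.
  - by move=> j; exact: bounded_growth.
  - move=> k i; rewrite m_eq; congr (_ + _ * _).
    rewrite (big_ord_widen N.+1 (fun l => 'C(i, l)%:R * m (k + 1) l +
      (-1) ^+ (i + l) * 'C(i, l)%:R * m (k - 1) l))// big_mkcond; apply: eq_bigr => l _.
    rewrite /A /A'; case: ltnP => // il; by rewrite bin_small// mulr0 !mul0r addr0.
under eq_bigr do rewrite mE big_distrr /=; rewrite exchange_big /=; apply: eq_bigr => j _.
have [v0 vj _] := vP j; have [w0 wj _] := wP j.
have -> : \det (B j) = (\sum_(k : I) p k * v j k) * (\sum_(i : I) w j i * c i) * \prod_(i | i != j) T j i i.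
  apply: (det_bordered (T_trig j) _ (Bc j) (Bp j) v0 vj w0 wj) => n i.
  by rewrite BT mxE.
have -> : \prod_(i | i != j) T j i i = \prod_(n : I | n != j) (1 - 2 ^+ n / 2 ^+ j).
  by apply: eq_bigr => i _; rewrite mxE /entry eqxx.
have P0 : \prod_(n : I | n != j) (1 - 2 ^+ n / 2 ^+ j) != 0 :> K.
  by apply/prodf_neq0 => i ij; have := T_diag j i ij; rewrite mxE /entry eqxx.
rewrite tauBkap.
have -> : \sum_(i : I) w j i * (2 * c i) = 2 * \sum_(i : I) w j i * c i.
  by rewrite big_distrr /=; apply: eq_bigr => i _; rewrite mulrCA.
transitivity ((\sum_(k : I) p k * v j k) * (2 * (\sum_(i : I) w j i * c i) / (2 ^+ j * sg j))).
  by rewrite big_distrl /=; apply: eq_bigr => i _; rewrite mulrA mulrAC -!mulrA.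
move: (\prod_(n | _) _) P0 (\sum_k _) (\sum_i _) (sg_neq0 j) (exp2n0 j) => P P0 a b s0 e0.
by field; rewrite P0 s0 e0.
Qed.

End Residues.

(** * Integrals of V against polynomials *)

HB.lock Definition xmoment (R : realType) (lambda : R[i]) k n : R[i] :=
  cintegral (@J11 R) (fun x => W lambda k x * x%:C%C ^+ n).

HB.lock Definition root_sigma (R : realType) (lambda : R[i]) j : R[i] :=
  sqrtc (1 - lambda ^+ 2 / 4 ^+ j).

Section FTC.
Variable R : realType.

Lemma Rintegral_FTC (f F : R -> R) (a b : R) : a < b -> continuous f ->
  (forall x : R, is_derive x (1 : R) F (f x)) ->
  \int[@lebesgue_measure R]_(x in `[a, b]) f x = F b - F a.
Proof.
move=> ab cf dF.
have cF : continuous F.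
  by move=> x; apply: differentiable_continuous; apply/derivable1_diffP; have [] := dF x.
rewrite /Rintegral (@continuous_FTC2 _ f F)//.
- exact: continuous_subspaceT.
- split => [x _||]; first by have [] := dF x.
    exact: cvg_at_right_filter (cF a).
  exact: cvg_at_left_filter (cF b).
- by move=> x _; rewrite derive1E derive_val.
Qed.

Lemma cintegral_exprn n : cintegral (@J11 R) (fun x => x%:C%C ^+ n) =
  2 * (if odd n then 0 else n.+1%:R^-1).
Proof.
have E x : (x%:C%C : R[i]) ^+ n = (x ^+ n)%:C%C by rewrite rmorphXn.
have dF x : is_derive x (1 : R) (fun y : R => n.+1%:R^-1 *: (y ^+ n.+1)) (x ^+ n : R).
  have H := is_deriveZ (n.+1%:R^-1) (@is_deriveX R R id n.+1 x 1 1 (is_derive_id _ _)).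
  have -> : (fun y : R => n.+1%:R^-1 *: (y ^+ n.+1)) = (n.+1%:R^-1 \*: (id ^+ n.+1) : R -> R).
    by apply/funext => y; rewrite /= exprfctE.
  apply: (is_derive_eq H).
  by rewrite /GRing.scale /= mulr1 mulrA mulVf ?mul1r// pnatr_eq0.
have F := @Rintegral_FTC (fun x => x ^+ n) _ (-1) 1 _ (@exprn_continuous R n) dF.
rewrite /cintegral; under eq_Rintegral do rewrite E /=.
under [X in Complex _ X]eq_Rintegral do rewrite E /=.
have -> : \int[@lebesgue_measure R]_(x in @J11 R) (0 : R) = 0.
  by rewrite /Rintegral integral0_eq.
rewrite /J11 Rintegral_itv_bndo_bndc; last first.
  suff [] : cintegrable (@J11 R) (fun x => (x ^+ n)%:C%C) by [].
  apply: (@bounded_cintegrable_J11 _ _ 1).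
    by apply: cmeasurable_real; exact: measurable_funX.
  move=> x; rewrite J11E => /andP[h1 h2]; rewrite normc_real normrX.
  by rewrite exprn_ile1// ler_norml h1 ltW.
rewrite F ?ltrN10 ?(lt_trans _ ltr01) ?ltrN10// expr1n /GRing.scale /= mulr1.
rewrite -signr_odd /=; case: (odd n) => /=.
  by rewrite mulr1 subrr mulr0.
rewrite mulrN1 opprK -[X in X + X]mulr1 -mulrDr.
have -> : (n.+1%:R^-1 : R[i]) = (n.+1%:R^-1 : R)%:C%C by rewrite fmorphV rmorph_nat.
have -> : (2 : R[i]) = (2 : R)%:C%C by rewrite rmorph_nat.
by rewrite -rmorphM /= mulrC.
Qed.

End FTC.

Section XMoments.
Variable R : realType.
Variable lambda : R[i].
Hypothesis lambda_lt1 : `|lambda| < 1.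
Local Notation nrm := (@normc R).
Local Notation W := (W lambda).
Local Notation xm := (xmoment lambda).
Local Notation sg := (root_sigma lambda).
Implicit Types (k : int) (x : R) (n N j : nat).

Let r1 : nrm lambda < 1. Proof. by rewrite -ltcR -normcE. Qed.
Let mJ := @measurable_J11 R.
Local Hint Resolve mJ : core.

Lemma xmomentE k n : xm k n = cintegral (@J11 R) (fun x => W k x * x%:C%C ^+ n).
Proof. by rewrite xmoment.unlock. Qed.

Lemma root_sigmaE j : sg j = sqrtc (1 - lambda ^+ 2 / 4 ^+ j).
Proof. by rewrite root_sigma.unlock. Qed.

Lemma cmeasurable_complex_of_real (D : set R) : cmeasurable D (fun x => x%:C%C : R[i]).
Proof. by apply: cmeasurable_real; exact: measurable_id. Qed.

Lemma J11_norm x : J11 x -> `|x| <= 1.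
Proof. by rewrite J11E ler_norml => /andP[-> /ltW]. Qed.

Lemma W_Xn_le k n x : J11 x -> nrm (W k x * x%:C%C ^+ n) <= 1 / (1 - nrm lambda).
Proof.
move=> Jx; rewrite normcM normcX normc_real (le_trans _ (W_le lambda_lt1 k x))//.
by rewrite ler_piMr ?normc_ge0// exprn_ile1// J11_norm.
Qed.

Lemma cmeasurable_WXn k n (D : set R) : cmeasurable D (fun x => W k x * x%:C%C ^+ n).
Proof.
apply: cmeasurableM; first exact: cmeasurable_W.
exact/cmeasurableX/cmeasurable_complex_of_real.
Qed.

Lemma cintegrable_WXn k n : cintegrable (@J11 R) (fun x => W k x * x%:C%C ^+ n).
Proof.
by apply: bounded_cintegrable_J11; [exact: cmeasurable_WXn|move=> x Jx; exact: W_Xn_le].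
Qed.

Lemma cintegrable_Xn (a : R[i]) n : cintegrable (@J11 R) (fun x => (a + x%:C%C) ^+ n).
Proof.
apply: (@bounded_cintegrable_J11 _ _ ((nrm a + 1) ^+ n)).
  apply: cmeasurableX; apply: cmeasurableD; first exact: cmeasurable_cst.
  exact: cmeasurable_complex_of_real.
move=> x Jx; rewrite normcX lerXn2r ?nnegrE ?normc_ge0 ?addr_ge0 ?normc_ge0//.
by rewrite (le_trans (normcD _ _))// lerD2l normc_real J11_norm.
Qed.

Lemma W_half_shift k (e : int) x : e = -1 \/ e = 1 -> J11 x ->
  W k (half_shift e%:~R x) = (k == 0)%:R + lambda * W (k + e) x.
Proof. by case=> -> Jx; rewrite ?rmorphN1 ?W_half_shiftN1 ?W_half_shift1. Qed.

Lemma pow_half_shift n (e : int) x :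
  2 ^+ n * (half_shift e%:~R x)%:C%C ^+ n = (e%:~R + x%:C%C) ^+ n :> R[i].
Proof.
rewrite -exprMn; congr (_ ^+ n).
rewrite /half_shift rmorphM rmorphD /= fmorphV rmorph_nat mulrC divfK ?pnatr_eq0//.
by rewrite addrC rmorph_int.
Qed.

Lemma half_xmoment k n (e : int) : e = -1 \/ e = 1 ->
  2 ^+ n * cintegral (@J11 R) (fun x => W k (half_shift e%:~R x) * (half_shift e%:~R x)%:C%C ^+ n) =
  (k == 0)%:R * cintegral (@J11 R) (fun x => (e%:~R + x%:C%C) ^+ n) +
  lambda * \sum_(i < n.+1) e%:~R ^+ (n - i) * 'C(n, i)%:R * xm (k + e) i.
Proof.
move=> he; have cI := cintegrable_WXn k n; have [cm cp _] := cintegral_halves cI.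
have ce : cintegrable (@J11 R) (fun x => W k (half_shift e%:~R x) * (half_shift e%:~R x)%:C%C ^+ n).
  by case: he => ->; rewrite ?rmorphN1; [exact: cm|exact: cp].
rewrite -cintegralZ//.
transitivity (cintegral (@J11 R) (fun x => (k == 0)%:R * (e%:~R + x%:C%C) ^+ n +
    lambda * \sum_(i < n.+1) e%:~R ^+ (n - i) * 'C(n, i)%:R * (W (k + e) x * x%:C%C ^+ i))).
  apply: eq_cintegral => x /set_mem Jx; rewrite mulrCA pow_half_shift W_half_shift//.
  rewrite mulrDl; apply: congr1; rewrite -mulrA; apply: congr1.
  rewrite exprDn big_distrr /=; apply: eq_bigr => i _.
  rewrite -mulr_natr; move: (W _ _) (e%:~R ^+ _) (_ ^+ i) ('C(n, i)%:R) => a b c d; ring.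
have cS : cintegrable (@J11 R) (fun x => \sum_(i < n.+1) e%:~R ^+ (n - i) * 'C(n, i)%:R *
    (W (k + e) x * x%:C%C ^+ i)).
  by apply: cintegrable_sum => // i; apply: cintegrableZ => //; exact: cintegrable_WXn.
have cX := cintegrable_Xn e%:~R n.
rewrite (cintegralD mJ (cintegrableZ _ mJ cX) (cintegrableZ _ mJ cS)).
rewrite (cintegralZ _ mJ cX) (cintegralZ _ mJ cS); apply: congr1; apply: congr1; rewrite cintegral_sum//; last first.
  by move=> i; apply: cintegrableZ => //; exact: cintegrable_WXn.
apply: eq_bigr => i _; rewrite cintegralZ//; last exact: cintegrable_WXn.
by rewrite xmomentE.
Qed.

(** Half of 2^n times the integral of x^n over the interval: the source term of the system, up to
    the factor 2, and the last column of [Bmx]. *)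
Definition xcoef n : R[i] := if odd n then 0 else 2 ^+ n / n.+1%:R.

Lemma halves_exprn n :
  (cintegral (@J11 R) (fun x => ((-1)%:~R + x%:C%C) ^+ n) +
   cintegral (@J11 R) (fun x => (1%:~R + x%:C%C) ^+ n)) / 2 = 2 * xcoef n.
Proof.
have cX : cintegrable (@J11 R) (fun x => x%:C%C ^+ n).
  by have := cintegrable_Xn 0 n; under eq_fun do rewrite add0r.
have [cm cp H] := cintegral_halves cX.
have -> : 2 * xcoef n = 2 ^+ n * cintegral (@J11 R) (fun x => x%:C%C ^+ n).
  by rewrite cintegral_exprn /xcoef mulrCA; case: (odd n); rewrite ?mulr0.
rewrite H mulrA; apply: (congr1 (fun z => z / 2)); rewrite mulrDr; apply: congr2.
  rewrite -cintegralZ; [|exact: mJ|exact: cm].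
  by apply: eq_cintegral => x _; rewrite -pow_half_shift rmorphN1.
rewrite -cintegralZ; [|exact: mJ|exact: cp].
by apply: eq_cintegral => x _; rewrite -pow_half_shift.
Qed.

Lemma half_system (K : fieldType) (E d l a a' b b' s s' : K) :
  E * b' = d * a' + l * s' -> E * b = d * a + l * s ->
  E * ((b' + b) / 2) = d * ((a' + a) / 2) + l / 2 * (s + s').
Proof.
move=> H1 H2; transitivity ((E * b' + E * b) / 2); first by ring.
by rewrite H1 H2; ring.
Qed.

Lemma xmoment_eq k n : 2 ^+ n * xm k n = (k == 0)%:R * (2 * xcoef n) +
  lambda / 2 * \sum_(i < n.+1) ('C(n, i)%:R * xm (k + 1) i +
                                (-1) ^+ (n + i) * 'C(n, i)%:R * xm (k - 1) i).
Proof.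
rewrite xmomentE; have [_ _ ->] := cintegral_halves (cintegrable_WXn k n).
have := @half_xmoment k n 1 (or_intror erefl); have := @half_xmoment k n (-1) (or_introl erefl).
have -> : cintegral (@J11 R) (Rminus (fun x => W k x * x%:C%C ^+ n)) =
  cintegral (@J11 R) (fun x => W k (half_shift (-1)%:~R x) * (half_shift (-1)%:~R x)%:C%C ^+ n).
  by apply: eq_cintegral => x _; rewrite rmorphN1.
have -> : cintegral (@J11 R) (Rplus (fun x => W k x * x%:C%C ^+ n)) =
  cintegral (@J11 R) (fun x => W k (half_shift 1%:~R x) * (half_shift 1%:~R x)%:C%C ^+ n) by [].
rewrite big_split /= -halves_exprn.
have -> : \sum_(i < n.+1) (1%:~R) ^+ (n - i) * 'C(n, i)%:R * xm (k + 1) i =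
    \sum_(i < n.+1) 'C(n, i)%:R * xm (k + 1) i.
  by apply: eq_bigr => i _; rewrite expr1n mul1r.
have -> : \sum_(i < n.+1) (-1)%:~R ^+ (n - i) * 'C(n, i)%:R * xm (k - 1) i =
    \sum_(i < n.+1) (-1) ^+ (n + i) * 'C(n, i)%:R * xm (k - 1) i.
  by apply: eq_bigr => i _; rewrite rmorphN1 sign_subn// -ltnS.
move=> H1 H2; exact: half_system H1 H2.
Qed.

Definition bounded_cseq (u : nat -> R[i]) := exists c : R, forall k : nat, nrm (u k) <= c.

Lemma bounded_xmoment (f : nat -> int) n : bounded_cseq (fun k : nat => xm (f k) n).
Proof.
pose c := 1 / (1 - nrm lambda); exists ((c + c) * 2) => k; rewrite xmomentE.
by apply: le_cintegral_J11; [exact: cmeasurable_WXn|move=> x Jx; exact: W_Xn_le].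
Qed.

Lemma bounded_cseqB u u' (a : R[i]) : bounded_cseq u -> bounded_cseq u' ->
  bounded_cseq (fun k : nat => u k - a * u' k).
Proof.
move=> [c uc] [c' uc']; exists (c + nrm a * c') => k.
rewrite (le_trans (normcD _ _))// lerD//.
have -> : nrm (- (a * u' k)) = nrm (a * u' k) by apply: complexI; rewrite -!normcE normrN.
by rewrite normcM ler_wpM2l ?normc_ge0.
Qed.

Lemma lambda_pow2_lt1 j : nrm (lambda / 2 ^+ j) < 1.
Proof.
rewrite (le_lt_trans _ r1)// normcM ler_piMr ?normc_ge0//.
rewrite normcV normcX.
have -> : nrm 2 = 2 by have := normc_real (2 : R); rewrite rmorph_nat ger0_norm.
by rewrite invf_le1 ?exprn_gt0// exprn_ege1// ler1n.
Qed.

Lemma root_sigma_sqr j : sg j = sqrtc (1 - (lambda / 2 ^+ j) ^+ 2).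
Proof.
rewrite root_sigmaE; congr (sqrtc (1 - _)).
rewrite expr_div_n; apply: congr1; apply: congr1.
by rewrite (_ : 4 = 2 ^+ 2); [rewrite -!exprM mulnC|rewrite -natrX].
Qed.

Lemma sqr_root_sigma j : sg j ^+ 2 = 1 - lambda ^+ 2 / 4 ^+ j.
Proof. by rewrite root_sigmaE sqr_sqrtc. Qed.

Lemma root_sigma_neq0 j : sg j != 0.
Proof.
rewrite root_sigma_sqr; apply: sqrtc1B_neq0; rewrite -[X in X < _]/(nrm (_ ^+ 1.+1)).
exact: normcXlt1 (lambda_pow2_lt1 j).
Qed.

Lemma add1_root_sigma_neq0 j : 1 + sg j != 0.
Proof. by rewrite root_sigmaE; exact: add1_sqrtc_neq0. Qed.

Lemma decay_rate_lt1 j : nrm (lambda / (2 ^+ j * (1 + sg j))) < 1.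
Proof.
rewrite (le_lt_trans _ (lambda_pow2_lt1 j))// invfM mulrA.
rewrite [X in X <= _]normcM ler_piMr ?normc_ge0//.
rewrite normcV invf_le1 ?root_sigmaE ?normc_1Dsqrtc//.
exact: lt_le_trans ltr01 (normc_1Dsqrtc _).
Qed.

Lemma decay_step (K : fieldType) (l p s a b : K) : p != 0 -> 1 + s != 0 ->
  (1 + s) * a = l / p * b -> a = l / (p * (1 + s)) * b.
Proof. by move=> p0 s0 E; apply: (mulfI s0); rewrite E; field; rewrite p0 s0. Qed.

Lemma decay_eq (K : fieldType) (l p a b : K) : (2 : K) != 0 -> p != 0 ->
  p * a = l / 2 * b -> 2 * a = l / p * b.
Proof.
move=> t0 p0 E; apply: (mulfI p0); rewrite mulrCA E.
by field; rewrite t0 p0.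
Qed.

Let exp2_neq0C j : (2 : R[i]) ^+ j != 0.
Proof. by rewrite expf_neq0// pnatr_eq0. Qed.

Lemma bounded_decay j u : bounded_cseq u ->
  (forall k : nat, 2 ^+ j * u k.+1 = lambda / 2 * (u k.+2 + u k)) ->
  forall k : nat, u k.+1 = lambda / (2 ^+ j * (1 + sg j)) * u k.
Proof.
move=> [c uc] ue k.
have := @bounded_recurrence R (fun i => u (k + i)%N) (lambda / 2 ^+ j) c (lambda_pow2_lt1 j)
  (fun i => uc _).
rewrite -root_sigma_sqr addn0 addn1 => H.
apply: decay_step; [exact: exp2_neq0C|exact: add1_root_sigma_neq0|apply: H => i].
rewrite !addnS; apply: decay_eq; [by rewrite pnatr_eq0|exact: exp2_neq0C|exact: ue].
Qed.

Lemma bounded_growth j u : bounded_cseq u ->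
  (forall k : nat, u k = lambda / (2 ^+ j * (1 + sg j)) * u k.+1) -> u 0%N = 0.
Proof.
move=> [c uc] ue; apply/eqP; rewrite -normc_eq0; apply/eqP.
apply: (@bounded_backward_growth R (fun k : nat => nrm (u k)) (nrm (lambda / (2 ^+ j * (1 + sg j)))) c).
- by rewrite normc_ge0 decay_rate_lt1.
- by move=> k; rewrite normc_ge0 uc.
- by move=> k; rewrite {1}ue normcM.
Qed.

Lemma exp2_inj a b : (2 : R[i]) ^+ a = 2 ^+ b -> a = b.
Proof.
move/eqP; rewrite -!natrX eqr_nat => /eqP.
by move=> /(congr1 (logn 2)); rewrite !pfactorK.
Qed.

Lemma BcoefE N (j : 'I_N.+1) : Bcoef lambda N j =
  2 / (2 ^+ j * sg j * \prod_(n < N.+1 | n != j) (1 - 2 ^+ n / 2 ^+ j)).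
Proof. by rewrite /Bcoef root_sigmaE big_mkord. Qed.

(** Stated for an arbitrary bounded solution of the system, so that it also yields uniqueness of the
    values at k = 0. *)
Lemma xmoment_residues N (P : {poly R[i]}) (m : int -> nat -> R[i]) :
  (forall k n, 2 ^+ n * m k n = (k == 0)%:R * (2 * xcoef n) +
    lambda / 2 * \sum_(i < n.+1) ('C(n, i)%:R * m (k + 1) i +
                                (-1) ^+ (n + i) * 'C(n, i)%:R * m (k - 1) i)) ->
  (forall n, bounded_cseq (fun k : nat => m k%:Z n)) ->
  (forall n, bounded_cseq (fun k : nat => m (- k%:Z) n)) ->
  \sum_(n < N.+1) P`_n * m 0 n =
  \sum_(0 <= j < N.+1) Bcoef lambda N j * \det (Bmx lambda N P j).
Proof.
move=> me bm bmN; rewrite big_mkord.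
under [RHS]eq_bigr do rewrite BcoefE.
have two_neq0 : (2 : R[i]) != 0 by rewrite pnatr_eq0.
apply: (@residue_formula _ N lambda sg bounded_cseq exp2_inj sqr_root_sigma root_sigma_neq0
  add1_root_sigma_neq0 bounded_cseqB _ _ _ bounded_decay bounded_growth m xcoef me bm bmN
  (fun n => P`_n) (fun j : 'I_N.+1 => Bmx lambda N P j)).
- by exists 0 => k; rewrite normc0.
- move=> j; exists 1 => k; rewrite normcX exprn_ile1 ?normc_ge0//.
  exact/ltW/decay_rate_lt1.
- by move=> u [c uc]; exists c.
- move=> j n i; rewrite mxE /= -ltnS ltn_ord -ltnS ltn_ord /Bentry root_sigmaE.
  by case: eqP.
- by move=> j n; rewrite mxE /= -ltnS ltn_ord ltnn.
- by move=> j i; rewrite mxE /= ltnn -ltnS ltn_ord.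
Qed.

Lemma cintegral_VXn_poly N (P : {poly R[i]}) : (size P <= N.+1)%N ->
  cintegral (@I11 R) (fun x => V lambda x * P.[x%:C%C]) = \sum_(n < N.+1) P`_n * xm 0 n.
Proof.
move=> sP.
have mP (D : set R) : cmeasurable D (fun x => P.[x%:C%C]).
  by apply: cmeasurable_horner; exact: cmeasurable_complex_of_real.
transitivity (cintegral (@J11 R) (fun x => W 0 x * P.[x%:C%C])).
  apply: cintegral_I11_dyadic.
  - pose c := (1 + nrm lambda / (1 - nrm lambda)) * \sum_(i < size P) nrm P`_i * 1 ^+ i.
    apply: (@bounded_cintegrable_J11 _ _ c).
      apply: cmeasurableM; last exact: mP.
      by apply: cmeasurable_V => //; exact: J11_I11.
    move=> x Jx; rewrite normcM ler_pM ?normc_ge0 ?V_le//.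
    by apply: normc_horner_le; rewrite normc_real J11_norm.
  - by apply: cmeasurableM; [exact: cmeasurable_W|exact: mP].
  - by move=> x /J11_I11 Ix dx; rewrite V_W.
transitivity (cintegral (@J11 R) (fun x => \sum_(n < N.+1) P`_n * (W 0 x * x%:C%C ^+ n))).
  apply: eq_cintegral => x _; rewrite (horner_coef_wide _ sP) big_distrr /=.
  by apply: eq_bigr => i _; rewrite mulrCA.
rewrite cintegral_sum//; last by move=> i; apply: cintegrableZ => //; exact: cintegrable_WXn.
by apply: eq_bigr => i _; rewrite xmomentE cintegralZ//; exact: cintegrable_WXn.
Qed.

Lemma cintegral_V_poly N (P : {poly R[i]}) : (size P <= N.+1)%N ->
  cintegral (@I11 R) (fun x => V lambda x * P.[x%:C%C]) =
  \sum_(0 <= j < N.+1) Bcoef lambda N j * \det (Bmx lambda N P j).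
Proof.
move=> sP; rewrite (cintegral_VXn_poly sP); apply: xmoment_residues xmoment_eq _ _ => n.
  exact: (bounded_xmoment (fun k : nat => k%:Z)).
exact: (bounded_xmoment (fun k : nat => - k%:Z)).
Qed.

Lemma det_Bmx_Xn N j : \det (Bmx lambda N 'X^N j) = \det (Bmx_minor lambda N j).
Proof.
pose jN : 'I_N.+2 := inord N.
have jNE : jN = N :> nat by rewrite inordK.
rewrite (expand_det_row _ ord_max) (bigD1 jN)//= big1 ?addr0; last first.
  move=> k kj; rewrite mxE /= ltnn; case: leqP => kN; last by rewrite mul0r.
  rewrite coefXn (_ : (k == N :> nat) = false) ?oppr0 ?mul0r//.
  by apply: contraNF kj => /eqP kN'; apply/eqP/val_inj; rewrite /= jNE.
(* The last row is reduced to the entry -1 in column N, and its cofactor sign (-1)^(2N + 1) cancels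
   it. *)
rewrite mxE /= ltnn jNE leqnn coefXn eqxx mulN1r /cofactor /= jNE addSn addnn.
by rewrite exprS -signr_odd odd_double expr0 mulr1 mulN1r opprK.
Qed.

Lemma cintegral_V_Xn N : cintegral (@I11 R) (fun x => V lambda x * x%:C%C ^+ N) =
  \sum_(0 <= j < N.+1) Bcoef lambda N j * \det (Bmx_minor lambda N j).
Proof.
have := @cintegral_V_poly N 'X^N; rewrite size_polyXn => /(_ (leqnn _)).
under eq_fun do rewrite hornerXn; move=> ->.
by apply: eq_bigr => j _; rewrite det_Bmx_Xn.
Qed.

(* Reflecting k and the sign of the odd moments preserves the system. *)
Lemma cintegral_V_odd N : odd N -> cintegral (@I11 R) (fun x => V lambda x * x%:C%C ^+ N) = 0.
Proof.
move=> oN; pose m k n := (-1) ^+ n * xm (- k) n.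
have E (u : int -> nat -> R[i]) : \sum_(n < N.+1) ('X^N : {poly R[i]})`_n * u 0 n = u 0 N.
  rewrite big_ord_recr /= coefXn eqxx mul1r big1 ?add0r// => i _.
  by rewrite coefXn (ltn_eqF (ltn_ord i)) mul0r.
have h1 : cintegral (@I11 R) (fun x => V lambda x * x%:C%C ^+ N) = xm 0 N.
  have := @cintegral_VXn_poly N 'X^N; rewrite size_polyXn => /(_ (leqnn _)).
  by under eq_fun do rewrite hornerXn; move=> ->; exact: E.
have h2 := @cintegral_V_Xn N.
have h3 : m 0 N = \sum_(0 <= j < N.+1) Bcoef lambda N j * \det (Bmx_minor lambda N j).
  under eq_bigr do rewrite -det_Bmx_Xn.
  rewrite -(@xmoment_residues N 'X^N m); first by rewrite E.
  - move=> k n; rewrite /m mulrCA xmoment_eq oppr_eq0 mulrDr; apply: congr2.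
      by rewrite /xcoef -signr_odd; case: (odd n); rewrite ?expr0 ?mul1r// !mulr0.
    rewrite mulrCA; apply: congr1; rewrite big_distrr /=; apply: eq_bigr => i _.
    rewrite addrC [in RHS]addrC.
    have -> : - (k - 1) = - k + 1 by rewrite opprD opprK.
    have -> : - (k + 1) = - k - 1 by rewrite opprD.
    have s2 : (-1) ^+ (n + i) = (-1) ^+ n * (-1) ^+ i :> R[i] by rewrite exprD.
    have sn : (-1) ^+ n * (-1) ^+ n = 1 :> R[i] by rewrite -exprMn mulrNN mulr1 expr1n.
    have si : (-1) ^+ i * (-1) ^+ i = 1 :> R[i] by rewrite -exprMn mulrNN mulr1 expr1n.
    rewrite s2; move: ((-1) ^+ n) ((-1) ^+ i) ('C(n, i)%:R) sn si (xm _ _) (xm _ _) => a b C sn si X Y.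
    transitivity (a * C * X + (a * a) * (b * C * Y)); first by ring.
    rewrite sn mul1r; transitivity (a * C * (b * b) * X + b * C * Y); last by ring.
    by rewrite si mulr1.
  - move=> n; have [c H] := bounded_xmoment (fun k : nat => - k%:Z) n; exists c => k.
    by rewrite /m normcM normcX normcN1 expr1n mul1r.
  - move=> n; have [c H] := bounded_xmoment (fun k : nat => - - k%:Z) n; exists c => k.
    by rewrite /m normcM normcX normcN1 expr1n mul1r.
(* The residue formula depends on the system alone, so the reflected solution has the same value at
   k = 0; for odd N that value is its own negative. *)
have : m 0 N = xm 0 N by rewrite h3 -h2 h1.
rewrite /m oppr0 -signr_odd oN expr1 mulN1r h1 => /eqP.
by rewrite eq_sym -addr_eq0 -mulr2n -mulr_natl mulf_eq0 pnatr_eq0 /= => /eqP.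
Qed.

End XMoments.

(** * Averaging operators *)

Section Averaging.
Variables (R : realType) (rho : R).
Hypothesis rho01 : 0 <= rho < 1.
Implicit Types (f g : R -> R) (x : R) (n N : nat).
Local Notation mu := (@lebesgue_measure R).
Let mJ := @measurable_J11 R.
Local Hint Resolve mJ : core.

Let rho0 : 0 <= rho. Proof. by case/andP: rho01. Qed.
Let rho1 : 0 < 1 - rho. Proof. by rewrite subr_gt0; case/andP: rho01. Qed.

(** Pointwise majorant of the halved operator: for |z| = 1 the modulus of M_z h / 2 is at most [avg]
    of |h|. Being independent of z, it controls all Neumann series at once. *)
Definition avg f x := 2^-1 * (f (half_shift (-1) x) + f (half_shift 1 x)).

Fixpoint wavg n f : R -> R := if n is m.+1 then fun x => rho * avg (wavg m f) x else f.

Definition pavg N f x := \sum_(n < N) wavg n f x.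

Lemma measurable_I11 : measurable (@I11 R). Proof. exact: measurable_itv. Qed.
Local Hint Resolve measurable_I11 : core.

Lemma le_avg f g x : (forall y, f y <= g y) -> avg f x <= avg g x.
Proof. by move=> fg; rewrite ler_pM2l ?invr_gt0// lerD. Qed.

Lemma avg_ge0 f x : (forall y, 0 <= f y) -> 0 <= avg f x.
Proof. by move=> f0; rewrite mulr_ge0 ?invr_ge0// addr_ge0. Qed.

Lemma wavg_ge0 n f x : (forall y, 0 <= f y) -> 0 <= wavg n f x.
Proof. by move=> f0; elim: n x => [|n IH] x //=; rewrite mulr_ge0// avg_ge0. Qed.

Lemma pavg_ge0 N f x : (forall y, 0 <= f y) -> 0 <= pavg N f x.
Proof. by move=> f0; apply: sumr_ge0 => n _; exact: wavg_ge0. Qed.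

Lemma pavg0 f x : pavg 0 f x = 0. Proof. by rewrite /pavg big_ord0. Qed.

Lemma pavgS N f x : pavg N.+1 f x = f x + rho * avg (pavg N f) x.
Proof.
rewrite /pavg big_ord_recl /=; congr (_ + _).
by rewrite -mulr_sumr; congr (_ * _); rewrite -mulr_sumr; congr (_ * _); rewrite big_split.
Qed.

Lemma pavg_nondecreasing f x : (forall y, 0 <= f y) ->
  {homo (fun N => pavg N f x) : m n / (m <= n)%N >-> m <= n}.
Proof.
move=> f0; apply: homo_leq => [//|y z t|N]; first exact: le_trans.
by rewrite /pavg big_ord_recr /= lerDl; exact: wavg_ge0.
Qed.

Lemma measurable_fun_half_shift_I11 (e : R) f : e = -1 \/ e = 1 ->
  measurable_fun (@I11 R) f -> measurable_fun (@I11 R) (fun x => f (half_shift e x)).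
Proof.
move=> he mf; apply: (measurable_comp _ _ mf (@measurable_half_shift R e (@I11 R))) => //.
by move=> _ [x Ix <-]; exact: half_shift_I11.
Qed.

Lemma measurable_avg f : measurable_fun (@I11 R) f -> measurable_fun (@I11 R) (avg f).
Proof.
move=> mf; apply: measurable_funM => //; apply: measurable_funD.
  by apply: measurable_fun_half_shift_I11 => //; left.
by apply: measurable_fun_half_shift_I11 => //; right.
Qed.

Lemma measurable_pavg N f : measurable_fun (@I11 R) f -> measurable_fun (@I11 R) (pavg N f).
Proof.
move=> mf; apply: measurable_sum => i; elim: {i}(nat_of_ord i) => //= n IH.
by apply: measurable_funM => //; exact: measurable_avg.
Qed.

Definition Int f : \bar R := (\int[mu]_(x in @J11 R) (f x)%:E)%E.

Lemma J11_sub_I11 : @J11 R `<=` @I11 R. Proof. by move=> x; exact: J11_I11. Qed.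

Lemma measurable_J11_fun d (T : measurableType d) (f : R -> T) :
  measurable_fun (@I11 R) f -> measurable_fun (@J11 R) f.
Proof. by apply: measurable_funS => //; exact: J11_sub_I11. Qed.

Lemma Int_ge0 f : (forall y, 0 <= f y) -> (0 <= Int f)%E.
Proof. by move=> f0; apply: integral_ge0 => x _; rewrite lee_fin. Qed.

Lemma IntZ (k : R) f : 0 <= k -> (forall y, 0 <= f y) -> measurable_fun (@I11 R) f ->
  Int (fun x => k * f x) = (k%:E * Int f)%E.
Proof.
move=> k0 f0 mf; rewrite -ge0_integralZl_EFin//; first by move=> x _; rewrite lee_fin.
by apply/measurable_EFinP; exact: measurable_J11_fun.
Qed.

Lemma IntD f g : (forall y, 0 <= f y) -> (forall y, 0 <= g y) ->
  measurable_fun (@I11 R) f -> measurable_fun (@I11 R) g ->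
  Int (fun x => f x + g x) = (Int f + Int g)%E.
Proof.
move=> f0 g0 mf mg; rewrite -ge0_integralD//.
- by move=> x _; rewrite lee_fin.
- by apply/measurable_EFinP; exact: measurable_J11_fun.
- by move=> x _; rewrite lee_fin.
- by apply/measurable_EFinP; exact: measurable_J11_fun.
Qed.

Lemma le_Int f g : (forall y, 0 <= f y) -> measurable_fun (@I11 R) f -> measurable_fun (@I11 R) g ->
  (forall x, J11 x -> f x <= g x) -> (Int f <= Int g)%E.
Proof.
move=> f0 mf mg fg; apply: ge0_le_integral => //.
- by move=> x _; rewrite lee_fin.
- by apply/measurable_EFinP; exact: measurable_J11_fun.
- by apply/measurable_EFinP; exact: measurable_J11_fun.
Qed.

(** [avg] is the transfer operator of the doubling map. As it preserves integrals, the weights rho^n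
    make the integrated series geometric. *)
Lemma Int_avg f : (forall y, 0 <= f y) -> measurable_fun (@I11 R) f -> Int (avg f) = Int f.
Proof.
move=> f0 mf; rewrite [RHS]/Int (@ge0_integral_halves R (EFin \o f)); last 2 first.
- by apply/measurable_EFinP; exact: measurable_J11_fun.
- by move=> x _; rewrite lee_fin.
have m1 : measurable_fun (@I11 R) (fun x => f (half_shift (-1) x)).
  by apply: measurable_fun_half_shift_I11 => //; left.
have m2 : measurable_fun (@I11 R) (fun x => f (half_shift 1 x)).
  by apply: measurable_fun_half_shift_I11 => //; right.
rewrite /avg IntZ ?invr_ge0//; [|by move=> y; rewrite addr_ge0|exact: measurable_funD].
by rewrite IntD.
Qed.

Lemma Int_pavg_le N f : (forall y, 0 <= f y) -> measurable_fun (@I11 R) f ->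
  (Int (pavg N f) <= (1 - rho)^-1%:E * Int f)%E.
Proof.
move=> f0 mf; have k0 : 0 <= (1 - rho)^-1 by rewrite invr_ge0 ltW.
elim: N => [|N IH].
  rewrite /Int integral0_eq ?mule_ge0 ?lee_fin ?Int_ge0// => x _.
  by rewrite pavg0.
have -> : Int (pavg N.+1 f) = (Int f + rho%:E * Int (pavg N f))%E.
  rewrite -(Int_avg (f := pavg N f)); [|by move=> y; exact: pavg_ge0|exact: measurable_pavg].
  rewrite -IntZ//; [|by move=> y; apply: avg_ge0 => z; exact: pavg_ge0
                    |by apply: measurable_avg; exact: measurable_pavg].
  rewrite -IntD//.
  - by apply: eq_integral => x _; rewrite pavgS.
  - by move=> y; rewrite mulr_ge0//; apply: avg_ge0 => z; exact: pavg_ge0.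
  - by apply: measurable_funM => //; apply: measurable_avg; exact: measurable_pavg.
rewrite (@le_trans _ _ (Int f + rho%:E * ((1 - rho)^-1%:E * Int f))%E)//.
  by rewrite leeD2l// lee_wpmul2l// lee_fin.
rewrite muleA -{1}[Int f]mul1e -ge0_muleDl ?lee_fin ?mulr_ge0// -EFinM -EFinD.
rewrite (_ : 1 + rho / (1 - rho) = (1 - rho)^-1)//.
by field; rewrite gt_eqF.
Qed.

(** Extended-valued because the sum may diverge for unbounded [f]; for integrable [f] this happens
    only on a null set. *)
Definition savg f x : \bar R := limn (fun N => (pavg N f x)%:E).

Let nd_pavg f x : (forall y, 0 <= f y) -> nondecreasing_seq (fun N => (pavg N f x)%:E).
Proof. by move=> f0 m n mn; rewrite lee_fin; exact: pavg_nondecreasing. Qed.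

Lemma cvg_savg f x : (forall y, 0 <= f y) -> (pavg N f x)%:E @[N --> \oo] --> savg f x.
Proof. by move=> f0; apply: ereal_nondecreasing_is_cvgn; exact: nd_pavg. Qed.

Lemma pavg_le_savg N f x : (forall y, 0 <= f y) -> ((pavg N f x)%:E <= savg f x)%E.
Proof.
move=> f0; apply: lime_ge; first exact: cvg_savg.
by near=> m; apply: nd_pavg => //; near: m; exists N.
Unshelve. all: by end_near. Qed.

Lemma savg_ge0 f x : (forall y, 0 <= f y) -> (0 <= savg f x)%E.
Proof. by move=> f0; have := pavg_le_savg 0 x f0; rewrite pavg0. Qed.

Lemma savg_le f x (c : \bar R) : (forall y, 0 <= f y) ->
  (forall N, (pavg N f x)%:E <= c)%E -> (savg f x <= c)%E.
Proof. by move=> f0 fc; apply: lime_le; [exact: cvg_savg|exact: nearW]. Qed.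

Lemma measurable_savg f : (forall y, 0 <= f y) -> measurable_fun (@I11 R) f ->
  measurable_fun (@I11 R) (savg f).
Proof.
move=> f0 mf; apply: (emeasurable_fun_cvg (fun N x => (pavg N f x)%:E)) => [N|x _].
  by apply/measurable_EFinP; exact: measurable_pavg.
exact: cvg_savg.
Qed.

Lemma integral_savg_le f : (forall y, 0 <= f y) -> measurable_fun (@I11 R) f ->
  (\int[mu]_(x in @J11 R) savg f x <= (1 - rho)^-1%:E * Int f)%E.
Proof.
move=> f0 mf; rewrite /savg monotone_convergence//.
- apply: lime_le; last by apply: nearW => N; exact: Int_pavg_le.
  apply: ereal_nondecreasing_is_cvgn => m n mn; apply: ge0_le_integral => //.
  + by move=> x _; rewrite lee_fin pavg_ge0.
  + by apply/measurable_EFinP; apply: measurable_J11_fun; exact: measurable_pavg.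
  + by apply/measurable_EFinP; apply: measurable_J11_fun; exact: measurable_pavg.
  + by move=> x _; exact: nd_pavg.
- by move=> N; apply/measurable_EFinP; apply: measurable_J11_fun; exact: measurable_pavg.
- by move=> N x _; rewrite lee_fin pavg_ge0.
- by move=> x _; exact: nd_pavg.
Qed.

Lemma ae_savg_lty f : (forall y, 0 <= f y) -> measurable_fun (@I11 R) f -> (Int f < +oo)%E ->
  mu.-negligible [set x | J11 x /\ savg f x = +oo%E].
Proof.
move=> f0 mf foo; have : mu.-integrable (@J11 R) (savg f).
  apply/integrableP; split; first by apply: measurable_J11_fun; exact: measurable_savg.
  under eq_integral do rewrite gee0_abs ?savg_ge0//.
  by rewrite (le_lt_trans (integral_savg_le f0 mf))// lte_mul_pinfty// lee_fin invr_ge0 ltW.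
move=> isf; have : {ae mu, forall x, J11 x -> savg f x \is a fin_num} by exact: integrable_ae.
apply: negligibleS => x /= [Jx E] /(_ Jx).
by rewrite E.
Qed.

Lemma le_pavg N f g x : (forall y, I11 y -> f y <= g y) -> I11 x -> pavg N f x <= pavg N g x.
Proof.
move=> fg; elim: N x => [|N IH] x Ix; first by rewrite !pavg0.
rewrite !pavgS lerD ?fg// ler_wpM2l// ler_pM2l ?invr_gt0// lerD//; apply: IH.
  by apply: half_shift_I11 => //; left.
by apply: half_shift_I11 => //; right.
Qed.

Lemma pavg_cst_le N (c : R) x : 0 <= c -> pavg N (fun=> c) x <= c / (1 - rho).
Proof.
move=> c0; elim: N x => [|N IH] x; first by rewrite pavg0 divr_ge0// ltW.
rewrite pavgS (le_trans (_ : _ <= c + rho * (c / (1 - rho))))//; last first.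
  by rewrite le_eqVlt; apply/orP; left; apply/eqP; field; rewrite gt_eqF.
rewrite lerD2l ler_wpM2l// /avg.
move: (IH (half_shift (-1) x)) (IH (half_shift 1 x)); set t := c / _ => h1 h2; lra.
Qed.

Lemma pavgD N f g x : pavg N (fun y => f y + g y) x = pavg N f x + pavg N g x.
Proof.
elim: N x => [|N IH] x; first by rewrite !pavg0 addr0.
by rewrite !pavgS /avg !IH; ring.
Qed.

(* Convexity of the square for the weights (1 - rho, rho). *)
Lemma pavg_sqr_le N f x : (forall y, 0 <= f y) ->
  pavg N f x ^+ 2 <= (1 - rho)^-1 * pavg N (fun y => f y ^+ 2) x.
Proof.
move=> f0; elim: N x => [|N IH] x; first by rewrite !pavg0 expr0n mulr0.
rewrite !pavgS /avg; move: (IH (half_shift (-1) x)) (IH (half_shift 1 x)).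
move: (pavg N _ (half_shift (-1) x)) (pavg N _ (half_shift 1 x)) => a b.
move: (pavg N _ (half_shift (-1) x)) (pavg N _ (half_shift 1 x)) (f x) => a2 b2 c h1 h2.
rewrite [leRHS]mulrC ler_pdivlMr//.
rewrite ![(1 - rho)^-1 * _]mulrC !ler_pdivlMr// in h1 h2.
set d := 2^-1 * (a + b).
have hd : d ^+ 2 * (1 - rho) <= 2^-1 * (a2 + b2).
  rewrite (le_trans (_ : _ <= 2^-1 * (a ^+ 2 + b ^+ 2) * (1 - rho)))//; last by lra.
  rewrite ler_pM2r// /d -subr_ge0.
  by rewrite (_ : _ - _ = (2^-1 * (a - b)) ^+ 2); [exact: sqr_ge0|field].
have hr : rho * (d ^+ 2 * (1 - rho)) <= rho * (2^-1 * (a2 + b2)) by exact: ler_wpM2l.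
rewrite (le_trans (_ : _ <= c ^+ 2 + rho * (d ^+ 2 * (1 - rho))))//; last by lra.
(* The square on the right is the convexity defect for the points c / (1 - rho) and d, since c + rho
   d is their mean with weights 1 - rho and rho. *)
rewrite -subr_ge0 (_ : _ - _ = rho * (c - (1 - rho) * d) ^+ 2); last by ring.
by rewrite mulr_ge0// sqr_ge0.
Qed.

End Averaging.

(** * Fubini's theorem for complex integrands *)

Section ComplexFubini.
Variable R : realType.
Local Notation mu := (@lebesgue_measure R).
Local Notation nrm := (@normc R).

Section RealFubini.
Variables (D1 D2 : set R) (f : R * R -> R) (K : R).
Hypothesis (mD1 : measurable D1) (mD2 : measurable D2).
Hypothesis D1oo : (mu D1 < +oo)%E.
Hypothesis mf : measurable_fun (D1 `*` D2) f.
Hypothesis K0 : 0 <= K.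
Hypothesis fK : forall t, D1 t -> (\int[mu]_(x in D2) `|f (t, x)|%:E <= K%:E)%E.

Let F := (EFin \o f) \_ (D1 `*` D2).

Let FE t x : F (t, x) = ((fun t => ((fun x => (f (t, x))%:E) \_ D2) x) \_ D1) t.
Proof. by rewrite /F /patch in_setX /=; case: (t \in D1); case: (x \in D2). Qed.

Let mF : measurable_fun [set: measurableTypeR R * measurableTypeR R] F.
Proof.
apply/(measurable_restrictT _ _).1; first exact: measurableX.
exact/measurable_EFinP.
Qed.

Let F1 t : (\int[mu]_x F (t, x) = ((fun t => \int[mu]_(x in D2) (f (t, x))%:E) \_ D1) t)%E.
Proof.
rewrite /patch; case: ifPn => tD; last first.
  by rewrite integral0_eq// => x _; rewrite FE /patch (negbTE tD).
by rewrite [RHS]integral_mkcond; apply: eq_integral => x _; rewrite FE /patch tD.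
Qed.

Let F2 x : (\int[mu]_t F (t, x) = ((fun x => \int[mu]_(t in D1) (f (t, x))%:E) \_ D2) x)%E.
Proof.
rewrite /patch; case: ifPn => xD; last first.
  by rewrite integral0_eq// => t _; rewrite FE /patch (negbTE xD); case: ifP.
by rewrite [RHS]integral_mkcond; apply: eq_integral => t _; rewrite FE /patch xD.
Qed.

Let absF t : (\int[mu]_x `|F (t, x)| =
  ((fun t => \int[mu]_(x in D2) `|f (t, x)|%:E) \_ D1) t)%E.
Proof.
rewrite /patch; case: ifPn => tD; last first.
  by rewrite integral0_eq// => x _; rewrite FE /patch (negbTE tD) abse0.
rewrite [RHS]integral_mkcond; apply: eq_integral => x _; rewrite FE /patch tD.
by case: ifP; rewrite ?abse0.
Qed.

Let iF : (mu \x mu)%E.-integrable [set: measurableTypeR R * measurableTypeR R] F.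
Proof.
apply/integrable12ltyP => //.
apply: (@le_lt_trans _ _ (\int[mu]_(t in D1) (K%:E))%E); last first.
  by rewrite integral_cst//= lte_mul_pinfty.
rewrite [leRHS]integral_mkcond; apply: ge0_le_integral => //.
- by move=> t _; exact: integral_ge0.
- exact: (@measurable_fun_fubini_tonelli_F _ _ _ _ R mu (abse \o F)
    (measurableT_comp (@abse_measurable R setT) mF) (fun=> abse_ge0 _)).
- by apply/(measurable_restrictT _ _).1 => //; exact: measurable_cst.
- move=> t _; rewrite absF /patch; case: ifPn => // tD.
  by apply: fK; exact/set_mem.
Qed.

Let fin1 t : D1 t -> (\int[mu]_(x in D2) (f (t, x))%:E \is a fin_num)%E.
Proof.
move=> Dt; apply: integrable_fin_num => //; apply/integrableP; split.
  apply/measurable_EFinP; apply: (measurable_comp _ _ mf).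
  - exact: measurableX.
  - by move=> _ [x Dx <-].
  - by apply: measurable_funTS; exact: pair1_measurable.
by rewrite (le_lt_trans (fK Dt))// ltry.
Qed.

Lemma measurable_Rintegral_fubini :
  measurable_fun D1 (fun t => \int[mu]_(x in D2) f (t, x)).
Proof.
apply/measurable_EFinP.
apply: (eq_measurable_fun (fun t => \int[mu]_x F (t, x))%E) => [t /set_mem Dt|].
  by rewrite F1 /patch mem_set//= fineK// fin1.
apply: measurable_funS (measurable_fubini_F iF) => //.
Qed.

(** The hypothesis makes the inner integral over x finite for every t, while the one over t is
    finite only for almost every x. Passing to real values with [fine] is thus exact on one side and
    correct up to a null set on the other. *)
Lemma Rintegral_fubini :
  \int[mu]_(t in D1) \int[mu]_(x in D2) f (t, x) =
  \int[mu]_(x in D2) \int[mu]_(t in D1) f (t, x).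
Proof.
congr fine.
transitivity (\int[mu]_t \int[mu]_x F (t, x))%E.
  rewrite [LHS]integral_mkcond; apply: eq_integral => t _.
  rewrite F1 /patch; case: ifPn => // /set_mem tD.
  by rewrite fineK// fin1.
rewrite (Fubini iF) [RHS]integral_mkcond.
have aeG : {ae mu, forall x, fubini_G mu F x \is a fin_num}.
  by have := ae_integrable2 iF; apply: filterS => x; exact: integrable_fin_num.
have GE x : ((fun x => (\int[mu]_(t in D1) f (t, x))%:E) \_ D2) x = (fine (fubini_G mu F x))%:E.
  by rewrite /fubini_G F2 /patch; case: ifPn.
apply: ae_eq_integral => //.
  exact: measurable_fubini_G iF.
  have /funext -> := GE.
  apply/measurable_EFinP; apply: (measurableT_comp (@fine_measurable R setT measurableT)).
  exact: measurable_fubini_G iF.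
by move: aeG; apply: negligibleS => x /= NE Gx; apply: NE => _; rewrite GE fineK.
Qed.

End RealFubini.

Lemma cintegral_fubini (D1 D2 : set R) (f : R * R -> R[i]) (K : R) :
  measurable D1 -> measurable D2 -> (mu D1 < +oo)%E -> cmeasurable (D1 `*` D2) f -> 0 <= K ->
  (forall t, D1 t -> (\int[mu]_(x in D2) (nrm (f (t, x)))%:E <= K%:E)%E) ->
  cmeasurable D1 (fun t => cintegral D2 (fun x => f (t, x))) /\
  cintegral D1 (fun t => cintegral D2 (fun x => f (t, x))) =
  cintegral D2 (fun x => cintegral D1 (fun t => f (t, x))).
Proof.
move=> mD1 mD2 D1oo mf K0 fK; have mn := measurable_normc mf.
have mx t : D1 t -> measurable_fun D2 (pair t).
  by move=> _; apply: measurable_funTS; exact: pair1_measurable.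
have mP d (T : measurableType d) (g : R * R -> T) t : D1 t -> measurable_fun (D1 `*` D2) g ->
    measurable_fun D2 (fun x => g (t, x)).
  move=> Dt mg; apply: (measurable_comp _ _ mg (mx t Dt)); first exact: measurableX.
  by move=> _ [x Dx <-].
case: mf => mR mI.
have hR t : D1 t -> (\int[mu]_(x in D2) `|complex.Re (f (t, x))|%:E <= K%:E)%E.
  move=> Dt; apply: le_trans (fK _ Dt); apply: ge0_le_integral => //.
  - apply/measurable_EFinP; apply: measurableT_comp; first exact: normr_measurable.
    exact: (mP _ _ (fun p => complex.Re (f p))).
  - by apply/measurable_EFinP; exact: (mP _ _ (fun p => nrm (f p))).
  - by move=> x _; rewrite lee_fin normc_Re.
have hI t : D1 t -> (\int[mu]_(x in D2) `|complex.Im (f (t, x))|%:E <= K%:E)%E.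
  move=> Dt; apply: le_trans (fK _ Dt); apply: ge0_le_integral => //.
  - apply/measurable_EFinP; apply: measurableT_comp; first exact: normr_measurable.
    exact: (mP _ _ (fun p => complex.Im (f p))).
  - by apply/measurable_EFinP; exact: (mP _ _ (fun p => nrm (f p))).
  - by move=> x _; rewrite lee_fin normc_Im.
split; last first.
  rewrite /cintegral /=; apply: (congr2 (@Complex R)).
    exact: (@Rintegral_fubini D1 D2 (fun p => complex.Re (f p)) K).
  exact: (@Rintegral_fubini D1 D2 (fun p => complex.Im (f p)) K).
split.
  exact: (@measurable_Rintegral_fubini D1 D2 (fun p => complex.Re (f p)) K).
exact: (@measurable_Rintegral_fubini D1 D2 (fun p => complex.Im (f p)) K).
Qed.

End ComplexFubini.

(** * Trigonometric integrals over the unit circle *)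

Section UnitCircle.
Variable R : realType.
Local Notation mu := (@lebesgue_measure R).
Local Notation nrm := (@normc R).
Implicit Types (s t a c x : R) (z w : R[i]) (n : nat).

Lemma cexpD z w : cexp (z + w) = cexp z * cexp w.
Proof.
apply/eqP; rewrite eq_complex ReM ImM /cexp /= ReD ImD expRD cosD sinD.
by apply/andP; split; apply/eqP; ring.
Qed.

Lemma cexp0 : cexp (0 : R[i]) = 1.
Proof. by rewrite /cexp /= expR0 cos0 sin0 !mul1r. Qed.

Lemma unit_circleD s t : unit_circle (s + t) = unit_circle s * unit_circle t.
Proof.
rewrite /unit_circle -cexpD; apply: congr1; apply/eqP.
by rewrite eq_complex ReD ImD /= addr0 !eqxx.
Qed.

Lemma unit_circle0 : unit_circle (0 : R) = 1. Proof. exact: cexp0. Qed.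

Lemma normc_unit_circle t : nrm (unit_circle t) = 1.
Proof. by rewrite /unit_circle /cexp /= expR0 !mul1r cos2Dsin2 sqrtr1. Qed.

Lemma unit_circle_neq0 t : unit_circle t != 0.
Proof. by rewrite -normc_eq0 normc_unit_circle oner_neq0. Qed.

Lemma unit_circleV t : (unit_circle t)^-1 = unit_circle (- t).
Proof.
by apply: (mulfI (unit_circle_neq0 t)); rewrite divff ?unit_circle_neq0// -unit_circleD subrr unit_circle0.
Qed.

Lemma cmeasurable_unit_circle d (T : measurableType d) (D : set T) (g : T -> R) :
  measurable_fun D g -> cmeasurable D (fun p : T => unit_circle (g p)).
Proof.
move=> mg; split; under eq_fun do rewrite /= expR0 mul1r.
  apply: measurableT_comp mg; exact: continuous_measurable_fun (@continuous_cos R).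
apply: measurableT_comp mg; exact: continuous_measurable_fun (@continuous_sin R).
Qed.

Lemma periodic_int (f : R -> R) (T : R) (k : int) : periodic f T -> forall x, f (x + T *~ k) = f x.
Proof.
move=> pf x; case: k => n; first exact: periodicn.
by rewrite NegzE mulrNz -{2}[x](subrK (T *+ n.+1)) periodicn.
Qed.

Lemma Rintegral_trig (q a : R) (k : int) : q = k%:~R -> q != 0 ->
  \int[mu]_(t in `[a, a + 2 * pi]) cos (q * t) = 0 /\
  \int[mu]_(t in `[a, a + 2 * pi]) sin (q * t) = 0.
Proof.
move=> qk q0; have a2 : a < a + 2 * pi by rewrite ltrDl mulr_gt0// pi_gt0.
have cq : continuous (fun t : R => q * t) by move=> t; apply: cvgM; [exact: cvg_cst|exact: cvg_id].
have shift : q * (a + 2 * pi) = q * a + (pi *+ 2) *~ k.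
  by rewrite mulrDr -mulr_natl -mulrzr -qk; ring.
have dq (x : R) : is_derive x (1 : R) (fun t : R => q * t) q.
  by apply: is_derive_eq; rewrite /GRing.scale /= mulr1.
have cc : continuous (fun t : R => cos (q * t)).
  by move=> x; apply: continuous_comp; [exact: cq|exact: continuous_cos].
have cs : continuous (fun t : R => sin (q * t)).
  by move=> x; apply: continuous_comp; [exact: cq|exact: continuous_sin].
have ds (x : R) : is_derive x (1 : R) (fun t => q^-1 * sin (q * t)) (cos (q * x)).
  by apply: is_derive_eq; rewrite /GRing.scale /=; field.
have dc (x : R) : is_derive x (1 : R) (fun t => - q^-1 * cos (q * t)) (sin (q * x)).
  by apply: is_derive_eq; rewrite /GRing.scale /=; field.
rewrite (Rintegral_FTC a2 cc ds) (Rintegral_FTC a2 cs dc) !shift.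
by rewrite !periodic_int ?subrr//; [exact: cosD2pi|exact: sinD2pi].
Qed.

(** Orthogonality of the characters. The base point [a] and the orientation [c] are free: the
    contour integral runs over [0, 2 pi], the Fourier formula over [- pi, pi] with both
    orientations. *)
Lemma cintegral_unit_circle (k : int) c a : c = 1 \/ c = -1 ->
  cintegral `[a, a + 2 * pi] (fun t => unit_circle (c * t * k%:~R)) =
  (2 * pi)%:C%C * (k == 0)%:R.
Proof.
move=> hc; have a2 : a <= a + 2 * pi by rewrite lerDl mulr_ge0// pi_ge0.
case: eqP => [->|/eqP k0].
  rewrite mulr1 /cintegral.
  under eq_Rintegral do rewrite mulr0 unit_circle0 /=.
  under [X in Complex _ X]eq_Rintegral do rewrite mulr0 unit_circle0 /=.
  rewrite !Rintegral_cst//= mul0r mul1r; apply: (congr2 (@Complex R)) => //.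
  by rewrite lebesgue_measure_itv /= lte_fin ltrDl mulr_gt0// ?pi_gt0//= addrC addKr.
have [k' hk'] : exists k' : int, c * k%:~R = k'%:~R.
  by case: hc => ->; [exists k; rewrite mul1r|exists (- k); rewrite mulN1r rmorphN].
have q0 : c * k%:~R != 0.
  by rewrite mulf_neq0 ?intr_eq0//; case: hc => ->; rewrite ?oppr_eq0 oner_neq0.
have [Hc Hs] := Rintegral_trig a hk' q0.
rewrite mulr0 /cintegral.
under eq_Rintegral do rewrite /= expR0 mul1r mulrAC.
under [X in Complex _ X]eq_Rintegral do rewrite /= expR0 mul1r mulrAC.
by rewrite Hc Hs.
Qed.

End UnitCircle.

(** * Iterates of the halved operator and visits to the origin *)

Section HalfOp.
Variables (R : realType) (lambda : R[i]).
Hypothesis lambda_lt1 : `|lambda| < 1.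
Local Notation mu := (@lebesgue_measure R).
Local Notation nrm := (@normc R).
Implicit Types (s t a c x : R) (z : R[i]) (n : nat) (h g : R -> R[i]).
Let mJ := @measurable_J11 R.
Local Hint Resolve mJ : core.

Let r01 : 0 <= nrm lambda < 1.
Proof. by rewrite normc_ge0 -ltcR -normcE. Qed.

Definition half_op z h x : R[i] := Mop z h x / 2.

Lemma half_opE z h x : half_op z h x =
  (z^-1 * h (half_shift (-1) x) + z * h (half_shift 1 x)) / 2.
Proof. by []. Qed.

Lemma half_op_lin_alg (K : fieldType) (t z' z a h1 k1 h2 k2 : K) :
  (z' * (a * h1 + k1) + z * (a * h2 + k2)) * t =
  a * ((z' * h1 + z * h2) * t) + (z' * k1 + z * k2) * t.
Proof. by ring. Qed.

Lemma half_op_lin z (a : R[i]) h g :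
  half_op z (fun x => a * h x + g x) = fun x => a * half_op z h x + half_op z g x.
Proof. by apply/funext => x; rewrite !half_opE; exact: half_op_lin_alg. Qed.

Lemma iter_half_op_lin n z (a : R[i]) h g :
  iter n (half_op z) (fun x => a * h x + g x) =
  fun x => a * iter n (half_op z) h x + iter n (half_op z) g x.
Proof. by elim: n => //= n ->; exact: half_op_lin. Qed.

Lemma normc2 : nrm 2 = 2.
Proof. by have := normc_real (2 : R); rewrite rmorph_nat ger0_norm. Qed.

Lemma normc_half_op_le z h x : nrm z = 1 ->
  nrm (half_op z h x) <= avg (fun y => nrm (h y)) x.
Proof.
move=> z1; rewrite half_opE normcM normcV normc2 /avg mulrC.
rewrite ler_pM2l ?invr_gt0// (le_trans (normcD _ _))//.
by rewrite !normcM normcV z1 invr1 !mul1r.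
Qed.

Lemma normc_iter_half_op_le (rho : R) n z h x : nrm z = 1 -> nrm lambda <= rho ->
  nrm (lambda ^+ n * iter n (half_op z) h x) <= wavg rho n (fun y => nrm (h y)) x.
Proof.
move=> z1 lr; rewrite normcM normcX.
elim: n x => [|n IH] x /=; first by rewrite mul1r.
set g := iter n _ _ in IH *; rewrite exprS -mulrA.
apply: ler_pM => //; rewrite ?mulr_ge0 ?exprn_ge0 ?normc_ge0//.
rewrite (le_trans (ler_wpM2l _ (normc_half_op_le g x z1))) ?exprn_ge0 ?normc_ge0//.
rewrite /avg mulrCA ler_pM2l ?invr_gt0// mulrDr.
exact: lerD.
Qed.

Lemma cintegrable_half_op z g : cintegrable (@J11 R) g -> cintegrable (@J11 R) (half_op z g).
Proof.
move=> cg; have [cm cp _] := cintegral_halves cg.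
have H : cintegrable (@J11 R) (fun x => 2^-1 * (z^-1 * Rminus g x + z * Rplus g x)).
  by apply: cintegrableZ => //; apply: cintegrableD => //; exact: cintegrableZ.
by rewrite /half_op; under eq_fun do rewrite mulrC.
Qed.

Lemma cintegrable_phase n s g : cintegrable (@J11 R) g ->
  cintegrable (@J11 R) (fun x => unit_circle (s * (walk n x)%:~R) * g x).
Proof.
move=> cg; apply: (le_cintegrable mJ _ (cintegrable_normc mJ cg)).
  apply: cmeasurableM; last exact: cintegrable_measurable.
  by apply: cmeasurable_unit_circle; apply: measurable_funM => //; exact: measurable_walk.
by move=> x _; rewrite normcM normc_unit_circle mul1r.
Qed.

Lemma phase_half_alg (K : fieldType) (t u v p g1 g2 : K) :
  p * ((u * g1 + v * g2) * t) = (p * u * g1 + p * v * g2) * t.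
Proof. by ring. Qed.

(** Read backwards through the halving identity, each application multiplies by z^-1 on the left
    half and by z on the right half; n applications accumulate z to the digit sum of length n. *)
Lemma cintegral_iter_half_op n s g : cintegrable (@J11 R) g ->
  cintegral (@J11 R) (iter n (half_op (unit_circle s)) g) =
  cintegral (@J11 R) (fun x => unit_circle (s * (walk n x)%:~R) * g x).
Proof.
elim: n g => [|n IH] g cg.
  by apply: eq_cintegral => x _ /=; rewrite /walk big_ord0 mulr0 unit_circle0 mul1r.
rewrite iterSr IH; last exact: cintegrable_half_op.
have [cm cp ->] := cintegral_halves (cintegrable_phase n.+1 s cg).
rewrite -(cintegralD mJ cm cp) mulrC -cintegralZ//; last exact: cintegrableD.
apply: eq_cintegral => x /set_mem Jx; rewrite half_opE [RHS]mulrC /Rminus /Rplus.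
rewrite -/(half_shift (-1) x) -/(half_shift 1 x) walk_half_shiftN1// walk_half_shift1//.
rewrite phase_half_alg unit_circleV -!unit_circleD !rmorphD rmorphN1 !mulrDr mulrN1 mulr1.
by rewrite [- s + _]addrC [s + _]addrC.
Qed.

Lemma normc_cintegral_le (D : set R) g : measurable D -> cintegrable D g ->
  nrm (cintegral D g) <= 2 * \int[mu]_(x in D) nrm (g x).
Proof.
move=> mD cg; have ig := cintegrable_normc mD cg; case: (cg) => g1 g2.
rewrite (le_trans (normc_ReIm _))// mulr_natl mulr2n /cintegral /=.
rewrite lerD// (le_trans (le_normr_Rintegral _ _))//;
  apply: le_Rintegral => //; try exact: integrable_norm.
- by move=> x Dx; exact: normc_Re.
- by move=> x Dx; exact: normc_Im.
Qed.

Lemma integral_normc_lty (D : set R) g : measurable D -> cintegrable D g ->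
  (\int[mu]_(x in D) (nrm (g x))%:E = (\int[mu]_(x in D) nrm (g x))%:E)%E.
Proof.
move=> mD cg; have ig := cintegrable_normc mD cg.
by rewrite /Rintegral fineK//; exact: integrable_fin_num.
Qed.

Lemma cintegrable_visit n h : cintegrable (@J11 R) h ->
  cintegrable (@J11 R) (fun x => (walk n x == 0)%:R * h x).
Proof.
move=> ch; have mW := @cmeasurable_walk_eq0 R 0 n (@J11 R).
apply: (le_cintegrable mJ _ (cintegrable_normc mJ ch)).
  apply: cmeasurableM; last exact: cintegrable_measurable.
  by move: mW; under eq_fun do rewrite add0r.
move=> x _; rewrite normcM ler_piMl ?normc_ge0//.
by case: (_ == 0); rewrite ?normc1 ?normc0.
Qed.

Lemma cintegrable_W_mul k g : cintegrable (@J11 R) g ->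
  cintegrable (@J11 R) (fun x => W lambda k x * g x).
Proof.
move=> cg; apply: (le_cintegrable mJ (g := fun x => 1 / (1 - nrm lambda) * nrm (g x))).
- by apply: cmeasurableM; [exact: cmeasurable_W|exact: cintegrable_measurable].
- under [X in _.-integrable _ X]eq_fun do rewrite /= EFinM.
  by apply: integrableZl => //; exact: cintegrable_normc.
- move=> x _; rewrite normcM ler_wpM2r ?normc_ge0//; exact: W_le.
Qed.

Lemma cintegral_V_mul g : cintegrable (@J11 R) g ->
  cintegral (@I11 R) (fun x => V lambda x * g x) =
  cintegral (@J11 R) (fun x => W lambda 0 x * g x).
Proof.
move=> cg; apply: cintegral_I11_dyadic.
- apply: (le_cintegrable mJ (g := fun x => (1 + nrm lambda / (1 - nrm lambda)) * nrm (g x))).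
  + apply: cmeasurableM; last exact: cintegrable_measurable.
    by apply: cmeasurable_V => //; exact: J11_I11.
  + under [X in _.-integrable _ X]eq_fun do rewrite /= EFinM.
    by apply: integrableZl => //; exact: cintegrable_normc.
  + by move=> x _; rewrite normcM ler_wpM2r ?normc_ge0// V_le.
- by apply: cmeasurableM; [exact: cmeasurable_W|exact: cintegrable_measurable].
- by move=> x /J11_I11 Ix dx; rewrite V_W.
Qed.

Lemma cintegral_visit n a c h : c = 1 \/ c = -1 -> cintegrable (@J11 R) h ->
  cmeasurable `[a, a + 2 * pi]
    (fun t => cintegral (@J11 R) (iter n (half_op (unit_circle (c * t))) h)) /\
  cintegral `[a, a + 2 * pi]
    (fun t => cintegral (@J11 R) (iter n (half_op (unit_circle (c * t))) h)) =
  (2 * pi)%:C%C * cintegral (@J11 R) (fun x => (walk n x == 0)%:R * h x).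
Proof.
move=> hc ch; pose D := `[a, a + 2 * pi]%classic.
have -> : (fun t => cintegral (@J11 R) (iter n (half_op (unit_circle (c * t))) h)) =
    fun t => cintegral (@J11 R) (fun x => unit_circle (c * t * (walk n x)%:~R) * h x).
  by apply/funext => t; exact: cintegral_iter_half_op.
pose f (p : R * R) := unit_circle (c * p.1 * (walk n p.2)%:~R) * h p.2.
have mD : measurable D by exact: measurable_itv.
have Doo : (mu D < +oo)%E.
  by rewrite lebesgue_measure_itv /=; case: ifP => _; rewrite -?EFinD ltry.
have m2 (k : R -> R) : measurable_fun (@J11 R) k ->
    measurable_fun (D `*` @J11 R) (fun p : R * R => k p.2).
  move=> mk; apply: (measurable_comp mJ _ mk); last exact: measurable_funTS.
  by move=> _ [[t x] [_ Jx] <-].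
have mf : cmeasurable (D `*` @J11 R) f.
  apply: cmeasurableM; last first.
    have [h1 h2] := cintegrable_measurable mJ ch; split.
      exact: (m2 (fun x => complex.Re (h x))).
    exact: (m2 (fun x => complex.Im (h x))).
  apply: cmeasurable_unit_circle; apply: measurable_funM.
    by apply: measurable_funM => //; exact: measurable_funTS.
  exact: (m2 (fun x => (walk n x)%:~R) (measurable_walk n (D := _))).
have K0 : 0 <= \int[mu]_(x in @J11 R) nrm (h x).
  by apply: Rintegral_ge0 => x _; exact: normc_ge0.
have fK t : D t -> (\int[mu]_(x in @J11 R) (nrm (f (t, x)))%:E <=
    (\int[mu]_(x in @J11 R) nrm (h x))%:E)%E.
  move=> _; rewrite -integral_normc_lty//.
  by under eq_integral do rewrite /f normcM normc_unit_circle mul1r.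
have [mF ->] := cintegral_fubini mD mJ Doo mf K0 fK.
split; first exact: mF.
have cV := cintegrable_visit n ch.
rewrite -cintegralZ//; apply: eq_cintegral => x _.
have cP : cintegrable D (fun t => unit_circle (c * t * (walk n x)%:~R)).
  apply: (@bounded_cintegrable _ _ _ 1) => //; last by move=> t _; rewrite normc_unit_circle.
  by apply: cmeasurable_unit_circle; apply: measurable_funM => //; exact: measurable_funM.
rewrite /f /=; under eq_fun do rewrite mulrC.
by rewrite cintegralZ// cintegral_unit_circle// mulrC mulrA.
Qed.

Lemma normc_cintegral_iter_le n s h : cintegrable (@J11 R) h ->
  nrm (cintegral (@J11 R) (iter n (half_op (unit_circle s)) h)) <=
  2 * \int[mu]_(x in @J11 R) nrm (h x).
Proof.
move=> ch; rewrite cintegral_iter_half_op//.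
rewrite (le_trans (normc_cintegral_le mJ (cintegrable_phase n s ch)))//.
by under eq_Rintegral do rewrite normcM normc_unit_circle mul1r.
Qed.

(** The iterates are integrated over x before being summed. These integrals are bounded uniformly in
    t and n even for unbounded [h], so the series is dominated by a geometric one. *)
Lemma cintegral_W_circle a c h : c = 1 \/ c = -1 -> cintegrable (@J11 R) h ->
  cintegral `[a, a + 2 * pi] (fun t => csum (fun n => lambda ^+ n *
    cintegral (@J11 R) (iter n (half_op (unit_circle (c * t))) h))) =
  (2 * pi)%:C%C * cintegral (@J11 R) (fun x => W lambda 0 x * h x).
Proof.
move=> hc ch; pose D := `[a, a + 2 * pi]%classic.
have mD : measurable D by exact: measurable_itv.
have Doo : (mu D < +oo)%E.
  by rewrite lebesgue_measure_itv /=; case: ifP => _; rewrite -?EFinD ltry.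
pose K := 2 * \int[mu]_(x in @J11 R) nrm (h x).
have ub n t : nrm (lambda ^+ n * cintegral (@J11 R) (iter n (half_op (unit_circle (c * t))) h)) <=
    K * nrm lambda ^+ n.
  rewrite normcM normcX mulrC ler_wpM2r ?exprn_ge0 ?normc_ge0//.
  exact: normc_cintegral_iter_le.
have mu_ n : cmeasurable D (fun t => lambda ^+ n *
    cintegral (@J11 R) (iter n (half_op (unit_circle (c * t))) h)).
  by apply: cmeasurableZ; exact: (cintegral_visit n a hc ch).1.
rewrite (@cintegral_csum_geometric _ D _ K _ mD Doo r01 mu_); last by move=> n t _; exact: ub.
have cD n : cintegrable D (fun t => cintegral (@J11 R) (iter n (half_op (unit_circle (c * t))) h)).
  apply: (@bounded_cintegrable _ _ _ K) => //; first exact: (cintegral_visit n a hc ch).1.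
  by move=> t _; exact: normc_cintegral_iter_le.
have dom x : dominated (fun n => lambda ^+ n * ((walk n x == 0)%:R * h x)).
  apply: (@dominated_geometric _ (nrm (h x)) _ _ r01) => n.
  rewrite mulrA normcM mulrC ler_wpM2l ?normc_ge0//.
  by have := W_term_le lambda 0 x n; rewrite add0r mul1r.
have WE x : W lambda 0 x * h x = csum (fun n => lambda ^+ n * ((walk n x == 0)%:R * h x)).
  rewrite W.unlock mulrC -csumZ; last exact: W_dominated.
  by apply: eq_csum => n; rewrite add0r mulrC mulrA.
have cV n := cintegrable_visit n ch.
have r1' : `|nrm lambda| < 1 by rewrite ger0_norm ?normc_ge0//; case/andP: r01.
have -> : cintegral (@J11 R) (fun x => W lambda 0 x * h x) =
    csum (fun n => lambda ^+ n * cintegral (@J11 R) (fun x => (walk n x == 0)%:R * h x)).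
  rewrite (eq_cintegral (g := fun x => csum (fun n => lambda ^+ n * ((walk n x == 0)%:R * h x))));
    last by move=> x _; exact: WE.
  rewrite (@cintegral_csum _ _ _ (fun n x => nrm (h x) * nrm lambda ^+ n)) //.
  - by apply: eq_csum => n; rewrite cintegralZ.
  - by move=> n; apply: cmeasurableZ; exact: cintegrable_measurable.
  - move=> n x _; rewrite mulrA normcM mulrC ler_wpM2l ?normc_ge0//.
    by have := W_term_le lambda 0 x n; rewrite add0r mul1r.
  - by move=> x _; exact: is_cvg_geometric_series.
  - have -> : (fun x => limn (series (fun n => nrm (h x) * nrm lambda ^+ n))) =
        fun x => (1 - nrm lambda)^-1 * nrm (h x).
      apply/funext => x; rewrite mulrC; apply/cvg_lim => //.
      exact: cvg_geometric_series.
    under [X in _.-integrable _ X]eq_fun do rewrite /= EFinM.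
    by apply: integrableZl => //; exact: cintegrable_normc.
rewrite -csumZ; last first.
  apply: (@dominated_geometric _ K _ _ r01) => n.
  rewrite normcM normcX mulrC ler_wpM2r ?exprn_ge0 ?normc_ge0//.
  rewrite (le_trans (normc_cintegral_le mJ (cV n)))// ler_pM2l//.
  apply: le_Rintegral => //; try exact: cintegrable_normc.
  move=> x _; rewrite normcM ler_piMl ?normc_ge0//.
  by case: (_ == 0); rewrite ?normc1 ?normc0.
apply: eq_csum => n; rewrite (cintegralZ _ mD (cD n)) (cintegral_visit n a hc ch).2.
by rewrite mulrCA.
Qed.

End HalfOp.

(** * The resolvent *)

Section FiniteAverages.
Variables (R : realType) (rho : R).
Hypothesis rho01 : 0 < rho < 1.
Implicit Types (f : R -> R) (x c : R) (n N : nat).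

Let rho0 : 0 < rho. Proof. by case/andP: rho01. Qed.
Let rho01' : 0 <= rho < 1. Proof. by case/andP: rho01 => /ltW ->. Qed.

Lemma savg_ltyP f x : (forall y, 0 <= f y) ->
  (exists c, forall N, pavg rho N f x <= c) <-> (savg rho f x < +oo)%E.
Proof.
move=> f0; split => [[c fc]|foo].
  by rewrite (@le_lt_trans _ _ c%:E) ?ltry//; apply: savg_le => // N; rewrite lee_fin.
exists (fine (savg rho f x)) => N; rewrite -lee_fin fineK; first exact: pavg_le_savg.
by rewrite ge0_fin_numE// savg_ge0.
Qed.

(** By the recursion, rho times the average of the partial sums at the two half shifts is at most
    the next partial sum at [x]. Dividing by [rho] is why a positive rate is used even for lambda =
    0. *)
Lemma savg_lty_half_shift f x : (forall y, 0 <= f y) -> (savg rho f x < +oo)%E ->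
  (savg rho f (half_shift (-1) x) < +oo)%E /\ (savg rho f (half_shift 1 x) < +oo)%E.
Proof.
move=> f0 /(savg_ltyP _ f0)[c fc]; split; apply/savg_ltyP => //; exists (c * 2 / rho) => N;
  have := fc N.+1; rewrite pavgS ler_pdivlMr// /avg;
  have := f0 x; have := pavg_ge0 rho01' N (half_shift (-1) x) f0;
  have := pavg_ge0 rho01' N (half_shift 1 x) f0;
  move: (pavg _ _ _ _) (pavg _ _ _ _) => a b a0 b0 fx h;
  have ra : 0 <= a * rho by [rewrite mulr_ge0// ltW]; have rb : 0 <= b * rho by [rewrite mulr_ge0// ltW];
  lra.
Qed.

Lemma pavgZ N (k : R) f x : pavg rho N (fun y => k * f y) x = k * pavg rho N f x.
Proof.
elim: N x => [|N IH] x; first by rewrite !pavg0 mulr0.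
by rewrite !pavgS /avg !IH; ring.
Qed.

Lemma wavg_avg n f x : wavg rho n (fun y => rho * avg f y) x = wavg rho n.+1 f x.
Proof. by elim: n x => [|n IH] x //=; congr (_ * _); rewrite /avg !IH. Qed.

Lemma pavg_avg N f x : pavg rho N (fun y => rho * avg f y) x = pavg rho N.+1 f x - f x.
Proof.
rewrite [in RHS]/pavg big_ord_recl /= addrAC subrr add0r.
by apply: eq_bigr => n _; exact: wavg_avg.
Qed.

Lemma series_wavg f x : series (fun n => wavg rho n f x) = fun N => pavg rho N f x.
Proof. by apply/funext => N; rewrite /series /pavg /= big_mkord. Qed.

Lemma savg_lty_cvg f x : (forall y, 0 <= f y) -> (savg rho f x < +oo)%E ->
  cvgn (series (fun n => wavg rho n f x)).
Proof.
move=> f0 /(savg_ltyP _ f0)[c fc]; rewrite series_wavg; apply: nondecreasing_is_cvgn.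
  by move=> m n mn; exact: pavg_nondecreasing.
by exists c => _ [N _ <-].
Qed.

Lemma limn_wavg f x : (forall y, 0 <= f y) -> (savg rho f x < +oo)%E ->
  ((limn (series (fun n => wavg rho n f x)))%:E = savg rho f x)%E.
Proof.
move=> f0 foo; have c := savg_lty_cvg f0 foo.
rewrite /savg -EFin_lim; last by move: c; rewrite series_wavg.
by rewrite series_wavg.
Qed.

End FiniteAverages.

Lemma dominated_shift (R : realType) (u : nat -> R[i]) :
  dominated u -> dominated (fun n => u n.+1).
Proof.
move=> [a ua /cvg_ex[/= l al]]; exists (fun n => a n.+1) => //.
apply/cvg_ex; exists (l - a 0%N).
rewrite (_ : series _ = fun n => series a n.+1 - a 0%N).
  by apply: cvgB; [rewrite (cvg_shiftS (series a))|exact: cvg_cst].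
by apply/funext => n; rewrite /series /= big_nat_recl// addrAC subrr add0r.
Qed.

Definition averages_finite (R : realType) (rho : R) (h : R -> R[i]) (x : R) : bool :=
  (savg rho (fun y => @normc R (h y)) x < +oo)%E.

(* The Neumann series of (1 - lambda M_z / 2)^-1, set to 0 where the dominating
   series of averages of |h| diverges. *)
HB.lock Definition neumann (R : realType) (rho : R) (lambda z : R[i]) (h : R -> R[i]) (x : R) : R[i] :=
  csum (fun n => (averages_finite rho h x)%:R * (lambda ^+ n * iter n (half_op z) h x)).

Section Neumann.
Variables (R : realType) (lambda : R[i]) (rho : R).
Local Notation nrm := (@normc R).
Hypothesis rho01 : 0 < rho < 1.
Hypothesis lambda_rho : nrm lambda <= rho.
Implicit Types (x : R) (z a : R[i]) (h g k : R -> R[i]).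
Local Notation nh := (fun h y => nrm (h y)).
Local Notation finite := (averages_finite rho).
Let rho01' : 0 <= rho < 1. Proof. by case/andP: rho01 => /ltW ->. Qed.

Let nh0 h y : 0 <= nrm (h y). Proof. exact: normc_ge0. Qed.

Lemma neumann_dominated z h x : nrm z = 1 -> finite h x ->
  dominated (fun n => lambda ^+ n * iter n (half_op z) h x).
Proof.
move=> z1 fx; exists (fun n => wavg rho n (nh h) x); last exact: savg_lty_cvg.
by move=> n; exact: normc_iter_half_op_le.
Qed.

Lemma neumannE z h x : finite h x ->
  neumann rho lambda z h x = csum (fun n => lambda ^+ n * iter n (half_op z) h x).
Proof. by move=> fx; rewrite neumann.unlock fx; apply: eq_csum => n; rewrite mul1r. Qed.

Lemma normc_neumann_le z h x : nrm z = 1 ->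
  ((nrm (neumann rho lambda z h x))%:E <= savg rho (nh h) x)%E.
Proof.
move=> z1; have [fx|] := boolP (finite h x).
  rewrite neumannE// -limn_wavg// lee_fin; apply: csum_le; last exact: savg_lty_cvg.
  by move=> n; exact: normc_iter_half_op_le.
move=> nf; rewrite neumann.unlock (negbTE nf).
rewrite (eq_csum (v := fun=> 0)); last by move=> n; rewrite mul0r.
by rewrite csum0 normc0; exact: savg_ge0.
Qed.

Lemma finite_lin a h k x : finite h x -> finite k x -> finite (fun y => a * h y + k y) x.
Proof.
move=> /(savg_ltyP rho01 _ (nh0 h))[c hc] /(savg_ltyP rho01 _ (nh0 k))[d kd].
apply/(savg_ltyP rho01 _ (nh0 _)); exists (nrm a * c + d) => N.
apply: (@le_trans _ _ (pavg rho N (fun y => nrm a * nrm (h y) + nrm (k y)) x)).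
  apply: ler_sum => n _; elim: {n}(nat_of_ord n) x {hc kd} => [|n IH] x /=.
    by rewrite (le_trans (normcD _ _))// normcM.
  by rewrite ler_wpM2l//; [case/andP: rho01'|rewrite /avg ler_pM2l ?invr_gt0// lerD].
by rewrite pavgD pavgZ lerD// ler_wpM2l ?normc_ge0.
Qed.

Lemma neumann_lin z a h k x : nrm z = 1 -> finite h x -> finite k x ->
  neumann rho lambda z (fun y => a * h y + k y) x =
  a * neumann rho lambda z h x + neumann rho lambda z k x.
Proof.
move=> z1 fh fk; rewrite !neumannE//; last exact: finite_lin.
have dh := neumann_dominated z1 fh; have dk := neumann_dominated z1 fk.
rewrite -csumZ// -csumD//; last exact: dominatedZ.
apply: eq_csum => n; rewrite iter_half_op_lin mulrDr.
by apply: (congr1 (fun u => u + _)); rewrite mulrCA.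
Qed.

Lemma TopE z h x : Top lambda z h x = h x - lambda * half_op z h x.
Proof. by []. Qed.

Lemma half_csum_alg (K : fieldType) (t u v l A B : K) :
  l * ((u * A + v * B) * t) = l * u * t * A + l * v * t * B.
Proof. by ring. Qed.

(** Finiteness at [x] passes to both half shifts, so three convergent series are involved, and
    removing the first term of the one at [x] gives the equation. *)
Lemma Top_neumann z h x : nrm z = 1 -> finite h x -> Top lambda z (neumann rho lambda z h) x = h x.
Proof.
move=> z1 fx; have [f1 f2] := savg_lty_half_shift rho01 (nh0 h) fx.
rewrite TopE half_opE !neumannE//.
have d1 := neumann_dominated z1 f1; have d2 := neumann_dominated z1 f2.
rewrite (csum_recl (neumann_dominated z1 fx)) expr0 mul1r /=.
rewrite half_csum_alg -!csumZ// -csumD; try exact: dominatedZ.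
apply/eqP; rewrite subr_eq; apply/eqP; apply: congr1; apply: eq_csum => n.
rewrite half_opE half_csum_alg !exprS.
move: (iter _ _ _ _) (iter _ _ _ _) (lambda ^+ n) z^-1 2^-1 => A B l z' t; ring.
Qed.

Lemma finite_Top z h x : nrm z = 1 -> finite h x -> finite (Top lambda z h) x.
Proof.
move=> z1 /(savg_ltyP rho01 _ (nh0 h))[c hc]; apply/(savg_ltyP rho01 _ (nh0 _)).
have /andP[r0 _] := rho01'.
exists (c + c) => N; have := hc N; have := hc N.+1.
have h1 : pavg rho N (nh (Top lambda z h)) x <=
    pavg rho N (fun y => nrm (h y) + rho * avg (nh h) y) x.
  apply: ler_sum => n _; elim: {n}(nat_of_ord n) x {hc} => [|n IH] x /=.
    rewrite TopE (le_trans (normcD _ _))// lerD2l -mulN1r.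
    have := normc_half_op_le h x z1; move: (half_op z h x) => g hg.
    by rewrite !normcM normcN1 mul1r ler_pM ?normc_ge0.
  by rewrite ler_wpM2l// /avg ler_pM2l ?invr_gt0// lerD.
move: h1; rewrite pavgD pavg_avg; have := nh0 h x.
by move: (pavg _ _ _ _) (pavg _ _ _ _) (pavg _ _ _ _) (nrm _) => p q s t; lra.
Qed.

(** The series for [Top lambda z h] has terms u_n - u_(n+1), so it telescopes to u_0. *)
Lemma neumann_Top z h x : nrm z = 1 -> finite h x -> neumann rho lambda z (Top lambda z h) x = h x.
Proof.
move=> z1 fx; rewrite neumannE; last exact: finite_Top.
pose u n := lambda ^+ n * iter n (half_op z) h x.
have du : dominated u by exact: neumann_dominated.
have du1 : dominated (fun n => u n.+1).
  exact: dominated_shift.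
have TE : Top lambda z h = fun y => - lambda * half_op z h y + h y.
  by apply/funext => y; rewrite TopE addrC mulNr.
have -> : (fun n => lambda ^+ n * iter n (half_op z) (Top lambda z h) x) =
    fun n => u n + -1 * u n.+1.
  apply/funext => n; rewrite TE iter_half_op_lin -iterSr /u exprS mulrDr addrC.
  apply: congr1; move: (iter _ _ _ _) (lambda ^+ n) => A l; ring.
rewrite csumD//; last exact: dominatedZ.
rewrite csumZ// (csum_recl du) mulN1r addrK.
by rewrite /u expr0 mul1r.
Qed.

End Neumann.

Section NeumannMeasurable.
Variables (R : realType) (lambda : R[i]) (rho : R).
Local Notation nrm := (@normc R).
Hypothesis rho01 : 0 < rho < 1.
Hypothesis lambda_rho : nrm lambda <= rho.
Implicit Types (x t : R) (z a : R[i]) (h g k : R -> R[i]).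
Let rho01' : 0 <= rho < 1. Proof. by case/andP: rho01 => /ltW ->. Qed.
Let mI := @measurable_I11 R.
Let mJ := @measurable_J11 R.
Local Hint Resolve mI mJ : core.

Lemma cmeasurable_averages_finite h : cmeasurable (@I11 R) h ->
  cmeasurable (@I11 R) (fun x => (averages_finite rho h x)%:R : R[i]).
Proof.
move=> mh; have mS : measurable_fun (@I11 R) (savg rho (fun y => nrm (h y))).
  by apply: measurable_savg => //; [move=> y; exact: normc_ge0|exact: measurable_normc].
pose A := @I11 R `&` [set x | (savg rho (fun y => nrm (h y)) x < +oo)%E].
have mA : measurable A by exact: emeasurable_fun_infty_o.
apply: (eq_cmeasurable _ (cmeasurable_real (measurable_funTS (@measurable_indic _ _ R setT A mA)))).
move=> x /set_mem Ix; rewrite /= indicE /averages_finite.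
have -> : (x \in A) = (savg rho (fun y => nrm (h y)) x < +oo)%E.
  by apply/idP/idP => [/set_mem[]|lt]; [|rewrite inE].
by case: (_ < _)%E.
Qed.

Lemma cmeasurable_circle_iter (D : set R) n h : measurable D -> cmeasurable (@I11 R) h ->
  cmeasurable (D `*` @I11 R) (fun p : R * R => iter n (half_op (unit_circle p.1)) h p.2).
Proof.
move=> mD mh; have mDI : measurable (D `*` @I11 R) by exact: measurableX.
elim: n => [|n IH] /=.
  case: mh => h1 h2; split.
    apply: (measurable_comp mI _ h1); last exact: measurable_funTS.
    by move=> _ [[t x] [_ Ix] <-].
  apply: (measurable_comp mI _ h2); last exact: measurable_funTS.
  by move=> _ [[t x] [_ Ix] <-].
have ms (e : R) : e = -1 \/ e = 1 -> cmeasurable (D `*` @I11 R)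
    (fun p : R * R => iter n (half_op (unit_circle p.1)) h (half_shift e p.2)).
  move=> he; pose s (p : R * R) := (p.1, half_shift e p.2).
  apply: (@cmeasurable_comp _ _ _ _ _ (D `*` @I11 R) (D `*` @I11 R)
    (fun p : R * R => iter n (half_op (unit_circle p.1)) h p.2) s) => //.
    by move=> _ [[t x] [Dt Ix] <-]; split => //; exact: half_shift_I11.
  apply: measurable_funTS; apply: measurable_fun_pair => //.
  exact: (measurableT_comp (@measurable_half_shift R e setT) measurable_snd).
under eq_fun do rewrite half_opE mulrC unit_circleV.
apply: cmeasurableZ; apply: cmeasurableD; apply: cmeasurableM.
- by apply: cmeasurable_unit_circle; apply: measurableT_comp => //; exact: measurable_funTS.
- by apply: ms; left.
- by apply: cmeasurable_unit_circle; exact: measurable_funTS.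
- by apply: ms; right.
Qed.

(** The indicator built into [neumann] makes the series converge at every point, so joint
    measurability of its terms passes to the sum. *)
Lemma circle_measurable_neumann h : cmeasurable (@I11 R) h ->
  circle_measurable (fun z => neumann rho lambda z h).
Proof.
move=> mh; rewrite /circle_measurable.
have -> : (fun p : R * R => neumann rho lambda (unit_circle p.1) h p.2) =
    fun p => csum (fun n => (averages_finite rho h p.2)%:R *
      (lambda ^+ n * iter n (half_op (unit_circle p.1)) h p.2)).
  by apply/funext => p; rewrite neumann.unlock.
apply: cmeasurable_csum => [n|[t x] _ /=].
  apply: cmeasurableM; last first.
    by apply: cmeasurableZ; apply: cmeasurable_circle_iter => //; exact: measurable_itv.
  apply: (@cmeasurable_comp _ _ _ _ _ _ (@I11 R) (fun x => (averages_finite rho h x)%:R)) => //.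
  - by move=> _ [[t x] [_ Ix] <-].
  - exact: cmeasurable_averages_finite.
  - exact: measurable_funTS.
case: (boolP (averages_finite rho h x)) => fx; last first.
  exists (fun=> 0) => [n|]; first by rewrite mul0r normc0.
  apply/cvg_ex; exists 0; rewrite /series /=.
  by under eq_fun do rewrite big1//; exact: cvg_cst.
by apply: dominatedZ; apply: neumann_dominated fx => //; exact: normc_unit_circle.
Qed.

Lemma cmeasurable_neumann z h : nrm z = 1 -> cmeasurable (@I11 R) h ->
  cmeasurable (@I11 R) (neumann rho lambda z h).
Proof.
move=> z1 mh; rewrite neumann.unlock; apply: cmeasurable_csum => [n|x _].
  apply: cmeasurableM; first exact: cmeasurable_averages_finite.
  apply: cmeasurableZ; elim: n => //= n IH.
  have ms (e : R) : e = -1 \/ e = 1 ->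
      cmeasurable (@I11 R) (fun x => iter n (half_op z) h (half_shift e x)).
    move=> he; apply: (cmeasurable_comp mI _ IH); last exact: measurable_half_shift.
    by move=> _ [x Ix <-]; exact: half_shift_I11.
  have -> : half_op z (iter n (half_op z) h) = fun x => 2^-1 *
      (z^-1 * iter n (half_op z) h (half_shift (-1) x) + z * iter n (half_op z) h (half_shift 1 x)).
    by apply/funext => x; rewrite half_opE mulrC.
  apply: cmeasurableZ; apply: cmeasurableD; apply: cmeasurableZ; apply: ms; [by left|by right].
case: (boolP (averages_finite rho h x)) => fx; last first.
  exists (fun=> 0) => [n|]; first by rewrite mul0r normc0.
  apply/cvg_ex; exists 0; rewrite /series /=.
  by under eq_fun do rewrite big1//; exact: cvg_cst.
by apply: dominatedZ; apply: neumann_dominated fx.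
Qed.

End NeumannMeasurable.

Lemma integral_I11 (R : realType) (f : R -> \bar R) : measurable_fun (@J11 R) f ->
  (\int[@lebesgue_measure R]_(x in @I11 R) f x = \int[@lebesgue_measure R]_(x in @J11 R) f x)%E.
Proof. by move=> mf; rewrite /I11 /J11 integral_itv_bndo_bndc. Qed.

Section Resolvent.
Variables (R : realType) (lambda : R[i]).
Hypothesis lambda_lt1 : `|lambda| < 1.
Local Notation mu := (@lebesgue_measure R).
Local Notation nrm := (@normc R).
Implicit Types (x t s : R) (z a : R[i]) (h g k : R -> R[i]).
Let mJ := @measurable_J11 R.
Local Hint Resolve mJ : core.
Let r01 : 0 <= nrm lambda < 1.
Proof. by rewrite normc_ge0 -ltcR -normcE. Qed.

Definition ae_eq_J11 (f g : R -> R[i]) :=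
  exists2 N : set R, mu.-negligible N & forall x, J11 x -> ~ N x -> f x = g x.

Section Equation.
Variables (s : R) (g h : R -> R[i]).
Let z := unit_circle s.
Hypotheses (cg : cintegrable (@J11 R) g) (ch : cintegrable (@J11 R) h).
Hypothesis gh : ae_eq_J11 (Top lambda z g) h.

Let I n := cintegral (@J11 R) (iter n (half_op z) g).
Let J n := cintegral (@J11 R) (iter n (half_op z) h).

Let IS n : I n = J n + lambda * I n.+1.
Proof.
have cgz := cintegrable_half_op z cg; have [N N0 ghN] := gh.
(* The equation g = h + lambda M_z g / 2 holds only almost everywhere. Writing the integrated
   iterates as integrals against a phase brings it under a single integral, where a null set does
   not matter. *)
rewrite /I /J iterSr !cintegral_iter_half_op// -cintegralZ//; last exact: cintegrable_phase.
rewrite -cintegralD//; [|exact: cintegrable_phase|by apply: cintegrableZ => //; exact: cintegrable_phase].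
have mp := fun k (ck : cintegrable (@J11 R) k) =>
  cintegrable_measurable mJ (cintegrable_phase n s ck).
apply: (ae_eq_cintegral mJ _ _ N0) => //; first exact: mp.
  by apply: cmeasurableD; [exact: mp|by apply: cmeasurableZ; exact: mp].
move=> x Jx Nx; have := ghN x Jx Nx; rewrite TopE => /eqP; rewrite subr_eq => /eqP {1}->.
by rewrite mulrDr; apply: congr1; rewrite mulrCA.
Qed.

Let I0E N : I 0%N = series (fun n => lambda ^+ n * J n) N + lambda ^+ N * I N.
Proof.
elim: N => [|N IH]; first by rewrite /series /= big_geq// expr0 mul1r add0r.
rewrite IH {1}IS seriesSr -addrA mulrDr; apply: congr1; apply: congr1.
by rewrite exprSr mulrA.
Qed.

Lemma cintegral_resolvent : cintegral (@J11 R) g = csum (fun n => lambda ^+ n * J n).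
Proof.
apply/esym/csum_lim; apply/cvgc_normc; apply/cvgrPdist_le => e e0.
pose K := 2 * \int[mu]_(x in @J11 R) nrm (g x).
have r1' : `|nrm lambda| < 1 by rewrite ger0_norm ?normc_ge0//; case/andP: r01.
have /cvgrPdist_le/(_ _ e0) := cvg_geometric K r1'.
apply: filterS => n; rewrite !sub0r !normrN /= => h1.
rewrite ger0_norm ?normc_ge0// normcB (le_trans _ h1)// (le_trans _ (ler_norm _))//.
rewrite -[cintegral _ _]/(I 0%N) (I0E n) addrAC subrr add0r normcM normcX mulrC.
by rewrite ler_wpM2r ?exprn_ge0 ?normc_ge0//; exact: normc_cintegral_iter_le.
Qed.

Hypotheses (mg : cmeasurable (@I11 R) g) (mh : cmeasurable (@I11 R) h).

(** An a priori bound independent of z, as Fubini requires; the finite norm of each inverse would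
    not give uniformity. It follows by integrating |g| <= |h| + |lambda| avg |g| and absorbing the
    last term, which is finite because [g] is integrable. *)
Lemma Int_resolvent_le :
  (Int (fun x => nrm (g x)) <= (1 - nrm lambda)^-1%:E * Int (fun x => nrm (h x)))%E.
Proof.
have r0 : 0 <= nrm lambda by exact: normc_ge0.
have r1 : 0 < 1 - nrm lambda by rewrite subr_gt0; case/andP: r01.
have mng := measurable_normc mg; have mnh := measurable_normc mh.
have ng0 y : 0 <= nrm (g y) by exact: normc_ge0.
have nh0 y : 0 <= nrm (h y) by exact: normc_ge0.
have [N N0 ghN] := gh.
have H : (Int (fun x => nrm (g x)) <= Int (fun x => nrm (h x)) +
    (nrm lambda)%:E * Int (fun x => nrm (g x)))%E.
  rewrite -{2}(@Int_avg R (fun x => nrm (g x)))// -IntZ//; last 2 first.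
  - by move=> y; exact: avg_ge0.
  - exact: measurable_avg.
  rewrite -IntD//; last 2 first.
  - by move=> y; rewrite mulr_ge0// avg_ge0.
  - by apply: measurable_funM => //; exact: measurable_avg.
  apply: ae_ge0_le_integral => //.
  - by move=> x _; rewrite lee_fin.
  - by apply/measurable_EFinP; exact: measurable_J11_fun.
  - by move=> x _; rewrite lee_fin addr_ge0// mulr_ge0// avg_ge0.
  - apply/measurable_EFinP; apply: measurable_J11_fun; apply: measurable_funD => //.
    by apply: measurable_funM => //; exact: measurable_avg.
  apply: negligibleS N0 => x /= NE; apply: contrapT => Nx; apply: NE => Jx.
  rewrite lee_fin; have := ghN x Jx Nx; rewrite TopE => /eqP; rewrite subr_eq => /eqP ->.
  rewrite (le_trans (normcD _ _))// lerD2l normcM ler_wpM2l//.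
  by apply: normc_half_op_le; exact: normc_unit_circle.
have Eg := integral_normc_lty mJ cg; have Eh := integral_normc_lty mJ ch.
move: H; rewrite /Int Eg Eh -!EFinM -EFinD !lee_fin.
move: (Rintegral _ _ _) (Rintegral _ _ _) => u v uv.
by rewrite mulrC ler_pdivlMr//; lra.
Qed.

End Equation.

Section Admissible.
Variable rho : R.
Hypothesis rho01 : 0 < rho < 1.
Hypothesis lambda_rho : nrm lambda <= rho.

(* The properties shared by L^2, L^oo and C on which part (ii) rests. *)
Record admissible (E : fspace R) : Prop := Admissible {
  adm_cmeasurable : forall h, fcarrier E h -> cmeasurable (@I11 R) h ;
  adm_Int : forall h, fcarrier E h -> (Int (fun x => nrm (h x)) < +oo)%E ;
  adm_lin : forall a h k, fcarrier E h -> fcarrier E k -> fcarrier E (fun x => a * h x + k x) ;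
  adm_Mop : forall z h, nrm z = 1 -> fcarrier E h -> fcarrier E (Mop z h) /\
    ((fnorm E h <= 1)%E -> (fnorm E (Mop z h) <= 2%:E)%E) ;
  adm_ae : forall f g, fcarrier E f -> fcarrier E g -> feq E f g -> ae_eq_J11 f g ;
  adm_feq : forall h k f g, fcarrier E h -> fcarrier E k -> fcarrier E f -> fcarrier E g ->
    (forall x, I11 x -> averages_finite rho h x -> averages_finite rho k x -> f x = g x) ->
    feq E f g ;
  adm_neumann : exists K : R, forall z h, nrm z = 1 -> fcarrier E h ->
    fcarrier E (neumann rho lambda z h) /\
    ((fnorm E h <= 1)%E -> (fnorm E (neumann rho lambda z h) <= K%:E)%E) }.

Section AdmissibleSpace.
Variable E : fspace R.
Hypothesis admE : admissible E.

Let opnorm_le T (K : R) : (forall h, fcarrier E h -> (fnorm E h <= 1)%E -> (fnorm E (T h) <= K%:E)%E) ->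
  (opnorm E T <= K%:E)%E.
Proof. by move=> TK; apply: ge_ereal_sup => _ [h [Eh h1] <-]; exact: TK. Qed.

Lemma bounded_op_Mop z : nrm z = 1 -> bounded_op E (Mop z) /\ (opnorm E (Mop z) <= 2%:E)%E.
Proof.
move=> z1; have le2 : (opnorm E (Mop z) <= 2%:E)%E.
  by apply: opnorm_le => h Eh; exact: (adm_Mop admE z1 Eh).2.
split => //; split; last by rewrite (le_lt_trans le2)// ltry.
  by move=> h Eh; exact: (adm_Mop admE z1 Eh).1.
move=> a h k Eh Ek; have M h' (Eh' : fcarrier E h') := (adm_Mop admE z1 Eh').1.
apply: (adm_feq admE Eh Ek); [by apply: M; exact: adm_lin|by apply: adm_lin => //; exact: M|].
move=> x _ _ _; rewrite /Mop /Rminus /Rplus.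
move: (h _) (h _) (k _) (k _) z^-1 => h1 h2 k1 k2 z'; ring.
Qed.

(** The resolvent identities hold at the points where the averages of |h| are finite, and [adm_feq]
    is designed to turn such pointwise identities into equality in the space. *)
Lemma is_inverse_op_neumann z : nrm z = 1 ->
  is_inverse_op E (Top lambda z) (neumann rho lambda z).
Proof.
move=> z1; have [K NK] := adm_neumann admE.
have TopN h : fcarrier E h -> fcarrier E (Top lambda z h).
  move=> Eh; rewrite (_ : Top lambda z h = fun x => (- (lambda / 2)) * Mop z h x + h x).
    by apply: adm_lin => //; exact: (adm_Mop admE z1 Eh).1.
  by apply/funext => x; rewrite /Top addrC mulNr mulrAC mulrA.
have Ne h (Eh : fcarrier E h) := (NK z h z1 Eh).1.
split; last first.
  move=> h Eh; split.
    apply: (adm_feq admE Eh Eh) => //; first by apply: TopN; exact: Ne.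
    by move=> x _ fx _; exact: Top_neumann.
  apply: (adm_feq admE Eh Eh) => //; first by apply: Ne; exact: TopN.
  by move=> x _ fx _; exact: neumann_Top.
split; first exact: Ne.
  move=> a h k Eh Ek; apply: (adm_feq admE Eh Ek).
  - by apply: Ne; exact: adm_lin.
  - by apply: adm_lin => //; exact: Ne.
  - by move=> x _ fh fk; exact: neumann_lin.
rewrite (@le_lt_trans _ _ K%:E) ?ltry//; apply: opnorm_le => h Eh.
exact: (NK z h z1 Eh).2.
Qed.

Let cintegrableE h : fcarrier E h -> cintegrable (@J11 R) h.
Proof.
move=> Eh; have mh := adm_cmeasurable admE Eh.
have mhJ : cmeasurable (@J11 R) h by apply: cmeasurableS mh => //; [exact: measurable_I11|exact: J11_sub_I11].
apply: (le_cintegrable mJ mhJ (g := fun x => nrm (h x))) => //.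
apply/integrableP; split; first by apply/measurable_EFinP; exact: measurable_normc.
under eq_integral do rewrite /= ger0_norm ?normc_ge0//.
exact: (adm_Int admE Eh).
Qed.

Lemma circle_div_alg (K : fieldType) (A p i u : K) : p != 0 -> i != 0 -> u != 0 ->
  A / (p * i * u) * (i * u) = p^-1 * A.
Proof. by move=> p0 i0 u0; field; rewrite p0 i0 u0. Qed.

Lemma mul_cancel_alg (K : fieldType) (p w A : K) : p != 0 -> w * A = p * (w * (p^-1 * A)).
Proof. by move=> p0; field. Qed.

Lemma Top_scale_alg (K : fieldType) (c l z' z d A B C : K) :
  c * A - l * ((z' * (c * B) + z * (c * C)) * d) = c * (A - l * ((z' * B + z * C) * d)).
Proof. by ring. Qed.

(** The resolvent equation, integrated over x, expresses the integral of [S z h] by a series in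
    which [S] no longer occurs; so every family of inverses gives the same value. *)
Lemma cintegral_V_resolvent (S : R[i] -> (R -> R[i]) -> R -> R[i]) :
  (forall z, nrm z = 1 -> is_inverse_op E (Top lambda z) (S z)) ->
  forall h, fcarrier E h -> circle_measurable (fun z => S z h) ->
  cintegral (@I11 R) (fun x => V lambda x * h x) =
  cintegral (@I11 R) (fun x => circle_integral (fun z =>
    S z h x / (2 * (pi : R)%:C%C * 'i%C * z))).
Proof.
move=> SP h Eh mS; pose D := `[0, 2 * pi : R]%classic.
have mI := @measurable_I11 R; have mD : measurable D by exact: measurable_itv.
have Doo : (mu D < +oo)%E.
  by rewrite lebesgue_measure_itv /=; case: ifP => _; rewrite -?EFinD ltry.
have ch := cintegrableE Eh.
have pi20 : 2 * (pi : R)%:C%C != 0.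
  rewrite mulf_neq0 ?pnatr_eq0//; apply/eqP => /(congr1 (@complex.Re R)) /= pi0.
  by have := @pi_gt0 R; rewrite pi0 ltxx.
have Sg t : [/\ fcarrier E (S (unit_circle t) h), cintegrable (@J11 R) (S (unit_circle t) h) &
    ae_eq_J11 (Top lambda (unit_circle t) (S (unit_circle t) h)) h].
  have [[Sc _ _] /(_ h Eh)[TS _]] := SP _ (normc_unit_circle t).
  have ES := Sc h Eh; split => //; first exact: cintegrableE.
  apply: (adm_ae admE _ Eh TS).
  rewrite (_ : Top _ _ _ = fun x => (- (lambda / 2)) * Mop (unit_circle t) (S (unit_circle t) h) x +
     S (unit_circle t) h x).
    by apply: adm_lin => //; exact: (adm_Mop admE (normc_unit_circle t) ES).1.
  by apply/funext => x; rewrite /Top addrC mulNr mulrAC mulrA.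
(* On the parametrised circle dz / (2 pi i z) becomes dt / (2 pi). *)
pose c : R[i] := (2 * (pi : R)%:C%C)^-1.
transitivity (cintegral (@I11 R) (fun x => cintegral D (fun t => c * S (unit_circle t) h x)));
  last first.
  apply: eq_cintegral => x _; apply: eq_cintegral => t _.
  by rewrite circle_div_alg ?unit_circle_neq0// eq_complex /= oner_eq0 andbF.
pose g t x := c * S (unit_circle t) h x; pose ch' x := c * h x.
have cch : cintegrable (@J11 R) ch' by exact: cintegrableZ.
have mch : cmeasurable (@I11 R) ch' by apply: cmeasurableZ; exact: (adm_cmeasurable admE Eh).
have cg t : cintegrable (@J11 R) (g t) by apply: cintegrableZ => //; have [] := Sg t.
have mg t : cmeasurable (@I11 R) (g t).
  by apply: cmeasurableZ; have [Es _ _] := Sg t; exact: (adm_cmeasurable admE Es).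
have gh t : ae_eq_J11 (Top lambda (unit_circle t) (g t)) ch'.
  have [_ _ [N N0 NE]] := Sg t; exists N => // x Jx Nx; rewrite /ch' -(NE x Jx Nx) !TopE !half_opE /g.
  exact: Top_scale_alg.
pose K := (1 - nrm lambda)^-1 * \int[mu]_(x in @J11 R) nrm (ch' x).
have K0 : 0 <= K.
  rewrite mulr_ge0 ?invr_ge0 ?subr_ge0; [by []|by case/andP: r01 => _ /ltW|].
  by apply: Rintegral_ge0 => x _; exact: normc_ge0.
have fK t : D t -> (\int[mu]_(x in @I11 R) (nrm (g t x))%:E <= K%:E)%E.
  move=> _; rewrite integral_I11; last first.
    by apply/measurable_EFinP; apply: measurable_J11_fun; exact: measurable_normc.
  rewrite EFinM -integral_normc_lty//; exact: (Int_resolvent_le (cg t) cch (gh t) (mg t) mch).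
have mf : cmeasurable (D `*` @I11 R) (fun p : R * R => g p.1 p.2) by exact: cmeasurableZ.
have [_ <-] := @cintegral_fubini R D (@I11 R) (fun p => g p.1 p.2) K mD mI Doo mf K0 fK.
have -> : (fun t => cintegral (@I11 R) (fun x => g t x)) = fun t => csum (fun n => lambda ^+ n *
    cintegral (@J11 R) (iter n (half_op (unit_circle (1 * t))) ch')).
  by apply/funext => t; rewrite mul1r cintegral_I11//; exact: (cintegral_resolvent (cg t) cch (gh t)).
have := cintegral_W_circle lambda_lt1 0 (or_introl erefl) cch; rewrite add0r => ->.
rewrite (cintegral_V_mul lambda_lt1 ch) -cintegralZ//; last exact: cintegrable_W_mul.
apply: eq_cintegral => x _; rewrite /ch' rmorphM /= rmorph_nat.
exact: mul_cancel_alg.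
Qed.

End AdmissibleSpace.
End Admissible.
End Resolvent.

(** * The spaces L^2 and L^oo *)

Section LebesgueSpaces.
Variables (R : realType) (lambda : R[i]) (rho : R).
Local Notation mu := (@lebesgue_measure R).
Local Notation nrm := (@normc R).
Hypothesis rho01 : 0 < rho < 1.
Hypothesis lambda_rho : nrm lambda <= rho.
Implicit Types (f : R -> R) (x c : R) (z a : R[i]) (h g k : R -> R[i]).
Let rho01' : 0 <= rho < 1. Proof. by case/andP: rho01 => /ltW ->. Qed.
Let rho1 : 0 < 1 - rho. Proof. by rewrite subr_gt0; case/andP: rho01. Qed.
Let mI := @measurable_I11 R.
Let mJ := @measurable_J11 R.
Local Hint Resolve mI mJ : core.
Local Notation nh h := (fun y => nrm (h y)).
Let nh0 h y : 0 <= nrm (h y). Proof. exact: normc_ge0. Qed.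

Lemma Int0P f : (forall y, 0 <= f y) -> measurable_fun (@I11 R) f ->
  Int f = 0%E <-> mu.-negligible [set x | J11 x /\ f x <> 0].
Proof.
move=> f0 mf; have mfJ : measurable_fun (@J11 R) (EFin \o f).
  by apply/measurable_EFinP; exact: measurable_J11_fun.
have -> : Int f = (\int[mu]_(x in @J11 R) `|(EFin \o f) x|)%E.
  by apply: eq_integral => x _; rewrite /= ger0_norm.
have -> : mu.-negligible [set x | J11 x /\ f x <> 0] <->
    ae_eq mu (@J11 R) (EFin \o f) (cst 0%E).
  split; apply: negligibleS => x /=.
    by move=> H; split; [apply: contrapT => nJ; apply: H|move=> fx; apply: H => _; rewrite fx].
  by move=> [Jx fx] /(_ Jx) [].
exact: ae_eq_integral_abs.
Qed.

Lemma le_Int0 f (g : R -> R) : (forall y, 0 <= f y) -> measurable_fun (@I11 R) f -> measurable_fun (@I11 R) g ->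
  (forall x, J11 x -> f x <= g x) -> Int g = 0%E -> Int f = 0%E.
Proof.
move=> f0 mf mg fg g0; apply/eqP; rewrite eq_le Int_ge0// andbT -g0.
exact: le_Int.
Qed.

Lemma cmeasurable_Mop z h : cmeasurable (@I11 R) h -> cmeasurable (@I11 R) (Mop z h).
Proof.
move=> mh; have ms (e : R) : e = -1 \/ e = 1 ->
    cmeasurable (@I11 R) (fun x => h (half_shift e x)).
  move=> he; apply: (cmeasurable_comp mI _ mh); last exact: measurable_half_shift.
  by move=> _ [x Ix <-]; exact: half_shift_I11.
by apply: cmeasurableD; apply: cmeasurableZ; apply: ms; [left|right].
Qed.

Lemma normc_Mop_le z h x : nrm z = 1 -> nrm (Mop z h x) <= 2 * avg (nh h) x.
Proof.
move=> z1; have := normc_half_op_le h x z1.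
by rewrite /half_op normcM normcV normc2 ler_pdivrMr// mulrC.
Qed.

Section Factory.
Variable p : \bar R.
Hypothesis norm0 : forall h, cmeasurable (@I11 R) h -> LpI11_norm p h = 0%E <-> Int (nh h) = 0%E.
Local Notation car h := (cmeasurable (@I11 R) h /\ (LpI11_norm p h < +oo)%E).
Hypothesis norm_Int : forall h, car h -> (Int (nh h) < +oo)%E.
Hypothesis norm_lin : forall a h k, car h -> car k -> (LpI11_norm p (fun x => a * h x + k x)%R < +oo)%E.
Hypothesis norm_Mop : forall z h, nrm z = 1 -> car h -> (LpI11_norm p (Mop z h) < +oo)%E /\
  ((LpI11_norm p h <= 1)%E -> (LpI11_norm p (Mop z h) <= 2%:E)%E).
Variable K : R.
Hypothesis norm_neumann : forall z h, nrm z = 1 -> car h ->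
  (LpI11_norm p (neumann rho lambda z h) < +oo)%E /\
  ((LpI11_norm p h <= 1)%E -> (LpI11_norm p (neumann rho lambda z h) <= K%:E)%E).

(** The two Lebesgue spaces share all measurability and almost everywhere arguments and differ only
    in the norm estimates, which are the hypotheses of this section. Null functions are recognised
    by the integral of their modulus. *)
Lemma admissible_LpI11 : admissible lambda rho (LpI11 p).
Proof.
split.
- by move=> h [].
- exact: norm_Int.
- move=> a h k Eh Ek; split; last exact: norm_lin.
  by case: Eh Ek => mh _ [mk _]; apply: cmeasurableD => //; exact: cmeasurableZ.
- move=> z h z1 Eh; have [H1 H2] := norm_Mop z1 Eh; split; last exact: H2.
  by split; [apply: cmeasurable_Mop; case: Eh|exact: H1].
- move=> f g [mf _] [mg _]; have md : cmeasurable (@I11 R) (fun x => f x - g x) by exact: cmeasurableB.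
  move=> /(norm0 md) /(Int0P (nh0 _) (measurable_normc md))[N [mN N0 NE]].
  exists N; first exact/negligibleP.
  move=> x Jx Nx; apply/eqP; rewrite -subr_eq0 -normc_eq0; apply/eqP; apply: contrapT => fg.
  by apply: Nx; apply: NE.
- move=> h k f g Eh Ek [mf _] [mg _] fg.
  have md : cmeasurable (@I11 R) (fun x => f x - g x) by exact: cmeasurableB.
  apply: (norm0 md).2; apply/(Int0P (nh0 (fun x => f x - g x)) (measurable_normc md)).
  have ae h' : car h' -> mu.-negligible [set x | J11 x /\ savg rho (nh h') x = +oo%E].
    by move=> Eh'; apply: ae_savg_lty => //; [apply: measurable_normc; case: Eh'|exact: norm_Int].
  apply: negligibleS (negligibleU (ae h Eh) (ae k Ek)) => x /= [Jx nfg].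
  have [fh|fh] := boolP (averages_finite rho h x); last first.
    by left; split => //; apply/eqP; rewrite -leye_eq leNgt.
  have [fk|fk] := boolP (averages_finite rho k x); last first.
    by right; split => //; apply/eqP; rewrite -leye_eq leNgt.
  exfalso; apply: nfg; rewrite fg// ?subrr ?normc0//.
  exact: J11_I11.
- exists K => z h z1 Eh; have [H1 H2] := norm_neumann z1 Eh; split; last exact: H2.
  by split; [apply: cmeasurable_neumann => //; case: Eh|exact: H1].
Qed.

End Factory.

Section L2.

Lemma poweR_LpI11_norm h : cmeasurable (@I11 R) h ->
  (LpI11_norm 2%:E h `^ 2 = Int (fun x => nrm (h x) ^+ 2)%R)%E.
Proof.
move=> mh; rewrite /LpI11_norm poweR_Lnorm// /Int -integral_I11; last first.
  by apply/measurable_EFinP; apply: measurable_J11_fun; apply: measurable_funX; exact: measurable_normc.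
rewrite [RHS]integral_mkcond; apply: eq_integral => x _; rewrite /patch.
case: ifP => _; last by rewrite abse0 poweR0r.
have -> : `|(complex.Re `|h x|)%:E|%E = (nrm (h x))%:E by rewrite gee0_abs// lee_fin; exact: normc_ge0.
by rewrite poweR_EFin powR_mulrn ?normc_ge0.
Qed.

Lemma L2_norm_le h (c : R) : 0 <= c -> cmeasurable (@I11 R) h ->
  (LpI11_norm 2%:E h <= c%:E)%E = (Int (fun x => nrm (h x) ^+ 2)%R <= (c ^+ 2)%:E)%E.
Proof.
move=> c0 mh; rewrite -poweR_LpI11_norm//.
have : (0 <= LpI11_norm 2%:E h)%E by exact: Lnorm_ge0.
case: (LpI11_norm _ h) => [r| |]//.
  by rewrite poweR_EFin !lee_fin => r0; rewrite powR_mulrn// ler_pXn2r.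
by move=> _; rewrite poweRyr// !leye_eq.
Qed.

Lemma L2_norm_lty h : cmeasurable (@I11 R) h ->
  (LpI11_norm 2%:E h < +oo)%E = (Int (fun x => nrm (h x) ^+ 2)%R < +oo)%E.
Proof.
move=> mh; rewrite -poweR_LpI11_norm//.
have : (0 <= LpI11_norm 2%:E h)%E by exact: Lnorm_ge0.
case: (LpI11_norm _ h) => [r| |]//.
  by rewrite poweR_EFin !ltry.
by rewrite poweRyr.
Qed.

Lemma admissible_L2 : admissible lambda rho (LpI11 2%:E).
Proof.
have mn h : cmeasurable (@I11 R) h -> measurable_fun (@I11 R) (fun x => nrm (h x) ^+ 2).
  by move=> mh; apply: measurable_funX; exact: measurable_normc.
have sq0 h y : 0 <= nrm (h y) ^+ 2 by exact: sqr_ge0.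
pose K := (1 - rho)^-1.
have K0 : 0 <= K by rewrite invr_ge0 ltW.
(* From (a + b)^2 <= 2 (a^2 + b^2) the squared modulus is at most 4 times the average of |h|^2, and
   averaging preserves the integral; this is the operator norm 2. *)
have Mop_le z h : nrm z = 1 -> cmeasurable (@I11 R) h ->
    (Int (fun x => nrm (Mop z h x) ^+ 2)%R <= 4%:E * Int (fun x => nrm (h x) ^+ 2)%R)%E.
  move=> z1 mh; rewrite -(Int_avg (f := fun x => nrm (h x) ^+ 2)) ; [|by []|exact: mn].
  have a0 y : 0 <= avg (fun x => nrm (h x) ^+ 2) y by exact: avg_ge0.
  have ma : measurable_fun (@I11 R) (avg (fun x => nrm (h x) ^+ 2)) by apply: measurable_avg; exact: mn.
  rewrite -IntZ//; apply: le_Int => //; first by apply: mn; exact: cmeasurable_Mop.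
    exact: measurable_funM.
  move=> x _; have := normc_Mop_le h x z1; rewrite /avg.
  move: (nrm (h _)) (nrm (h _)) (nrm (Mop z h x)) (nh0 (Mop z h) x) => a b m m0 mab.
  rewrite (le_trans (_ : _ <= (a + b) ^+ 2))//; last first.
    by rewrite -subr_ge0 (_ : _ - _ = (a - b) ^+ 2) ?sqr_ge0//; field.
  by rewrite ler_pXn2r// ?nnegrE//; lra.
(* One factor [K] comes from the convexity estimate for the square of the sum of averages, the other
   from integrating the sum of the averages of |h|^2. *)
have neu_le z h : nrm z = 1 -> cmeasurable (@I11 R) h ->
    (Int (fun x => nrm (neumann rho lambda z h x) ^+ 2)%R <=
     (K ^+ 2)%:E * Int (fun x => nrm (h x) ^+ 2)%R)%E.
  move=> z1 mh; have mS := measurable_savg rho01' (sq0 h) (mn h mh).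
  apply: (@le_trans _ _ (\int[mu]_(x in @J11 R) (K%:E * savg rho (fun y => (nrm (h y) ^+ 2)%R) x))%E).
    apply: ge0_le_integral => //.
    - by move=> x _; rewrite lee_fin sqr_ge0.
    - apply/measurable_EFinP; apply: measurable_J11_fun; apply: mn.
      exact: cmeasurable_neumann.
    - by apply: measurable_funeM; exact: measurable_J11_fun.
    move=> x _; have := normc_neumann_le rho01 lambda_rho h x z1.
    have := savg_ge0 rho01' x (sq0 h).
    case S2 : (savg rho (fun y => nrm (h y) ^+ 2) x) => [s| |]//; last first.
      by rewrite gt0_muley ?leey// lte_fin invr_gt0.
    rewrite lee_fin => s0 le1.
    have le2 : (savg rho (nh h) x <= (Num.sqrt (K * s))%:E)%E.
      apply: savg_le => // N; rewrite lee_fin -(ler_pXn2r (n := 2))//; last 2 first.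
      - by rewrite nnegrE pavg_ge0.
      - by rewrite nnegrE sqrtr_ge0.
      rewrite sqr_sqrtr ?mulr_ge0// (le_trans (pavg_sqr_le rho01' N x (nh0 h)))//.
      by rewrite ler_wpM2l// -lee_fin -S2 pavg_le_savg.
    have := le_trans le1 le2; rewrite lee_fin => le3.
    rewrite -EFinM lee_fin -(sqr_sqrtr (mulr_ge0 K0 s0)) ler_pXn2r// nnegrE ?normc_ge0//.
  rewrite ge0_integralZl_EFin//; last 2 first.
  - by move=> x _; exact: savg_ge0.
  - exact: measurable_J11_fun.
  rewrite expr2 EFinM -muleA lee_wpmul2l// ?lee_fin//.
  by apply: integral_savg_le => //; exact: mn.
apply: (@admissible_LpI11 _ _ _ _ _ K).
- move=> h mh; have -> : LpI11_norm 2%:E h = 0%E <-> Int (fun x => nrm (h x) ^+ 2) = 0%E.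
    have N0 : (0 <= LpI11_norm 2%:E h)%E by exact: Lnorm_ge0.
    have := L2_norm_le (lexx 0) mh; rewrite expr0n /= => E; split => H.
      by apply/eqP; rewrite eq_le -E H lexx Int_ge0.
    by apply/eqP; rewrite eq_le N0 andbT E H.
  rewrite !Int0P//; [|exact: measurable_normc|exact: mn].
  have -> // : [set x | J11 x /\ nrm (h x) ^+ 2 <> 0] = [set x | J11 x /\ nrm (h x) <> 0].
  apply/seteqP; split => x /= [Jx nz]; split => //; apply: contra_not nz.
    by move=> ->; rewrite expr0n.
  by move=> /eqP; rewrite sqrf_eq0 => /eqP.
- move=> h [mh]; rewrite L2_norm_lty// => I2.
  (* On a set of finite measure L^2 lies in L^1, here through |h| <= 1 + |h|^2. *)
  have le1 : (Int (nh h) <= Int (fun x => 1 + nrm (h x) ^+ 2)%R)%E.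
    apply: le_Int => //; first exact: measurable_normc.
      by apply: measurable_funD => //; exact: mn.
    by move=> x _; have := sqr_ge0 (nrm (h x) - 1); rewrite sqrrB expr1n; have := nh0 h x; lra.
  rewrite (le_lt_trans le1)// IntD//; last exact: mn.
  by rewrite lte_add_pinfty// /Int integral_cst// mul1e mu_J11_lty.
- move=> a h k [mh h2] [mk k2].
  have mhk : cmeasurable (@I11 R) (fun x => a * h x + k x) by apply: cmeasurableD => //; exact: cmeasurableZ.
  move: h2 k2; rewrite !L2_norm_lty// => h2 k2; pose b := 2 * nrm a ^+ 2.
  have b0 : 0 <= b by rewrite mulr_ge0// sqr_ge0.
  have bh0 y : 0 <= b * nrm (h y) ^+ 2 by rewrite mulr_ge0.
  have ck0 y : 0 <= 2 * nrm (k y) ^+ 2 by rewrite mulr_ge0.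
  have mbh : measurable_fun (@I11 R) (fun y => b * nrm (h y) ^+ 2) by apply: measurable_funM => //; exact: mn.
  have mck : measurable_fun (@I11 R) (fun y => 2 * nrm (k y) ^+ 2) by apply: measurable_funM => //; exact: mn.
  have le1 : (Int (fun x => nrm (a * h x + k x) ^+ 2)%R <=
      Int (fun x => b * nrm (h x) ^+ 2 + 2 * nrm (k x) ^+ 2)%R)%E.
    apply: le_Int (sq0 (fun x => a * h x + k x)) (mn _ mhk) (measurable_funD mbh mck) _.
    move=> x _ /=; have := normcD (a * h x) (k x); rewrite normcM /b.
    have := nh0 h x; have := normc_ge0 a; have := nh0 k x; have := normc_ge0 (a * h x + k x).
    move: (nrm (h x)) (nrm (k x)) (nrm a) (nrm (_ + _)) => p q r s s0 q0 r0 p0 le.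
    rewrite (le_trans (_ : _ <= (r * p + q) ^+ 2))//.
      by rewrite ler_pXn2r// nnegrE// addr_ge0// mulr_ge0.
    by rewrite -subr_ge0 (_ : _ - _ = (r * p - q) ^+ 2) ?sqr_ge0//; ring.
  rewrite (le_lt_trans le1)// IntD// !IntZ//; [|exact: mn|exact: mn].
  by rewrite lte_add_pinfty// lte_mul_pinfty.
- move=> z h z1 [mh hoo]; have mM := cmeasurable_Mop z mh; have le1 := Mop_le z h z1 mh.
  rewrite L2_norm_lty// in hoo; split.
    by rewrite L2_norm_lty// (le_lt_trans le1)// lte_mul_pinfty.
  rewrite !L2_norm_le// expr1n => h1; rewrite (le_trans le1)//.
  by rewrite (_ : 2 ^+ 2 = 4 * 1) ?EFinM ?lee_wpmul2l// mulr1 -natrX.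
- move=> z h z1 [mh hoo]; have mN := cmeasurable_neumann rho01 lambda_rho z1 mh.
  have le1 := neu_le z h z1 mh; rewrite L2_norm_lty// in hoo; split.
    by rewrite L2_norm_lty// (le_lt_trans le1)// lte_mul_pinfty// lee_fin sqr_ge0.
  rewrite !L2_norm_le// expr1n => h1; rewrite (le_trans le1)//.
  by rewrite -[leRHS]mule1 lee_wpmul2l// lee_fin sqr_ge0.
Qed.

End L2.

Section Linf.

(* The bound |h| <= c almost everywhere is encoded as the vanishing of the
   integral of the excess, which averaging preserves. *)
Definition excess (c : R) h y := Num.max 0 (nrm (h y) - c).

Lemma excess_ge0 c h y : 0 <= excess c h y.
Proof. by rewrite /excess le_max lexx. Qed.

Lemma normc_le_excess c h y : nrm (h y) <= c + excess c h y.
Proof. by rewrite -lerBlDl /excess le_max lexx orbT. Qed.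

Lemma excess_le c h y (e : R) : 0 <= e -> nrm (h y) <= c + e -> excess c h y <= e.
Proof. by move=> e0 hce; rewrite /excess ge_max e0 lerBlDl. Qed.

Lemma measurable_excess c h : cmeasurable (@I11 R) h -> measurable_fun (@I11 R) (excess c h).
Proof.
move=> mh; apply: measurable_maxr => //.
by apply: measurable_funB => //; exact: measurable_normc.
Qed.

Lemma negligible_set1 (c : R) : mu.-negligible [set c].
Proof. by apply/negligibleP; [exact: measurable_set1|exact: lebesgue_measure_set1]. Qed.

Lemma mu_setT_gt0 : (0 < mu [set: R])%E.
Proof.
apply: (@lt_le_trans _ _ (mu (@J11 R))); first by rewrite mu_J11.
by apply: le_measure; rewrite ?inE.
Qed.

Lemma Linf_norm_le h c : 0 <= c -> cmeasurable (@I11 R) h ->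
  (LpI11_norm +oo%E h <= c%:E)%E <-> Int (excess c h) = 0%E.
Proof.
move=> c0 mh; rewrite (Int0P (excess_ge0 c h) (measurable_excess c mh)).
rewrite /LpI11_norm unlock mu_setT_gt0; split => [/ess_supP|H].
  apply: negligibleS => x /= [Jx ex]; rewrite /patch mem_set/=; last exact: J11_I11.
  rewrite lee_fin => le; apply: ex; apply/eqP; rewrite eq_le excess_ge0 andbT excess_le// addr0.
  by rewrite (le_trans _ le)// ler_norm.
(* The norm refers to [-1, 1] and the integral to [-1, 1[; the endpoint 1 is added as a null set. *)
apply/ess_supP; apply: negligibleS (negligibleU H (negligible_set1 1)) => x /= nle.
have Ix : I11 x.
  by apply: contrapT => nIx; apply: nle; rewrite /patch memNset//= normr0 lee_fin.
have [->|x1] := eqVneq x 1; [by right|left; split].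
  by move: Ix; rewrite J11E /I11 /= in_itv /= => /andP[-> x1']; rewrite lt_neqAle x1.
apply: contra_not nle => e0; rewrite /patch mem_set//= lee_fin ger0_norm ?normc_ge0//.
by have := normc_le_excess c h x; rewrite e0 addr0.
Qed.

Lemma Linf_norm_bound h : (LpI11_norm +oo%E h < +oo)%E ->
  exists2 c, 0 <= c & (LpI11_norm +oo%E h <= c%:E)%E.
Proof.
have : (0 <= LpI11_norm +oo%E h)%E by exact: Lnorm_ge0.
by case: (LpI11_norm _ h) => [r| |]//; rewrite lee_fin => r0 _; exists r.
Qed.

Lemma Int_excess0 h : Int (excess 0 h) = Int (nh h).
Proof.
apply: eq_integral => x _; apply: congr1.
by rewrite /excess subr0; apply/max_idPr; exact: normc_ge0.
Qed.

Lemma admissible_Linf : admissible lambda rho (LpI11 +oo%E).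
Proof.
have lty h c : (LpI11_norm +oo%E h <= c%:E -> LpI11_norm +oo%E h < +oo)%E.
  by move=> le; rewrite (le_lt_trans le)// ltry.
have Mop_le z h c : nrm z = 1 -> 0 <= c -> cmeasurable (@I11 R) h ->
    (LpI11_norm +oo%E h <= c%:E)%E -> (LpI11_norm +oo%E (Mop z h) <= (2 * c)%:E)%E.
  move=> z1 c0 mh /(Linf_norm_le c0 mh) e0.
  have me := measurable_excess c mh; have ege := excess_ge0 c h.
  apply/Linf_norm_le; [by rewrite mulr_ge0|exact: cmeasurable_Mop|].
  apply: (@le_Int0 _ (fun x => 2 * avg (excess c h) x)).
  - exact: excess_ge0.
  - by apply: measurable_excess; exact: cmeasurable_Mop.
  - by apply: measurable_funM => //; exact: measurable_avg.
  - move=> x _; apply: excess_le; first by rewrite mulr_ge0// avg_ge0.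
    rewrite (le_trans (normc_Mop_le h x z1))// -mulrDr ler_pM2l//.
    have := normc_le_excess c h (half_shift (-1) x); have := normc_le_excess c h (half_shift 1 x).
    by rewrite /avg; move: (excess _ _ _) (excess _ _ _) (nrm _) (nrm _) => p q r s; lra.
  - rewrite IntZ//; [|by move=> y; exact: avg_ge0|exact: measurable_avg].
    by rewrite Int_avg// e0 mule0.
have neu_le z h c : nrm z = 1 -> 0 <= c -> cmeasurable (@I11 R) h ->
    (LpI11_norm +oo%E h <= c%:E)%E -> (LpI11_norm +oo%E (neumann rho lambda z h) <= (c / (1 - rho))%:E)%E.
  move=> z1 c0 mh /(Linf_norm_le c0 mh) e0.
  have me := measurable_excess c mh; have ege := excess_ge0 c h.
  have d0 : 0 <= c / (1 - rho) by rewrite divr_ge0// ltW.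
  have mN := cmeasurable_neumann rho01 lambda_rho z1 mh.
  apply/Linf_norm_le => //; apply/eqP; rewrite eq_le Int_ge0 ?andbT; last exact: excess_ge0.
  apply: (@le_trans _ _ (\int[mu]_(x in @J11 R) savg rho (excess c h) x)%E); last first.
    by have := integral_savg_le rho01' ege me; rewrite e0 mule0.
  apply: ge0_le_integral => //.
  - by move=> x _; rewrite lee_fin excess_ge0.
  - by apply/measurable_EFinP; apply: measurable_J11_fun; exact: measurable_excess.
  - by apply: measurable_J11_fun; exact: measurable_savg.
  move=> x _; have S0 := savg_ge0 rho01' x ege.
  (* Split |h| <= c + excess: the constant sums to at most c / (1 - rho), and the sum of the
     averaged excess has integral 0. *)
  have le1 : (savg rho (nh h) x <= (c / (1 - rho))%:E + savg rho (excess c h) x)%E.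
    apply: savg_le => // N.
    apply: (@le_trans _ _ (c / (1 - rho) + pavg rho N (excess c h) x)%:E).
      rewrite lee_fin (le_trans (_ : _ <= pavg rho N (fun y => c + excess c h y) x))//.
        by apply: ler_sum => n _; elim: {n}(nat_of_ord n) x {S0} => [|n IH] x /=;
          [exact: normc_le_excess|rewrite ler_wpM2l//; [case/andP: rho01'|rewrite le_avg]].
      by rewrite pavgD lerD2r pavg_cst_le.
    by rewrite EFinD leeD2l// pavg_le_savg.
  have := le_trans (normc_neumann_le rho01 lambda_rho h x z1) le1.
  case: (savg rho (excess c h) x) S0 => [s| |]//; last by move=> _ _; exact: leey.
  by rewrite !lee_fin => s0 le2; exact: excess_le.
apply: (@admissible_LpI11 _ _ _ _ _ (1 / (1 - rho))).
- move=> h mh; rewrite -Int_excess0 -(Linf_norm_le (lexx 0) mh).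
  by split => [->//|H]; apply/eqP; rewrite eq_le H Lnorm_ge0.
- move=> h [mh /Linf_norm_bound[c c0 /(Linf_norm_le c0 mh) e0]].
  have me := measurable_excess c mh; have ege := excess_ge0 c h.
  apply: (@le_lt_trans _ _ (Int (fun x => c + excess c h x))).
    apply: le_Int => //; [exact: measurable_normc|exact: measurable_funD|].
    by move=> x _; exact: normc_le_excess.
  rewrite IntD// e0 adde0 /Int integral_cst// lte_mul_pinfty//; exact: mu_J11_lty.
- move=> a h k [mh /Linf_norm_bound[c c0 /(Linf_norm_le c0 mh) e0]]
    [mk /Linf_norm_bound[d d0 /(Linf_norm_le d0 mk) e1]].
  have mhk : cmeasurable (@I11 R) (fun x => a * h x + k x) by apply: cmeasurableD => //; exact: cmeasurableZ.
  have me := measurable_excess c mh; have ege := excess_ge0 c h.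
  have me' := measurable_excess d mk; have ege' := excess_ge0 d k.
  have a0 := normc_ge0 a.
  have ae0 y : 0 <= nrm a * excess c h y by rewrite mulr_ge0.
  have mae : measurable_fun (@I11 R) (fun y => nrm a * excess c h y) by exact: measurable_funM.
  apply: (lty _ (nrm a * c + d)); apply/Linf_norm_le => //; first by rewrite addr_ge0// mulr_ge0.
  apply: (@le_Int0 _ (fun x => nrm a * excess c h x + excess d k x)).
  - exact: excess_ge0.
  - exact: measurable_excess.
  - exact: measurable_funD.
  - move=> x _; apply: excess_le; first by rewrite addr_ge0.
    rewrite (le_trans (normcD _ _))// normcM addrACA -mulrDr lerD//.
      by rewrite ler_wpM2l// normc_le_excess.
    exact: normc_le_excess.
  - by rewrite IntD// IntZ// e0 e1 mule0 adde0.
- move=> z h z1 [mh hoo]; split; last first.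
    by move=> h1; rewrite -[2]mulr1; exact: Mop_le.
  have [c c0 hc] := Linf_norm_bound hoo; exact: (lty _ _ (Mop_le z h c z1 c0 mh hc)).
- move=> z h z1 [mh hoo]; split; last by move=> h1; exact: neu_le.
  have [c c0 hc] := Linf_norm_bound hoo; exact: (lty _ _ (neu_le z h c z1 c0 mh hc)).
Qed.

End Linf.

End LebesgueSpaces.

(** * Uniform convergence and the space of continuous functions *)

Section UniformSeries.
Variable R : realType.
Local Notation nrm := (@normc R).

Lemma csum_tail (u : nat -> R[i]) (c r : R) N : 0 <= r < 1 -> (forall n, nrm (u n) <= c * r ^+ n) ->
  nrm (csum u - series u N) <= c * r ^+ N / (1 - r).
Proof.
move=> r01 uc.
have uN k : forall n, nrm (u (k + n)%N) <= (c * r ^+ k) * r ^+ n.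
  by move=> n; rewrite -mulrA -exprD.
suff -> : csum u - series u N = csum (fun n => u (N + n)%N) by apply: csum_geometric_le (uN N).
apply/eqP; rewrite subr_eq; apply/eqP; elim: N => [|N IH].
  by rewrite /series /= big_geq// addr0.
rewrite IH (csum_recl (dominated_geometric r01 (uN N))) addn0 seriesSr addrC addrA.
rewrite [RHS]addrC; apply: congr1.
by apply: eq_csum => n; rewrite addSnnS.
Qed.

(** The Weierstrass test along an arbitrary filter: it serves for the continuity of the Neumann
    series within [-1, 1] and for limits in omega. *)
Lemma cvg_csum_uniform (T : Type) (F : set_system T) {FF : Filter F}
    (u : nat -> T -> R[i]) (l : nat -> R[i]) (c r : R) :
  0 <= r < 1 -> (\forall t \near F, forall n, nrm (u n t) <= c * r ^+ n) ->
  (forall n, nrm (l n) <= c * r ^+ n) ->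
  (forall n, (fun t => u n t : R[i]^o) @ F --> (l n : R[i]^o)) ->
  (fun t => csum (u ^~ t) : R[i]^o) @ F --> (csum l : R[i]^o).
Proof.
move=> r01 uc lc ul; apply/cvgc_normc/cvgrPdist_le => e e0.
have e3 : 0 < e / 3 by rewrite divr_gt0.
have r1 : `|r| < 1 by case/andP: r01 => r0 r1; rewrite ger0_norm.
have /cvgrPdist_le/(_ _ e3)[N _ HN] := cvg_geometric (c / (1 - r)) r1.
have {HN} := HN N (leqnn N); rewrite sub0r normrN /= => HN.
have tail v : (forall n, nrm (v n) <= c * r ^+ n) -> nrm (csum v - series v N) <= e / 3.
  move=> vc; rewrite (le_trans (csum_tail N r01 vc))// (le_trans _ HN)//.
  by rewrite (le_trans _ (ler_norm _))// mulrAC.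
have ser : (fun t => series (u ^~ t) N : R[i]^o) @ F --> (series l N : R[i]^o).
  elim: {HN tail} N => [|N IH].
    under eq_fun do rewrite /series /= big_geq//.
    by rewrite /series /= big_geq//; exact: cvgc_cst.
  by under eq_fun do rewrite seriesSr; rewrite seriesSr; apply: cvgcD; [exact: IH|exact: ul].
move/cvgc_normc/cvgrPdist_le : ser => /(_ _ e3).
apply: filterS2 uc => t uct; rewrite !sub0r !normrN ger0_norm ?normc_ge0// => ht.
rewrite ger0_norm ?normc_ge0//.
have -> : csum (u ^~ t) - csum l = (csum (u ^~ t) - series (u ^~ t) N) +
    (series (u ^~ t) N - series l N) + (series l N - csum l).
  by rewrite !addrA subrK subrK.
rewrite (le_trans (normcD _ _))// (_ : e = e / 3 + e / 3 + e / 3); last by field.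
rewrite lerD//; last by rewrite normcB; exact: tail.
by rewrite (le_trans (normcD _ _))// lerD// tail.
Qed.

End UniformSeries.

Section ContinuousFunctions.
Variables (R : realType) (lambda : R[i]) (rho : R).
Local Notation nrm := (@normc R).
Hypothesis rho01 : 0 < rho < 1.
Hypothesis lambda_rho : nrm lambda <= rho.
Implicit Types (x c : R) (z a : R[i]) (h g k : R -> R[i]).
Let rho01' : 0 <= rho < 1. Proof. by case/andP: rho01 => /ltW ->. Qed.
Let rho1 : 0 < 1 - rho. Proof. by rewrite subr_gt0; case/andP: rho01. Qed.
Let mI := @measurable_I11 R.
Local Notation I := (@I11 R).
Local Hint Resolve mI : core.

Definition within_I11 h := forall x, I x -> (fun y => h y : R[i]^o) @ within I (nbhs x) --> (h x : R[i]^o).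

Lemma CI11P h : fcarrier (CI11 R) h <-> within_I11 h.
Proof. exact: (subspace_continuousP I (h : R -> R[i]^o)). Qed.

Lemma within_I11_ReIm h : within_I11 h ->
  {within I, continuous (fun x => complex.Re (h x))} /\ {within I, continuous (fun x => complex.Im (h x))}.
Proof.
by move=> ch; split; apply/subspace_continuousP => x Ix; have /cvgcP[] := ch x Ix.
Qed.

Lemma within_I11_cmeasurable h : within_I11 h -> cmeasurable I h.
Proof.
by move=> /within_I11_ReIm[h1 h2]; split; exact: subspace_continuous_measurable_fun.
Qed.

Lemma within_I11_bounded h : within_I11 h -> exists2 c, 0 <= c & forall x, I x -> nrm (h x) <= c.
Proof.
move=> /within_I11_ReIm[h1 h2].
have bound (f : R -> R) : {within I, continuous f} -> exists c, forall x, I x -> `|f x| <= c.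
  move=> cf; have N11 : (-1 : R) <= 1 by lra.
  have [c _ cP] := EVT_max N11 cf; have [d _ dP] := EVT_min N11 cf.
  exists (`|f c| + `|f d|) => x Ix; have Ix' : x \in `[(-1 : R), 1] by exact: Ix.
  have := cP x Ix'; have := dP x Ix'; have := ler_norm (f c); have := ler_norm (- f d).
  rewrite normrN ler_norml; have := normr_ge0 (f c); have := normr_ge0 (f d).
  by move: (`|f c|) (`|f d|) (f c) (f d) (f x) => p q r s t; lra.
have [c hc] := bound _ h1; have [d hd] := bound _ h2.
exists (Num.max 0 (c + d)); first by rewrite le_max lexx.
move=> x Ix; have le := lerD (hc x Ix) (hd x Ix).
by rewrite le_max (le_trans (normc_ReIm _) le) orbT.
Qed.

Lemma within_I11_half_shift (e : R) h : e = -1 \/ e = 1 -> within_I11 h ->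
  within_I11 (fun x => h (half_shift e x)).
Proof.
move=> he ch x Ix; apply: cvg_comp (ch _ (half_shift_I11 he Ix)).
move=> P HP; have {}HP : nbhs (half_shift e x) (fun y => I y -> P y) by exact: HP.
have cs : half_shift e @ x --> half_shift e x.
  by apply: cvgM; [apply: cvgD; [exact: cvg_id|exact: cvg_cst]|exact: cvg_cst].
have H : nbhs x (fun y => I (half_shift e y) -> P (half_shift e y)) by exact: (cs _ HP).
suff : nbhs x (fun y => I y -> P (half_shift e y)) by [].
by move: H; apply: filterS => y Py Iy; apply: Py; exact: half_shift_I11.
Qed.

Lemma within_I11_lin a h k : within_I11 h -> within_I11 k -> within_I11 (fun x => a * h x + k x).
Proof.
move=> ch ck x Ix; apply: (cvgcD (f := fun y => a * h y)); last exact: ck.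
by apply: (cvgcM (f := fun=> a)); [exact: cvgc_cst|exact: ch].
Qed.

Lemma within_I11_half_op z h : within_I11 h -> within_I11 (half_op z h).
Proof.
move=> ch; have -> : half_op z h = fun x => (z^-1 / 2) * h (half_shift (-1) x) +
    (fun x => (z / 2) * h (half_shift 1 x) + 0) x.
  by apply/funext => x; rewrite addr0 half_opE mulrDl; apply: congr2; rewrite mulrAC.
apply: within_I11_lin; first by apply: within_I11_half_shift => //; left.
apply: (within_I11_lin (k := fun=> 0)); first by apply: within_I11_half_shift => //; right.
by move=> x _; exact: cvgc_cst.
Qed.

Lemma within_I11_iter_half_op n z h : within_I11 h -> within_I11 (iter n (half_op z) h).
Proof.
move=> ch; elim: n => [|n IH]; first exact: ch.
by rewrite iterS; exact: within_I11_half_op.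
Qed.

Lemma C_norm_le h c : 0 <= c -> (fnorm (CI11 R) h <= c%:E)%E <-> (forall x, I x -> nrm (h x) <= c).
Proof.
move=> c0; split => [H x Ix|H].
  rewrite -lee_fin (le_trans _ H)//; apply: ereal_sup_ubound; by exists x.
by apply: ge_ereal_sup => _ [x Ix <-]; rewrite lee_fin; exact: H.
Qed.

Lemma averages_finite_bounded h c : 0 <= c -> (forall x, I x -> nrm (h x) <= c) ->
  forall x, I x -> averages_finite rho h x.
Proof.
move=> c0 hc x Ix; apply/(savg_ltyP rho01 x (fun y => normc_ge0 (h y))); exists (c / (1 - rho)) => N.
by rewrite (le_trans (le_pavg rho01' N hc Ix))// pavg_cst_le.
Qed.

Lemma normc_neumann_bounded z h c x : nrm z = 1 -> 0 <= c -> (forall x, I x -> nrm (h x) <= c) ->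
  I x -> nrm (neumann rho lambda z h x) <= c / (1 - rho).
Proof.
move=> z1 c0 hc Ix; rewrite -lee_fin (le_trans (normc_neumann_le rho01 lambda_rho h x z1))//.
apply: savg_le => // [y|N]; first exact: normc_ge0.
by rewrite lee_fin (le_trans (le_pavg rho01' N hc Ix))// pavg_cst_le.
Qed.

(** A continuous function on the closed interval is bounded, so its averages are finite at every
    point and the Neumann series converges uniformly there. *)
Lemma within_I11_neumann z h : nrm z = 1 -> within_I11 h -> within_I11 (neumann rho lambda z h).
Proof.
move=> z1 ch x Ix; have [c c0 hc] := within_I11_bounded ch.
have fin := averages_finite_bounded c0 hc.
have term_le n y : I y -> nrm (lambda ^+ n * iter n (half_op z) h y) <= c * rho ^+ n.
  move=> Iy; rewrite (le_trans (normc_iter_half_op_le n h y z1 lambda_rho))//.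
  elim: n y Iy => [|n IH] y Iy /=; first by rewrite mulr1 hc.
  rewrite exprS [leRHS]mulrCA ler_wpM2l//; first by case/andP: rho01'.
  have := IH _ (half_shift_I11 (or_introl erefl) Iy); have := IH _ (half_shift_I11 (or_intror erefl) Iy).
  by rewrite /avg; move: (wavg _ _ _ _) (wavg _ _ _ _) => p q; lra.
rewrite neumannE; last exact: fin.
have H : (fun y => csum (fun n => lambda ^+ n * iter n (half_op z) h y) : R[i]^o) @ within I (nbhs x) -->
    (csum (fun n => lambda ^+ n * iter n (half_op z) h x) : R[i]^o).
  apply: (cvg_csum_uniform (u := fun n y => lambda ^+ n * iter n (half_op z) h y) rho01' (c := c)).
  - suff : nbhs x (fun y => I y -> forall n, nrm (lambda ^+ n * iter n (half_op z) h y) <= c * rho ^+ n) by [].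
    by apply: filterE => y Iy n; exact: term_le.
  - by move=> n; exact: term_le.
  - move=> n; apply: (cvgcM (f := fun=> lambda ^+ n)); first exact: cvgc_cst.
    have Wn : within_I11 (iter n (half_op z) h) by exact: within_I11_iter_half_op.
    exact: (Wn x Ix).
apply: cvg_trans H; apply: near_eq_cvg.
suff : nbhs x (fun y => I y -> csum (fun n => lambda ^+ n * iter n (half_op z) h y) =
    neumann rho lambda z h y) by [].
by apply: filterE => y Iy; rewrite neumannE//; exact: fin.
Qed.

Lemma admissible_C : admissible lambda rho (CI11 R).
Proof.
have feqE f g : (forall x, I x -> f x = g x) -> feq (CI11 R) f g.
  move=> fg; apply/eqP; rewrite eq_le; apply/andP; split.
    by apply/C_norm_le => // x Ix; rewrite fg// subrr normc0.
  (* The supremum is nonnegative because the interval is not empty: evaluate at 0. *)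
  apply: (@le_trans _ _ (nrm (f 0 - g 0))%:E); first by rewrite lee_fin normc_ge0.
  by apply: ereal_sup_ubound; exists 0 => //; rewrite /I11 /= in_itv /= lerN10 ler01.
split.
- by move=> h /CI11P; exact: within_I11_cmeasurable.
- move=> h /CI11P ch; have [c c0 hc] := within_I11_bounded ch.
  apply: (@le_lt_trans _ _ (Int (fun=> c))).
    apply: le_Int => //; first by move=> y; exact: normc_ge0.
      by apply: measurable_normc; exact: within_I11_cmeasurable.
    by move=> x /J11_I11; exact: hc.
  rewrite /Int integral_cst; last exact: measurable_J11.
  by rewrite lte_mul_pinfty// mu_J11_lty.
- by move=> a h k /CI11P ch /CI11P ck; apply/CI11P; exact: within_I11_lin.
- move=> z h z1 /CI11P ch; split.
    apply/CI11P; have -> : Mop z h = fun x => 2 * half_op z h x + 0.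
      by apply/funext => x; rewrite addr0 /half_op mulrCA divff ?mulr1// pnatr_eq0.
    apply: (within_I11_lin (k := fun=> 0)); first exact: within_I11_half_op.
    by move=> x _; exact: cvgc_cst.
  move=> /(C_norm_le h ler01) h1; apply/C_norm_le => // x Ix.
  rewrite (le_trans (normc_Mop_le h x z1))// /avg.
  have := h1 _ (half_shift_I11 (or_introl erefl) Ix); have := h1 _ (half_shift_I11 (or_intror erefl) Ix).
  by move: (nrm _) (nrm _) => p q; lra.
- move=> f g _ _ fg; exists set0; first exact: negligible_set0.
  move=> x /J11_I11 Ix _; apply/eqP; rewrite -subr_eq0 -normc_eq0 eq_le normc_ge0 andbT.
  by move: x Ix; apply/C_norm_le => //; rewrite -[X in (X <= _)%E]/(fnorm (CI11 R) (fun x => f x - g x)) fg.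
- move=> h k f g /CI11P ch /CI11P ck _ _ fg; apply: feqE => x Ix.
  have [c c0 hc] := within_I11_bounded ch; have [d d0 kd] := within_I11_bounded ck.
  by apply: fg => //; [exact: averages_finite_bounded hc x Ix|exact: averages_finite_bounded kd x Ix].
- exists (1 / (1 - rho)) => z h z1 /CI11P ch; split; first by apply/CI11P; exact: within_I11_neumann.
  move=> /(C_norm_le h ler01) h1; apply/C_norm_le; first by rewrite divr_ge0// ltW.
  by move=> x Ix; exact: normc_neumann_bounded.
Qed.

End ContinuousFunctions.

(** * Fourier integrals and the continued fraction *)

Section ComplexTrig.
Variable R : realType.
Local Notation nrm := (@normc R).
Local Notation i := ('i%C : R[i]).
Implicit Types (z w v : R[i]) (x t phi : R).

Lemma i_neq0 : i != 0.
Proof. by rewrite eq_complex /= oner_eq0 andbF. Qed.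

Lemma normc_cexp z : nrm (cexp z) = expR (complex.Re z).
Proof.
rewrite /cexp /= !exprMn -mulrDr cos2Dsin2 mulr1 sqrtr_sqr ger0_norm//.
Qed.

Lemma cexpN z : cexp z * cexp (- z) = 1.
Proof. by rewrite -cexpD subrr cexp0. Qed.

Lemma unit_circleE t : unit_circle t = cexp (i * t%:C%C).
Proof.
rewrite /unit_circle; apply: congr1; apply/eqP.
by rewrite eq_complex ReM ImM /= !mul0r !mulr0 mul1r subr0 add0r !eqxx.
Qed.

Lemma ccosN z : ccos (- z) = ccos z.
Proof. by rewrite /ccos mulrN opprK addrC. Qed.

Lemma csinN z : csin (- z) = - csin z.
Proof. by rewrite /csin mulrN opprK -[RHS]mulNr opprB. Qed.

Lemma csincN z : csinc (- z) = csinc z.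
Proof. by rewrite /csinc oppr_eq0 csinN invrN mulrNN. Qed.

Lemma ccos0 : ccos (0 : R[i]) = 1.
Proof. by rewrite /ccos mulr0 oppr0 cexp0 -mulr2n -mulr_natl mulfV ?mulr1// pnatr_eq0. Qed.

Lemma csinc0 : csinc (0 : R[i]) = 1. Proof. by rewrite /csinc eqxx. Qed.

Lemma csinc_half_alg (K : fieldType) (a b j w : K) : (2 : K) != 0 -> j != 0 -> w != 0 ->
  (a * a - b * b) / (2 * j) / w = (a - b) / (2 * j) / (w / 2) * ((a + b) / 2).
Proof. by move=> t0 j0 w0; field; rewrite t0 j0 w0. Qed.

Lemma csinc_half w : csinc w = csinc (w / 2) * ccos (w / 2).
Proof.
have two0 : (2 : R[i]) != 0 by rewrite pnatr_eq0.
have [->|w0] := eqVneq w 0; first by rewrite mul0r csinc0 ccos0 mulr1.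
have w20 : w / 2 != 0 by rewrite mulf_neq0// invr_neq0.
have wE : i * w = i * (w / 2) + i * (w / 2) by rewrite -mulrDr -splitr.
rewrite /csinc (negbTE w0) (negbTE w20) /csin /ccos.
rewrite [X in cexp X - _]wE [X in _ - cexp (- X)]wE opprD !cexpD.
by apply: csinc_half_alg => //; exact: i_neq0.
Qed.

Lemma exp2C_neq0 n : (2 : R[i]) ^+ n != 0. Proof. by rewrite expf_neq0// pnatr_eq0. Qed.

Lemma half_pow w n : w / 2 ^+ n / 2 = w / 2 ^+ n.+1.
Proof. by rewrite exprSr invfM mulrA. Qed.

(** The finite form of the product of Viete and Euler, by repeated use of the double angle
    formula. *)
Lemma csinc_prod w n : csinc w = csinc (w / 2 ^+ n) * \prod_(1 <= j < n.+1) ccos (w / 2 ^+ j).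
Proof.
elim: n => [|n IH]; first by rewrite big_geq// expr0 divr1 mulr1.
rewrite IH csinc_half half_pow [in RHS]big_nat_recr//= -mulrA; apply: congr1.
exact: mulrC.
Qed.

Lemma Re_le_normc z : complex.Re z <= nrm z.
Proof. by rewrite (le_trans (ler_norm _))// normc_Re. Qed.

Lemma normcN z : nrm (- z) = nrm z.
Proof. by apply: complexI; rewrite -!normcE normrN. Qed.

Lemma normci : nrm i = 1. Proof. by rewrite /= expr0n /= add0r expr1n sqrtr1. Qed.

Lemma Re_iD t z : complex.Re (i * (t%:C%C + z)) = complex.Re (i * z).
Proof. by case: z => a b; rewrite /= !(mul0r, mul1r, add0r). Qed.

(** A real shift only rotates the two exponentials, so the bound is uniform in [t]. *)
Lemma normc_ccos_le t z : nrm (ccos (t%:C%C + z)) <= expR (nrm z).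
Proof.
rewrite /ccos normcM normcV normc2 ler_pdivrMr//.
rewrite (le_trans (normcD _ _))// !normc_cexp ReN Re_iD.
have zi : nrm (i * z) = nrm z by rewrite normcM normci mul1r.
have h1 : expR (complex.Re (i * z)) <= expR (nrm z) by rewrite ler_expR -zi Re_le_normc.
have h2 : expR (- complex.Re (i * z)) <= expR (nrm z).
  by rewrite ler_expR -zi -normcN -ReN Re_le_normc.
by rewrite mulr_natr mulr2n lerD.
Qed.

Definition expi w x : R[i] := cexp (i * (w * x%:C%C)).

Lemma Re_expi w x : complex.Re (expi w x) =
  expR (- (complex.Im w * x)) * cos (complex.Re w * x).
Proof.
rewrite /expi /cexp /=; case: w => a b /=.
by rewrite !(mulr0, mul0r, mul1r, addr0, subr0, add0r, sub0r).
Qed.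

Lemma Im_expi w x : complex.Im (expi w x) =
  expR (- (complex.Im w * x)) * sin (complex.Re w * x).
Proof.
rewrite /expi /cexp /=; case: w => a b /=.
by rewrite !(mulr0, mul0r, mul1r, addr0, subr0, add0r, sub0r).
Qed.

Lemma continuous_Re_expi w : continuous (fun x => complex.Re (expi w x)).
Proof.
under eq_fun do rewrite Re_expi; move=> x; apply: cvgM.
  apply: continuous_comp; last exact: continuous_expR.
  by apply: cvgN; apply: cvgM; [exact: cvg_cst|exact: cvg_id].
apply: continuous_comp; last exact: continuous_cos.
by apply: cvgM; [exact: cvg_cst|exact: cvg_id].
Qed.

Lemma continuous_Im_expi w : continuous (fun x => complex.Im (expi w x)).
Proof.
under eq_fun do rewrite Im_expi; move=> x; apply: cvgM.
  apply: continuous_comp; last exact: continuous_expR.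
  by apply: cvgN; apply: cvgM; [exact: cvg_cst|exact: cvg_id].
apply: continuous_comp; last exact: continuous_sin.
by apply: cvgM; [exact: cvg_cst|exact: cvg_id].
Qed.

Lemma cmeasurable_expi w (D : set R) : cmeasurable D (expi w).
Proof.
split; apply: measurable_funTS; apply: continuous_measurable_fun.
  exact: continuous_Re_expi.
exact: continuous_Im_expi.
Qed.

Lemma normc_expi_le w x : `|x| <= 1 -> nrm (expi w x) <= expR (nrm w).
Proof.
move=> x1; rewrite normc_cexp ler_expR (le_trans (Re_le_normc _))//.
by rewrite !normcM normci mul1r normc_real ler_piMr// normc_ge0.
Qed.

Lemma cintegrable_expi w : cintegrable (@J11 R) (expi w).
Proof.
apply: (@bounded_cintegrable_J11 _ _ (expR (nrm w))); first exact: cmeasurable_expi.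
by move=> x; rewrite J11E => /andP[h1 /ltW h2]; apply: normc_expi_le; rewrite ler_norml h1.
Qed.

Lemma expi_primitive_alg (p q a b u v : R) : - (p * b) - q * a = 1 -> p * a - q * b = 0 ->
  p * (- b * u - a * v) - q * (a * u - b * v) = u /\
  p * (a * u - b * v) + q * (- b * u - a * v) = v.
Proof.
move=> h1 h2; split.
  transitivity ((- (p * b) - q * a) * u - (p * a - q * b) * v); first by ring.
  by rewrite h1 h2 mul1r mul0r subr0.
transitivity ((- (p * b) - q * a) * v + (p * a - q * b) * u); first by ring.
by rewrite h1 h2 mul1r mul0r addr0.
Qed.

Lemma is_derive_expi w x :
  is_derive x (1 : R) (fun y => complex.Re (expi w y))
    (- complex.Im w * complex.Re (expi w x) - complex.Re w * complex.Im (expi w x)) /\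
  is_derive x (1 : R) (fun y => complex.Im (expi w y))
    (complex.Re w * complex.Re (expi w x) - complex.Im w * complex.Im (expi w x)).
Proof.
have -> : (fun y => complex.Re (expi w y)) =
    fun y => expR (- (complex.Im w * y)) * cos (complex.Re w * y).
  by apply/funext => y; rewrite Re_expi.
have -> : (fun y => complex.Im (expi w y)) =
    fun y => expR (- (complex.Im w * y)) * sin (complex.Re w * y).
  by apply/funext => y; rewrite Im_expi.
rewrite Re_expi Im_expi; split; apply: is_derive_eq; rewrite /GRing.scale /=; ring.
Qed.

Lemma csinc_alg (K : fieldType) (A B j v : K) : (2 : K) != 0 -> j != 0 -> v != 0 ->
  (j * v)^-1 * (A - B) = 2 * ((A - B) / (2 * j) / v).
Proof. by move=> t0 j0 v0; field; rewrite t0 j0 v0. Qed.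

Lemma cintegral_expi w : cintegral (@J11 R) (expi w) = 2 * csinc w.
Proof.
have [->|w0] := eqVneq w 0.
  rewrite csinc0 mulr1 (eq_cintegral (g := fun=> 1)).
    by rewrite cintegral_J11_cst mulr1.
  by move=> x _; rewrite /expi mul0r mulr0 cexp0.
rewrite -(cintegral_I11 (cintegrable_expi w)).
pose c := (i * w)^-1.
have iw0 : i * w != 0 by rewrite mulf_neq0// i_neq0.
have c1 : c * (i * w) = 1 by rewrite mulVf.
have := congr1 (@complex.Re R) c1; have := congr1 (@complex.Im R) c1.
rewrite !(ReM, ImM) /= !(mul0r, mul1r, add0r, sub0r, subr0) => h2 h1.
have d x := is_derive_expi w x.
have h1' : - (complex.Re c * complex.Im w) - complex.Im c * complex.Re w = 1 by rewrite -h1; ring.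
have h2' : complex.Re c * complex.Re w - complex.Im c * complex.Im w = 0 by rewrite -h2; ring.
pose FR x := complex.Re c * complex.Re (expi w x) - complex.Im c * complex.Im (expi w x).
pose FI x := complex.Re c * complex.Im (expi w x) + complex.Im c * complex.Re (expi w x).
have dR (x : R) : is_derive x (1 : R) FR (complex.Re (expi w x)).
  have [d1 d2] := d x; have [E _] := expi_primitive_alg (complex.Re (expi w x)) (complex.Im (expi w x)) h1' h2'.
  by apply: is_derive_eq E.
have dI (x : R) : is_derive x (1 : R) FI (complex.Im (expi w x)).
  have [d1 d2] := d x; have [_ E] := expi_primitive_alg (complex.Re (expi w x)) (complex.Im (expi w x)) h1' h2'.
  by apply: is_derive_eq E.
have N11 : (-1 : R) < 1 by lra.
rewrite /cintegral /I11 (Rintegral_FTC N11 (@continuous_Re_expi w) dR)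
  (Rintegral_FTC N11 (@continuous_Im_expi w) dI).
transitivity (c * (expi w 1 - expi w (-1))).
  apply/eqP; rewrite eq_complex /= !(ReM, ImM, ReB, ImB) /FR /FI.
  by apply/andP; split; apply/eqP; ring.
rewrite /csinc (negbTE w0) /csin /expi /c rmorphN1 rmorph1 mulr1 mulrN1 mulrN.
by apply: csinc_alg => //; rewrite ?pnatr_eq0// i_neq0.
Qed.

End ComplexTrig.

Section FourierCosine.
Variables (R : realType) (lambda : R[i]).
Hypothesis lambda_lt1 : `|lambda| < 1.
Local Notation nrm := (@normc R).
Local Notation i := ('i%C : R[i]).
Implicit Types (w v : R[i]) (x t phi : R) (n : nat).
Let mJ := @measurable_J11 R.
Local Hint Resolve mJ : core.
Let r01 : 0 <= nrm lambda < 1.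
Proof. by rewrite normc_ge0 -ltcR -normcE. Qed.

Lemma half_op_expi t w (a : R[i]) :
  half_op (unit_circle t) (fun x => a * expi w x) =
  fun x => a * ccos (t%:C%C + w / 2) * expi (w / 2) x.
Proof.
apply/funext => x; rewrite half_opE unit_circleV !unit_circleE /ccos /expi.
have E (e : R) : cexp (i * (w * (half_shift e x)%:C%C)) =
    cexp (i * (w / 2 * e%:C%C)) * cexp (i * (w / 2 * x%:C%C)).
  rewrite -cexpD; apply: congr1; rewrite -mulrDr; apply: congr1.
  by rewrite -mulrDr /half_shift rmorphM rmorphD /= fmorphV rmorph_nat [RHS]mulrAC -mulrA addrC.
rewrite !E rmorphN rmorphN1 rmorph1 mulr1 mulrN1 !mulrN.
have -> : cexp (i * (t%:C%C + w / 2)) = cexp (i * t%:C%C) * cexp (i * (w / 2)) by rewrite -cexpD mulrDr.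
have -> : cexp (- (i * (t%:C%C + w / 2))) = cexp (- (i * t%:C%C)) * cexp (- (i * (w / 2))).
  by rewrite -cexpD mulrDr opprD.
move: (cexp (- (i * t%:C%C))) (cexp (i * t%:C%C)) (cexp (- (i * (w / 2)))) (cexp (i * (w / 2))).
move: (cexp (i * (w / 2 * x%:C%C))) 2^-1 => e d A B C D; ring.
Qed.

Definition ccos_prod t w n : R[i] := \prod_(1 <= j < n.+1) ccos (t%:C%C + w / 2 ^+ j).

Lemma iter_half_op_expi t w (a : R[i]) n :
  iter n (half_op (unit_circle t)) (fun x => a * expi w x) =
  fun x => a * ccos_prod t w n * expi (w / 2 ^+ n) x.
Proof.
elim: n => [|n IH] /=.
  by apply/funext => x; rewrite /ccos_prod big_geq// mulr1 expr0 divr1.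
rewrite IH half_op_expi; apply/funext => x; rewrite half_pow /ccos_prod [in RHS]big_nat_recr//=.
by rewrite mulrA.
Qed.

Lemma Cfun_termE t w n : Cfun_term lambda t w n =
  lambda ^+ n * csinc (w / 2 ^+ n) * ccos_prod t w n.
Proof. by []. Qed.

Lemma cintegral_iter_expi t w n :
  cintegral (@J11 R) (iter n (half_op (unit_circle t)) (fun x => 2^-1 * expi w x)) =
  csinc (w / 2 ^+ n) * ccos_prod t w n.
Proof.
rewrite iter_half_op_expi cintegralZ//; last exact: cintegrable_expi.
rewrite cintegral_expi mulrAC mulrA; have : (2 : R[i]) != 0 by rewrite pnatr_eq0.
by move: (csinc _) (ccos_prod _ _ _) => a b t0; rewrite mulVf// mul1r.
Qed.

Lemma ccos_prodNN t w n : ccos_prod (- t) (- w) n = ccos_prod t w n.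
Proof.
apply: eq_bigr => j _; rewrite -[RHS]ccosN opprD rmorphN; apply: congr1; apply: congr1.
by rewrite mulNr.
Qed.

(** The terms of the series are unchanged when phi and omega change sign together. Reversing the
    orientation of the circle therefore gives the same integral for both exponentials of the cosine.
    The factor 1/2 normalises the integral of exp(i w x), which is twice [csinc]. *)
Lemma cintegral_W_expi w c : c = 1 \/ c = -1 ->
  cintegral `[- pi, pi : R] (fun phi => Cfun lambda phi w) =
  (2 * pi)%:C%C * cintegral (@J11 R) (fun x => W lambda 0 x * (2^-1 * expi (c%:C%C * w) x)).
Proof.
move=> hc; have cE : cintegrable (@J11 R) (fun x => 2^-1 * expi (c%:C%C * w) x).
  by apply: cintegrableZ => //; exact: cintegrable_expi.
rewrite -(cintegral_W_circle lambda_lt1 (- pi) hc cE).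
have -> : - pi + 2 * pi = pi :> R by ring.
apply: eq_cintegral => t _; rewrite /Cfun; apply: eq_csum => n.
rewrite Cfun_termE cintegral_iter_expi mulrA.
case: hc => ->; first by rewrite rmorph1 !mul1r.
by rewrite rmorphN1 !mulN1r ccos_prodNN mulNr csincN.
Qed.

Lemma eq_mul_sum_alg (F : fieldType) (p k a b : F) : (2 : F) != 0 -> p != 0 ->
  k = 2 * p * b -> k = 2 * p * a -> b + a = p^-1 * k.
Proof.
move=> t0 p0 kb ka; have <- : a = b by apply: (mulfI (mulf_neq0 t0 p0)); rewrite -ka.
by rewrite ka; field.
Qed.

Lemma cintegral_V_ccos w :
  cintegral (@I11 R) (fun x => V lambda x * ccos (w * x%:C%C)) =
  (pi : R)%:C%C^-1 * cintegral `[- pi, pi] (fun phi => Cfun lambda phi w).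
Proof.
have cE v : cintegrable (@J11 R) (fun x => 2^-1 * expi v x).
  by apply: cintegrableZ => //; exact: cintegrable_expi.
have cW v := cintegrable_W_mul lambda_lt1 0 (cE v).
have ccosE x : ccos (w * x%:C%C) = 2^-1 * expi (1%:C%C * w) x + 2^-1 * expi ((-1)%:C%C * w) x.
  by rewrite /ccos /expi rmorph1 rmorphN1 mul1r mulN1r mulNr mulrN -mulrDr mulrC.
pose K := cintegral `[- pi, pi : R] (fun phi => Cfun lambda phi w).
have H1 : K = (2 * pi)%:C%C * _ := cintegral_W_expi w (or_introl erefl).
have H2 : K = (2 * pi)%:C%C * _ := cintegral_W_expi w (or_intror erefl).
transitivity (cintegral (@J11 R) (fun x => W lambda 0 x * (2^-1 * expi (1%:C%C * w) x) +
    W lambda 0 x * (2^-1 * expi ((-1)%:C%C * w) x))).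
  rewrite (eq_cintegral (g := fun x => V lambda x *
      (2^-1 * expi (1%:C%C * w) x + 2^-1 * expi ((-1)%:C%C * w) x))); last first.
    by move=> x _; rewrite ccosE.
  rewrite cintegral_V_mul//; last exact: cintegrableD.
  by apply: eq_cintegral => x _; rewrite mulrDr.
rewrite cintegralD// -/K.
have p0 : (pi : R)%:C%C != 0.
  apply/eqP => /(congr1 (@complex.Re R)) /= pi0.
  by have := @pi_gt0 R; rewrite pi0 ltxx.
move: H1 H2; rewrite rmorphM /= rmorph_nat; move: (cintegral _ _) (cintegral _ _) => A B.
move: p0; move: (pi%:C%C) => p p0 H1 H2.
have two0 : (2 : R[i]) != 0 by rewrite pnatr_eq0.
exact: eq_mul_sum_alg H1 H2.
Qed.

(** The j-th factor is at most exp(|w| / 2^j), and these exponents sum to |w| (1 - 2^-n), so the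
    bound is uniform in [n] and [t]. *)
Lemma normc_expR_prod t w n : nrm (ccos_prod t w n) <= expR (nrm w).
Proof.
suff H : nrm (ccos_prod t w n) <= expR (nrm w * (1 - 2 ^- n)).
  by rewrite (le_trans H)// ler_expR ler_piMr ?normc_ge0// gerBl invr_ge0 exprn_ge0.
elim: n => [|n IH].
  by rewrite /ccos_prod big_geq// normc1 expr0 invr1 subrr mulr0 expR0.
rewrite /ccos_prod big_nat_recr//= -/(ccos_prod t w n) normcM.
have -> : nrm w * (1 - 2 ^- n.+1) = nrm w * (1 - 2 ^- n) + nrm (w / 2 ^+ n.+1).
  rewrite normcM normcV normcX normc2 exprS.
  by field; exact: exp2_neq0.
by rewrite expRD ler_pM ?normc_ge0// normc_ccos_le.
Qed.

Lemma normc_csinc_le w : nrm (csinc w) <= 2 * expR (nrm w).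
Proof.
have := @le_cintegral_J11 R (expi w) (expR (nrm w)) (cmeasurable_expi _ _).
rewrite cintegral_expi normcM normc2 => H.
rewrite -(ler_pM2l (x := 2))// (le_trans (H _))//.
  by move=> x; rewrite J11E => /andP[h1 /ltW h2]; apply: normc_expi_le; rewrite ler_norml h1.
lra.
Qed.

Lemma normc_Cfun_term_le t w (m : R) n : nrm w <= m ->
  nrm (Cfun_term lambda t w n) <= (2 * expR m * expR m) * nrm lambda ^+ n.
Proof.
move=> wm; rewrite Cfun_termE !normcM normcX -mulrA mulrC ler_wpM2r ?exprn_ge0 ?normc_ge0//.
have wn : nrm (w / 2 ^+ n) <= nrm w.
  rewrite normcM ler_piMr ?normc_ge0// normcV normcX normc2.
  by rewrite invf_le1 ?exprn_gt0// exprn_ege1// ler1n.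
rewrite ler_pM ?normc_ge0//.
  rewrite (le_trans (normc_csinc_le _))// ler_pM2l// ler_expR.
  exact: le_trans wn wm.
by rewrite (le_trans (normc_expR_prod _ _ _))// ler_expR.
Qed.

Lemma Cfun_term_dominated t w : dominated (Cfun_term lambda t w).
Proof. exact: (dominated_geometric r01 (fun n => normc_Cfun_term_le t n (lexx (nrm w)))). Qed.

Lemma cvg_Cfun t w : cvgn (series (Cfun_term lambda t w : nat -> R[i]^o)).
Proof. by apply/cvg_ex; exists (Cfun lambda t w); exact: (dominated_cvg_csum (Cfun_term_dominated t w)). Qed.

End FourierCosine.

(** * Continued fractions of Euler type *)

Section ContinuedFraction.
Variable K : fieldType.
Variables (a b q p : nat -> K).
Hypothesis bE : forall n, b n.+1 = q n.+1 + p n.+1.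
Hypothesis a1E : a 1%N = p 1%N.
Hypothesis aE : forall n, a n.+2 = q n.+1 * p n.+2.

Let recE u v n : cfrac_rec a b u v n.+1 =
  ((cfrac_rec a b u v n).2, b n.+1 * (cfrac_rec a b u v n).2 - a n.+1 * (cfrac_rec a b u v n).1).
Proof. by rewrite /=; case: (cfrac_rec a b u v n). Qed.

(** With b_n = q_n + p_n and a_n = q_(n-1) p_n, where q_0 counts as 1, the contributions of p_n
    cancel in the recurrence and only the factor q_n remains. *)
Lemma cfrac_denE n : cfrac_den a b n = \prod_(1 <= j < n.+1) q j.
Proof.
suff [] : (cfrac_rec a b 1 1 n.+1).2 = \prod_(1 <= j < n.+2) q j /\
    (cfrac_rec a b 1 1 n.+1).1 = \prod_(1 <= j < n.+1) q j by rewrite recE.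
elim: n => [|n [IH1 IH2]].
  by rewrite /= big_nat1 big_geq// !mulr1 bE a1E addrK.
split; last by rewrite recE.
rewrite recE IH1 IH2 bE aE big_nat_recr//= [in X in _ - X]mulrC.
rewrite [\prod_(1 <= j < n.+3) _]big_nat_recr//= [\prod_(1 <= j < n.+2) _]big_nat_recr//=.
by ring.
Qed.

(** Euler's correspondence: the convergents are the partial sums of the series of products of p_j /
    q_j. *)
Lemma cfrac_numE n : (forall j, q j.+1 != 0) -> cfrac_num a b n =
  cfrac_den a b n * \sum_(0 <= k < n.+1) \prod_(1 <= j < k.+1) (p j / q j).
Proof.
move=> q0.
suff [] : (cfrac_rec a b 0 1 n.+1).2 = cfrac_den a b n.+1 * \sum_(0 <= k < n.+2) \prod_(1 <= j < k.+1) (p j / q j) /\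
    (cfrac_rec a b 0 1 n.+1).1 = cfrac_den a b n * \sum_(0 <= k < n.+1) \prod_(1 <= j < k.+1) (p j / q j).
  by rewrite recE.
elim: n => [|n [IH1 IH2]].
  have s1 : \sum_(0 <= k < 1) \prod_(1 <= j < k.+1) (p j / q j) = 1 by rewrite big_nat1 big_geq.
  have s2 : \sum_(0 <= k < 2) \prod_(1 <= j < k.+1) (p j / q j) = 1 + p 1%N / q 1%N.
    by rewrite big_nat_recr//= s1 big_nat1.
  rewrite s1 s2 !cfrac_denE big_nat1 big_geq// /= mulr0 subr0 !mulr1 bE; split => //.
  by rewrite mulrDr mulr1 mulrCA divff// mulr1.
split; last by rewrite recE.
rewrite recE IH1 IH2 !cfrac_denE bE aE.
rewrite [\sum_(0 <= k < n.+3) _]big_nat_recr//= [\sum_(0 <= k < n.+2) _]big_nat_recr//=.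
rewrite [\prod_(1 <= j < n.+3) q j]big_nat_recr//= [\prod_(1 <= j < n.+2) q j]big_nat_recr//=.
rewrite [\prod_(1 <= j < n.+3) (p j / _)]big_nat_recr//= [\prod_(1 <= j < n.+2) (p j / _)]big_nat_recr//=.
move: (\prod_(1 <= j < n.+1) q j) (\prod_(1 <= j < n.+1) (p j / q j)) (\sum_(0 <= k < n.+1) _) => A B C.
by field; rewrite !q0.
Qed.

End ContinuedFraction.

Section CosineContinuedFraction.
Variables (R : realType) (lambda : R[i]).
Hypothesis lambda_lt1 : `|lambda| < 1.
Local Notation nrm := (@normc R).
Local Notation i := ('i%C : R[i]).
Implicit Types (w : R[i]) (t phi : R) (n : nat).

Lemma csinc_neq0 w : w = 0 \/ csin w != 0 -> csinc w != 0.
Proof.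
case=> [->|s0]; first by rewrite csinc0 oner_neq0.
have [->|w0] := eqVneq w 0; first by rewrite csinc0 oner_neq0.
by rewrite /csinc (negbTE w0) mulf_neq0// invr_neq0.
Qed.

Lemma prod_ccos_neq0 w n : csinc w != 0 -> \prod_(1 <= j < n.+1) ccos (w / 2 ^+ j) != 0.
Proof. by rewrite (csinc_prod w n) mulf_eq0 negb_or => /andP[]. Qed.

Lemma ccos_half_neq0 w n : csinc w != 0 -> ccos (w / 2 ^+ n.+1) != 0.
Proof. by move=> /(prod_ccos_neq0 n.+1); rewrite big_nat_recr//= mulf_eq0 negb_or => /andP[]. Qed.

Lemma cfb_eq phi w n : cfb lambda phi w n.+1 =
  ccos (w / 2 ^+ n.+1) + lambda * ccos (phi%:C%C + w / 2 ^+ n.+1).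
Proof. by []. Qed.

Lemma cfa_eq1 phi w : cfa lambda phi w 1 = lambda * ccos (phi%:C%C + w / 2 ^+ 1).
Proof. by rewrite /cfa eqxx expr1. Qed.

Lemma cfa_eq phi w n : cfa lambda phi w n.+2 =
  ccos (w / 2 ^+ n.+1) * (lambda * ccos (phi%:C%C + w / 2 ^+ n.+2)).
Proof. by rewrite /cfa -[n.+2 == 1%N]/false -mulrA mulrCA. Qed.

Lemma convergent_alg (F : fieldType) (Q P s l : F) : Q != 0 ->
  s * Q * (l * P / Q) = l * s * P.
Proof. by move=> Q0; field. Qed.

Lemma mul_divK (F : fieldType) (s x : F) : s != 0 -> x = s * x / s.
Proof. by move=> s0; rewrite mulrAC divff// mul1r. Qed.

(** By [csinc_prod], [csinc w] divided by the first k cosines is [csinc (w / 2 ^+ k)], the factor in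
    the k-th term of the series. The n-th convergent comprises the terms 0 to n, hence the index
    [n.+1]. *)
Lemma convergent_sum phi w n : csinc w != 0 ->
  cfrac_den (cfa lambda phi w) (cfb lambda phi w) n != 0 /\
  csinc w * (cfrac_num (cfa lambda phi w) (cfb lambda phi w) n /
             cfrac_den (cfa lambda phi w) (cfb lambda phi w) n) =
  series (Cfun_term lambda phi w) n.+1.
Proof.
move=> w0.
have d0 : cfrac_den (cfa lambda phi w) (cfb lambda phi w) n != 0.
  rewrite (cfrac_denE (q := fun j => ccos (w / 2 ^+ j)) (p := fun j => lambda * ccos (phi%:C%C + w / 2 ^+ j))
    (cfb_eq phi w) (cfa_eq1 phi w) (cfa_eq phi w)); exact: prod_ccos_neq0.
split => //.
rewrite (cfrac_numE (q := fun j => ccos (w / 2 ^+ j)) (p := fun j => lambda * ccos (phi%:C%C + w / 2 ^+ j))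
    (cfb_eq phi w) (cfa_eq1 phi w) (cfa_eq phi w)); last by move=> j; exact: ccos_half_neq0.
rewrite [cfrac_den _ _ _ * _]mulrC mulfK// big_distrr /=; apply: eq_bigr => k _.
rewrite Cfun_termE /ccos_prod {1}(csinc_prod w k).
have Q0 := prod_ccos_neq0 k w0.
have -> : \prod_(1 <= j < k.+1) (lambda * ccos (phi%:C%C + w / 2 ^+ j) / ccos (w / 2 ^+ j)) =
    lambda ^+ k * \prod_(1 <= j < k.+1) ccos (phi%:C%C + w / 2 ^+ j) /
    \prod_(1 <= j < k.+1) ccos (w / 2 ^+ j).
  by rewrite prodf_div big_split /= prodr_const_nat subn1.
move: Q0; move: (\prod_(1 <= j < k.+1) ccos (w / _)) (\prod_(1 <= j < k.+1) ccos (_ + _)) (csinc _) (lambda ^+ k).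
exact: convergent_alg.
Qed.

Lemma cfrac_cvg_Cfun phi w : csinc w != 0 ->
  cfrac_cvg (cfa lambda phi w) (cfb lambda phi w) (Cfun lambda phi w / csinc w).
Proof.
move=> w0; split; first by apply: nearW => n; have [] := convergent_sum phi n w0.
have -> : (fun n => cfrac_num (cfa lambda phi w) (cfb lambda phi w) n /
     cfrac_den (cfa lambda phi w) (cfb lambda phi w) n) =
    fun n => series (Cfun_term lambda phi w) n.+1 * (csinc w)^-1.
  apply/funext => n; have [_ <-] := convergent_sum phi n w0.
  exact: mul_divK.
apply: (cvgcM (f := fun n => series (Cfun_term lambda phi w) n.+1)); last exact: cvgc_cst.
have := dominated_cvg_csum (Cfun_term_dominated lambda_lt1 phi w).
by rewrite -(cvg_shiftS (series (Cfun_term lambda phi w) : nat -> R[i]^o)).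
Qed.

Lemma cfrac_val_Cfun phi w : csinc w != 0 ->
  csinc w * cfrac_val (cfa lambda phi w) (cfb lambda phi w) = Cfun lambda phi w.
Proof.
move=> w0; have [_ H] := cfrac_cvg_Cfun phi w0.
by rewrite /cfrac_val (cvgc_lim H) mulrC divfK.
Qed.

End CosineContinuedFraction.

(** * Continuity in omega at the zeros of the sine *)

Section CosineContinuity.
Variables (R : realType) (lambda : R[i]).
Hypothesis lambda_lt1 : `|lambda| < 1.
Local Notation nrm := (@normc R).
Local Notation i := ('i%C : R[i]).
Implicit Types (w v : R[i]) (t phi : R) (n : nat).
Let r01 : 0 <= nrm lambda < 1.
Proof. by rewrite normc_ge0 -ltcR -normcE. Qed.

Lemma csin_add_alg (K : fieldType) (j A B C D : K) : (2 : K) != 0 -> j != 0 ->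
  (A * C - B * D) / (2 * j) =
  (A - B) / (2 * j) * ((C + D) / 2) + (A + B) / 2 * ((C - D) / (2 * j)).
Proof. by move=> t0 j0; field; rewrite t0 j0. Qed.

Lemma csin_add w v : csin (w + v) = csin w * ccos v + ccos w * csin v.
Proof.
rewrite /csin /ccos mulrDr opprD !cexpD.
have t0 : (2 : R[i]) != 0 by rewrite pnatr_eq0.
exact: csin_add_alg t0 (i_neq0 R).
Qed.

Lemma ccos_neq0 w : csin w = 0 -> ccos w != 0.
Proof.
move=> s0; apply/eqP => c0; have := cexpN (i * w).
have t0 : (2 : R[i]) != 0 by rewrite pnatr_eq0.
move: s0 c0; rewrite /csin /ccos; move: (cexp _) (cexp _) => A B.
move=> /eqP; rewrite mulf_eq0 invr_eq0 mulf_eq0 (negbTE t0) (negbTE (i_neq0 R)) !orbF subr_eq0 => /eqP ->.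
move=> /eqP; rewrite mulf_eq0 invr_eq0 (negbTE t0) orbF -mulr2n -mulr_natl mulf_eq0 (negbTE t0) /= => /eqP ->.
by rewrite mul0r => /esym/eqP; rewrite oner_eq0.
Qed.

(* sin v = 0 forces exp(2 i v) = 1, hence Im v = 0 and cos (2 Re v) = 1. *)
Lemma csin_neq0 v : v != 0 -> nrm v <= 1 -> csin v != 0.
Proof.
move=> v0 v1; apply/eqP => s0.
have t0 : (2 : R[i]) != 0 by rewrite pnatr_eq0.
have E : cexp (i * v + i * v) = 1.
  have := cexpN (i * v); rewrite cexpD; move: s0; rewrite /csin; move: (cexp _) (cexp _) => A B.
  by move=> /eqP; rewrite mulf_eq0 invr_eq0 mulf_eq0 (negbTE t0) (negbTE (i_neq0 R)) !orbF subr_eq0 => /eqP ->.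
have := congr1 nrm E; rewrite normc_cexp normc1 => N1.
have /eqP : complex.Re (i * v + i * v) = 0 by apply: expR_inj; rewrite N1 expR0.
have := congr1 (@complex.Re R) E; rewrite {1}/cexp /= N1 mul1r.
have := normc_Re v; move: v0 v1; case: v {s0 E N1} => a b v0 v1 /= a1.
rewrite !(mul0r, mul1r, add0r, sub0r, subr0) => ca; rewrite -opprD oppr_eq0 -mulr2n mulrn_eq0 /= => /eqP b0.
have {}a1 : `|a| <= 1 by rewrite (le_trans a1).
have ca' : cos `|a + a| = cos 0.
  by rewrite cos0; have [_|_] := ger0P (a + a); rewrite ?cosN.
(* As |a| <= 1, the argument lies in [0, 2] and hence in [0, pi], where the cosine is injective. *)
have : `|a + a| = 0.
  apply: cos_inj ca'; rewrite in_itv /= ?lexx ?pi_ge0// normr_ge0 (le_trans _ (pi_ge2 R))//.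
  by rewrite (le_trans (ler_normD _ _))//; lra.
move=> /normr0_eq0/eqP; rewrite -mulr2n mulrn_eq0 /= => /eqP a0.
by move/eqP: v0; apply; rewrite a0 b0.
Qed.

Section Limit.
Variables (T : Type) (F : set_system T).
Context {FF : Filter F}.
Variables (f : T -> R[i]) (l : R[i]).
Hypothesis fl : (fun x => f x : R[i]^o) @ F --> (l : R[i]^o).

Lemma cvg_cexp : (fun x => cexp (f x) : R[i]^o) @ F --> (cexp l : R[i]^o).
Proof.
have /cvgcP[fR fI] := fl; apply/cvgcP; rewrite /cexp /=; split; apply: cvgM.
- exact: cvg_comp fR (@continuous_expR R _).
- exact: cvg_comp fI (@continuous_cos R _).
- exact: cvg_comp fR (@continuous_expR R _).
- exact: cvg_comp fI (@continuous_sin R _).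
Qed.

End Limit.

Section Limits.
Variables (T : Type) (F : set_system T).
Context {FF : Filter F}.
Variables (f : T -> R[i]) (l : R[i]).
Hypothesis fl : (fun x => f x : R[i]^o) @ F --> (l : R[i]^o).

Let cvgZ (c : R[i]) (g : T -> R[i]) m : (fun x => g x : R[i]^o) @ F --> (m : R[i]^o) ->
  (fun x => c * g x : R[i]^o) @ F --> (c * m : R[i]^o).
Proof. by move=> gm; apply: (cvgcM (f := fun=> c)) gm; exact: cvgc_cst. Qed.

Let cvgZr (c : R[i]) (g : T -> R[i]) m : (fun x => g x : R[i]^o) @ F --> (m : R[i]^o) ->
  (fun x => g x * c : R[i]^o) @ F --> (m * c : R[i]^o).
Proof. by move=> gm; apply: cvgcM gm _; exact: cvgc_cst. Qed.

Let cvgN1 (g : T -> R[i]) m : (fun x => g x : R[i]^o) @ F --> (m : R[i]^o) ->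
  (fun x => - g x : R[i]^o) @ F --> (- m : R[i]^o).
Proof. exact: cvgN. Qed.

Lemma cvg_ccos : (fun x => ccos (f x) : R[i]^o) @ F --> (ccos l : R[i]^o).
Proof.
apply: cvgZr; apply: cvgcD; apply: cvg_cexp; first exact: cvgZ.
exact/cvgN1/cvgZ.
Qed.

Lemma cvg_csinc : l != 0 -> (\forall x \near F, f x != 0) ->
  (fun x => csinc (f x) : R[i]^o) @ F --> (csinc l : R[i]^o).
Proof.
move=> l0 f0; have H : (fun x => csin (f x) * (f x)^-1 : R[i]^o) @ F --> (csin l * l^-1 : R[i]^o).
  apply: cvgcM; last exact: (@cvgV R[i] T F FF f l l0 fl).
  apply: cvgZr; apply: cvgcD; first by apply: cvg_cexp; exact: cvgZ.
  by apply: cvgN1; apply: cvg_cexp; exact/cvgN1/cvgZ.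
rewrite {2}/csinc (negbTE l0); apply: cvg_trans H; apply: near_eq_cvg.
by apply: filterS f0 => x fx0; rewrite /csinc (negbTE fx0).
Qed.

End Limits.

Lemma cvg_Cfun_omega (F : set_system R[i]) {FF : Filter F} phi w : w != 0 ->
  (fun v => v : R[i]^o) @ F --> (w : R[i]^o) ->
  (fun v => Cfun lambda phi v : R[i]^o) @ F --> (Cfun lambda phi w : R[i]^o).
Proof.
move=> w0 Fw; have near_le (e : R) : 0 < e -> \forall v \near F, nrm (v - w) <= e.
  move=> e0; have /cvgc_normc/cvgrPdist_le/(_ _ e0) := Fw; apply: filterS => v.
  by rewrite sub0r normrN ger0_norm ?normc_ge0.
have w1 : nrm w <= nrm w + 1 by rewrite lerDl.
(* The terms are dominated uniformly on the disc |v - w| <= 1, where |v| <= |w| + 1. *)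
apply: (cvg_csum_uniform (u := fun n v => Cfun_term lambda phi v n) r01
  (c := 2 * expR (nrm w + 1) * expR (nrm w + 1))).
- apply: filterS (near_le 1 ltr01) => v vw n; apply: normc_Cfun_term_le.
  by rewrite -[v](subrK w) (le_trans (normcD _ _))// addrC lerD2l.
- by move=> n; exact: normc_Cfun_term_le.
have v0 : \forall v \near F, v != 0.
  have w20 : 0 < nrm w / 2 by rewrite divr_gt0// lt_neqAle normc_ge0 eq_sym normc_eq0 w0.
  apply: filterS (near_le _ w20) => v; apply: contraTneq => ->.
  by rewrite sub0r normcN -ltNge; lra.
have shift n : (fun v => v / 2 ^+ n : R[i]^o) @ F --> (w / 2 ^+ n : R[i]^o).
  by apply: cvgcM Fw _; exact: cvgc_cst.
move=> n; apply: cvgcM; first apply: cvgcM; first exact: cvgc_cst.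
- apply: cvg_csinc; [exact: shift|by rewrite mulf_neq0// invr_neq0// exp2C_neq0|].
  by apply: filterS v0 => v v0; rewrite mulf_neq0// invr_neq0// exp2C_neq0.
- elim: n => [|n IH].
    have E v : \prod_(1 <= j < 1) ccos (phi%:C%C + v / 2 ^+ j) = 1 by rewrite big_geq.
    rewrite E (_ : (fun v => _) = fun=> 1); first exact: cvgc_cst.
    by apply/funext => v; exact: E.
  have E v : \prod_(1 <= j < n.+2) ccos (phi%:C%C + v / 2 ^+ j) =
      \prod_(1 <= j < n.+1) ccos (phi%:C%C + v / 2 ^+ j) * ccos (phi%:C%C + v / 2 ^+ n.+1).
    by rewrite big_nat_recr.
  under eq_fun do rewrite E; rewrite E; apply: cvgcM; first exact: IH.
  by apply: cvg_ccos; apply: cvgcD; [exact: cvgc_cst|exact: shift].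
Qed.

(** At a zero w of the sine, sin v = cos w sin(v - w) is nonzero for 0 < |v - w| <= 1. So the
    fraction represents [Cfun] on a punctured disc, and [Cfun] is continuous at w. *)
Lemma cfrac_limit phi w : w != 0 -> csin w = 0 ->
  (fun v : R[i]^o => csinc v * cfrac_val (cfa lambda phi v) (cfb lambda phi v) : R[i]^o) @ (w : R[i]^o)^'
  --> (Cfun lambda phi w : R[i]^o).
Proof.
move=> w0 s0; have Fw : (fun v => v : R[i]^o) @ (w : R[i]^o)^' --> (w : R[i]^o) by exact: cvg_within.
have H : (fun v : R[i]^o => Cfun lambda phi v : R[i]^o) @ (w : R[i]^o)^' --> (Cfun lambda phi w : R[i]^o).
  exact: cvg_Cfun_omega w0 Fw.
have near1 : \forall v \near (w : R[i]^o)^', nrm (v - w) <= 1.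
  have /cvgc_normc/cvgrPdist_le/(_ _ ltr01) := Fw; apply: filterS => v.
  by rewrite sub0r normrN ger0_norm ?normc_ge0.
have E : \forall v \near (w : R[i]^o)^', (Cfun lambda phi v : R[i]^o) =
    csinc v * cfrac_val (cfa lambda phi v) (cfb lambda phi v).
  apply: filterS2 (nbhs_dnbhs_neq (w : R[i]^o)) near1 => v vw v1.
  have sv : csin v != 0.
    rewrite -[v](subrK w) addrC csin_add s0 mul0r add0r mulf_neq0 ?ccos_neq0//.
    by apply: csin_neq0 => //; rewrite subr_eq0.
  by rewrite cfrac_val_Cfun// csinc_neq0//; right.
exact: cvg_trans (near_eq_cvg E) H.
Qed.

End CosineContinuity.

Theorem theorem2p1 (R : realType) (lambda : R[i]) (hlambda : `|lambda| < 1) :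
  (* (i) *)
  [/\ forall (N : nat) (P : {poly R[i]}), (size P <= N.+1)%N ->
        cintegral (@I11 R) (fun x => P.[V lambda x])
        = 2 / (\prod_(1 <= n < N.+1) sqrtc (1 - lambda ^+ (2 * n)))
          * \det (Amx lambda N P),
      forall N : nat, (1 <= N)%N ->
        cintegral (@I11 R) (fun x => V lambda x ^+ N)
        = 2 / (\prod_(1 <= n < N.+1) sqrtc (1 - lambda ^+ (2 * n)))
          * \det (Amx_minor lambda N),
      forall N : nat, (1 <= N)%N ->
        cintegral (@I11 R) (fun x => V lambda x ^+ N)
        = (sqrtc (1 - lambda ^+ (2 * N)))^-1
          * (2 + \sum_(1 <= n < N)
                   'C(N, n)%:R * (1 - sqrtc (1 - lambda ^+ (2 * n)))
                   * cintegral (@I11 R) (fun x => V lambda x ^+ n)),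
      forall N : nat, (1 <= N)%N ->
        (1 - sqrtc (1 - lambda ^+ (2 * N)))
        * cintegral (@I11 R) (fun x => V lambda x ^+ N)
        = cintegral (@I11 R) (fun x => (V lambda x - 1) ^+ N)
    & (* there are no chains with k > N *)
      forall N : nat, (1 <= N)%N ->
        cintegral (@I11 R) (fun x => V lambda x ^+ N)
        = 2 * \sum_(1 <= k < N.+1)
                \sum_(c : k.+1.-tuple 'I_N.+1 | is_chain c)
                  chain_term lambda c]
  /\
  (* (ii) *)
  (forall E : fspace R,
     [\/ E = LpI11 2%:E, E = LpI11 +oo%E | E = CI11 R] ->
     [/\ forall z : R[i], `|z| = 1 ->
           bounded_op E (Mop z) /\ (opnorm E (Mop z) <= 2%:E)%E,
         exists S : R[i] -> (R -> R[i]) -> (R -> R[i]),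
           (forall z : R[i], `|z| = 1 ->
              is_inverse_op E (Top lambda z) (S z)) /\
           (forall h : R -> R[i], fcarrier E h ->
              circle_measurable (fun z => S z h))
       & forall S : R[i] -> (R -> R[i]) -> (R -> R[i]),
           (forall z : R[i], `|z| = 1 ->
              is_inverse_op E (Top lambda z) (S z)) ->
           forall h : R -> R[i], fcarrier E h ->
           circle_measurable (fun z => S z h) ->
           cintegral (@I11 R) (fun x => V lambda x * h x)
           = cintegral (@I11 R) (fun x =>
               circle_integral (fun z =>
                 S z h x / (2 * (pi : R)%:C%C * 'i%C * z)))])
  /\
  (* (iii) *)
  [/\ forall (N : nat) (P : {poly R[i]}), ~~ odd N -> (size P <= N.+1)%N ->
        cintegral (@I11 R) (fun x => V lambda x * P.[x%:C%C])
        = \sum_(0 <= j < N.+1) Bcoef lambda N j * \det (Bmx lambda N P j),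
      forall N : nat, ~~ odd N ->
        cintegral (@I11 R) (fun x => V lambda x * x%:C%C ^+ N)
        = \sum_(0 <= j < N.+1) Bcoef lambda N j * \det (Bmx_minor lambda N j)
    & forall N : nat, odd N ->
        cintegral (@I11 R) (fun x => V lambda x * x%:C%C ^+ N) = 0]
  /\
  (* (iv) *)
  (forall omega : R[i],
     [/\ cintegral (@I11 R) (fun x => V lambda x * ccos (omega * x%:C%C))
         = (pi : R)%:C%C^-1
           * cintegral `[- pi, pi] (fun phi => Cfun lambda phi omega),
         forall phi : R,
           cvgn (series (Cfun_term lambda phi omega : nat -> R[i]^o)),
         (* outside the zeros of sin, and at 0 *)
         omega = 0 \/ csin omega != 0 -> forall phi : R,
           exists2 l : R[i],
             cfrac_cvg (cfa lambda phi omega) (cfb lambda phi omega) l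
             & Cfun lambda phi omega = csinc omega * l
       & (* at the other zeros of sin the right-hand side has the form
            0 * oo and is understood by continuity in omega *)
         omega != 0 -> csin omega = 0 -> forall phi : R,
           (fun w : R[i]^o =>
              csinc w * cfrac_val (cfa lambda phi w) (cfb lambda phi w)
              : R[i]^o) @ (omega : R[i]^o)^'
             --> (Cfun lambda phi omega : R[i]^o)]).
Proof.
have [nl0 nl1] : 0 <= normc lambda /\ normc lambda < 1.
  by rewrite normc_ge0 -ltcR -normcE.
(* The midpoint of |lambda| and 1: at least |lambda|, below 1, and positive even when lambda = 0. *)
pose rho := (1 + normc lambda) / 2.
have rho01 : 0 < rho < 1 by apply/andP; split; rewrite /rho; lra.
have lambda_rho : normc lambda <= rho by rewrite /rho; lra.
have nrm1 (z : R[i]) : normc z = 1 -> `|z| = 1 by rewrite normcE => ->.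
have nrm1' (z : R[i]) : `|z| = 1 -> normc z = 1.
  by rewrite normcE => z1; exact: complexI z1.
have prodE N : \prod_(1 <= n < N.+1) root1B lambda n =
    \prod_(1 <= n < N.+1) sqrtc (1 - lambda ^+ (2 * n)).
  by apply: eq_bigr => n _; rewrite root1BE.
split.
  split=> [N P sP|N N1|N N1|N N1|N N1].
  - by rewrite -prodE; exact: cintegral_V_det.
  - by rewrite -prodE; exact: cintegral_VX_det.
  - rewrite -root1BE cintegral_VX_recurrence//; apply: congr1; apply: congr1.
    by apply: eq_bigr => n _; rewrite root1BE.
  - by rewrite -root1BE; exact: cintegral_V_sub1.
  - exact: cintegral_VX_chains.
split.
  move=> E HE; have admE : admissible lambda rho E.
    by case: HE => ->; [exact: admissible_L2|exact: admissible_Linf|exact: admissible_C].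
  split=> [z /nrm1' z1||S SP h Eh mS].
  - exact: bounded_op_Mop admE z z1.
  - exists (neumann rho lambda); split=> [z /nrm1' z1|h Eh].
      exact: is_inverse_op_neumann.
    by apply: circle_measurable_neumann => //; exact: adm_cmeasurable admE h Eh.
  - by apply: (cintegral_V_resolvent hlambda admE) => // z /nrm1; exact: SP.
split.
  split=> [N P _ sP|N _|N oN].
  - exact: cintegral_V_poly.
  - exact: cintegral_V_Xn.
  - exact: cintegral_V_odd.
move=> omega; split.
- exact: cintegral_V_ccos.
- by move=> phi; exact: cvg_Cfun.
- move=> /csinc_neq0 s0 phi; exists (Cfun lambda phi omega / csinc omega).
    exact: cfrac_cvg_Cfun.
  by rewrite [RHS]mulrA; exact: mul_divK.
- by move=> w0 s0 phi; exact: cfrac_limit.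
Qed.
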